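(* The standard Gaussian measure $\gamma$ on $\mathbb R^n$ satisfies the refined Talagrand inequality $$W_2^2(h\gamma,\gamma)\le\frac12\int\Delta h\,d\gamma+n\left(1-\exp\left(\frac1{2n}\int\Delta h\,d\gamma-\frac1n\,\mathrm{Ent}_\gamma(h)\right)\right)$$ for all probability densities $h$ with respect to $\gamma$. This inequality implies the classical Talagrand inequality $$W_2^2(h\gamma,\gamma)\le\mathrm{Ent}_\gamma(h)$$ for all probability densities $h$ with respect to $\gamma$, and the refined Poincaré inequality $$\mathrm{Var}_\gamma(f)\le\int|\nabla f|^2\,d\gamma-\frac1{2n}\left(\int\Delta f\,d\gamma\right)^2$$ for all smooth functions $f$.
   Context: $\mathbb R^n$ carries the Euclidean distance. The Wasserstein distance is normalized with the factor $\frac12$: $W_2(\nu,\mu)=\inf_\pi\sqrt{\int\frac{|x-y|^2}{2}\,d\pi(x,y)}$, the infimum being over probability measures $\pi$ on $\mathbb R^n\times\mathbb R^n$ with marginals $\nu$ and $\mu$. $\mathrm{Ent}_\gamma(h)=\int h\log h\,d\gamma-\int h\,d\gamma\,\log\int h\,d\gamma$ and $\mathrm{Var}_\gamma(f)=\int f^2d\gamma-(\int f\,d\gamma)^2$. For a probability density $h$ with respect to $\gamma$, $\int\Delta h\,d\gamma$ equals $\int|x|^2h(x)\,d\gamma(x)-n$ by integration by parts when $h$ is smooth, and is understood as $\int|x|^2h(x)\,d\gamma(x)-n$ when $h$ is not smooth. *)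

(* Defs.v *)
From HB Require Import structures.
From mathcomp Require Import all_boot all_order all_algebra.
From mathcomp Require Import all_classical all_reals all_analysis.

Set Implicit Arguments.
Unset Strict Implicit.
Unset Printing Implicit Defensive.

Import Order.TTheory GRing.Theory Num.Theory.
Import numFieldNormedType.Exports.

Local Open Scope classical_set_scope.
Local Open Scope ring_scope.

(* The library puts no sigma-algebra on row vectors.  The one below is
   generated by the coordinates (as for [n.-tuple T] in the library); it is the
   Borel sigma-algebra of R^n. *)
Definition rV_display : measure_display -> measure_display.
Proof. exact. Qed.

Section rV_measurable.
Context (R : realType) (n : nat).

Definition rV_coord (i : 'I_n) (x : 'rV[R]_n) : R := x ord0 i.

Let rV_set0 : g_sigma_preimage rV_coord set0.
Proof. exact: sigma_algebra0. Qed.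

Let rV_setC A : g_sigma_preimage rV_coord A -> g_sigma_preimage rV_coord (~` A).
Proof. exact: sigma_algebraC. Qed.

Let rV_bigcup (F : (set 'rV[R]_n)^nat) :
  (forall i, g_sigma_preimage rV_coord (F i)) ->
  g_sigma_preimage rV_coord (\bigcup_i (F i)).
Proof. exact: sigma_algebra_bigcup. Qed.

HB.instance Definition _ :=
  @isMeasurable.Build (rV_display default_measure_display) 'rV[R]_n
    (g_sigma_preimage rV_coord) rV_set0 rV_setC rV_bigcup.

Lemma measurable_rV_coord (i : 'I_n) : measurable_fun setT (rV_coord i).
Proof.
move=> _ Y mY; rewrite setTI; apply: sub_sigma_algebra => /=.
rewrite -bigcup_seq/=; exists i => /=; first by rewrite mem_index_enum.
by exists Y => //; rewrite setTI.
Qed.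

Lemma measurable_fun_rV d (T : measurableType d) (f : T -> 'rV[R]_n) :
  (forall i, measurable_fun setT (rV_coord i \o f)) -> measurable_fun setT f.
Proof.
move=> mf.
have sub : g_sigma_preimage (fun i => rV_coord i \o f) `<=` measurable.
  apply: smallest_sub; first exact: sigma_algebra_measurable.
  rewrite -bigcup_seq/=; apply: bigcup_sub => i _ A [B mB <-].
  exact: mf.
rewrite g_sigma_preimage_comp in sub.
by move=> _ A mA; apply: sub; exists A.
Qed.

End rV_measurable.

Section gaussian.
Context (R : realType).

Definition cons_rV (n : nat) (p : measurableTypeR R * 'rV[R]_n) : 'rV[R]_n.+1 :=
  row_mx (const_mx p.1 : 'rV[R]_1) p.2.

Lemma measurable_cons_rV (n : nat) : measurable_fun setT (@cons_rV n).
Proof.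
apply: measurable_fun_rV => i.
case: (unliftP ord0 i) => [j|] ->.
- have -> : rV_coord (lift ord0 j) \o @cons_rV n = rV_coord j \o snd.
    apply/funext => p; rewrite /rV_coord /cons_rV /=.
    have -> : lift ord0 j = rshift 1 j :> 'I_(1 + n) by exact: val_inj.
    exact: row_mxEr.
  exact: measurableT_comp (measurable_rV_coord j) measurable_snd.
- have -> : rV_coord ord0 \o @cons_rV n = fst; last exact: measurable_fst.
  apply/funext => p; rewrite /rV_coord /cons_rV /=.
  transitivity
    (row_mx (const_mx p.1 : 'rV[R]_1) p.2 ord0 (lshift n (ord0 : 'I_1))).
    by congr fun_of_matrix; exact: val_inj.
  by rewrite row_mxEl mxE.
Qed.

HB.instance Definition _ (n : nat) :=
  isMeasurableFun.Build _ _ _ _ (@cons_rV n) (@measurable_cons_rV n).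

(* The standard Gaussian measure N(0, I_n), as the n-fold product of N(0, 1). *)
Fixpoint gaussian (n : nat) : probability 'rV[R]_n R :=
  match n with
  | 0 => dirac (0 : 'rV[R]_0)
  | m.+1 => distribution (normal_prob 0 1 \x gaussian m)%E (@cons_rV m)
  end.

End gaussian.

Section functionals.
Context (R : realType).
Local Open Scope ereal_scope.

(* Extended-real valued; [ln 0 = 0], so that [0 log 0 = 0]. *)
Definition Ent d (T : measurableType d) (mu : {measure set T -> \bar R})
    (h : T -> R) : \bar R :=
  \int[mu]_x (h x * ln (h x))%:E
    - (\int[mu]_x (h x)%:E) * lne (\int[mu]_x (h x)%:E).

Definition Var d (T : measurableType d) (mu : {measure set T -> \bar R})
    (f : T -> R) : \bar R :=
  \int[mu]_x (f x ^+ 2)%:E - (\int[mu]_x (f x)%:E) ^+ 2.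

Definition probability_density d (T : measurableType d)
    (mu : {measure set T -> \bar R}) (h : T -> R) : Prop :=
  [/\ measurable_fun setT h, forall x, (0 <= h x)%R
    & \int[mu]_x (h x)%:E = 1].

Definition density_measure d (T : measurableType d)
    (mu : {measure set T -> \bar R}) (h : T -> R) : set T -> \bar R :=
  fun A => \int[mu]_(x in A) (h x)%:E.

(* The squared Euclidean norm ([`|x|] is the sup norm on row vectors). *)
Definition sqnorm (n : nat) (x : 'rV[R]_n) : R := (\sum_i x ord0 i ^+ 2)%R.

Definition coupling (n : nat) (nu mu : set 'rV[R]_n -> \bar R)
    (pi : probability ('rV[R]_n * 'rV[R]_n)%type R) : Prop :=
  forall A : set 'rV[R]_n, measurable A ->
    pushforward pi fst A = nu A /\ pushforward pi snd A = mu A.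

Definition W2 (n : nat) (nu mu : set 'rV[R]_n -> \bar R) : \bar R :=
  ereal_inf [set sqrte (\int[pi]_p (sqnorm (p.1 - p.2) / 2)%:E)
            | pi in coupling nu mu].

(* [\int Delta h d gamma] for a density [h], understood through integration by
   parts so that no smoothness of [h] is needed. *)
Definition density_laplacian (n : nat) (h : 'rV[R]_n -> R) : \bar R :=
  \int[gaussian R n]_x (sqnorm x * h x)%:E - n%:R%:E.

End functionals.

Section smooth.
Context (R : realType) (n : nat).
Implicit Types (f : 'rV[R]_n -> R) (x : 'rV[R]_n).

Definition partial (i : 'I_n) f x : R := 'D_(delta_mx ord0 i) f x.

Fixpoint class_C (k : nat) f : Prop :=
  continuous f /\
  if k is k'.+1 then
    forall i, (forall x, derivable f x (delta_mx ord0 i)) /\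
              class_C k' (partial i f)
  else True.

Definition smooth f : Prop := forall k, class_C k f.

Definition gradient f x : 'rV[R]_n := \row_i partial i f x.

Definition laplacian f x : R := \sum_i partial i (partial i f) x.

End smooth.

Section inequalities.
Context (R : realType) (n : nat).
Local Open Scope ereal_scope.
Let gamma := gaussian R n.

(* All densities are allowed.  If the second moment of [h] is infinite then so is
   its entropy, and the exponent has the form [+oo - +oo], which is [-oo] in the
   library: the right-hand side is then [+oo]. *)
Definition refined_Talagrand : Prop :=
  forall h : 'rV[R]_n -> R, probability_density gamma h ->
    W2 (density_measure gamma h) gamma ^+ 2 <=
      2^-1%:E * density_laplacian h
      + n%:R%:E * (1 - expeR ((2 * n%:R)^-1%:E * density_laplacian h
                              - n%:R^-1%:E * Ent gamma h)).

Definition classical_Talagrand : Prop :=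
  forall h : 'rV[R]_n -> R, probability_density gamma h ->
    W2 (density_measure gamma h) gamma ^+ 2 <= Ent gamma h.

(* [Delta f] must be integrable for the last term to make sense; the other two
   integrals may be infinite. *)
Definition refined_Poincare : Prop :=
  forall f : 'rV[R]_n -> R, smooth f ->
    gamma.-integrable setT (EFin \o laplacian f) ->
    Var gamma f <=
      \int[gamma]_x (sqnorm (gradient f x))%:E
      - (2 * n%:R)^-1%:E * (\int[gamma]_x (laplacian f x)%:E) ^+ 2.

End inequalities.

(* Main.v *)
From HB Require Import structures.
From mathcomp Require Import all_boot all_order all_algebra.
From mathcomp Require Import all_classical all_reals all_analysis.
From mathcomp Require Import measurable_realfun lebesgue_integral.
From mathcomp Require Import ring lra.
Require Import Defs.

(** Everything rests on one identity for the standard Gaussian measure on the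
   line: the kernel [kappa s y z], which is [|y - z|] if [s] is between [y] and
   [z] and [0] otherwise, has mean [2 * phi s] when [y] and [z] are independent
   and Gaussian ([kappa_integral]).  It is integration by parts in a form that
   applies to monotone maps without differentiating them.

   Refined Talagrand inequality.  On the line let [S] be the monotone map that
   transports a density [m] to the Gaussian measure.  Since [S] is monotone, the
   kernel identity bounds the mean of [S'] under [m] by the covariance of [x] and
   [S x]; as [S'] is given by the Monge-Ampere equation
   [S' x = exp (x^2 / 2 - (S x)^2 / 2 - ln (m x))], this reads
   [cost (S) + \int S' <= \int (x^2 + 1) / 2] ([transport_cost1],
   [quantile_transport_cost]).  In dimension [n] the densities are disintegrated
   and the one-dimensional maps are assembled in the triangular Knothe map.  Its
   costs add up, and the arithmetic-geometric mean inequality replaces the sum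
   of the diagonal derivatives by [n] times the [n]-th root of the Jacobian
   determinant ([gaussian_transport]).  The determinant is again given by the
   Monge-Ampere equation, so Jensen's inequality for the exponential yields the
   exponential of the Laplacian and the entropy ([transport_gain_ge],
   [refined_talagrand_gaussian]).

   The classical inequality follows from [1 - exp t <= - t]
   ([classical_of_refined]).

   Refined Poincare inequality.  The same kernel and Cauchy-Schwarz give the
   Poincare inequality on the line ([poincare1]), which tensorizes
   ([sqr_incr_tensor], [poincare_gaussian]).  Applied to [f - c * |x|^2] it
   becomes a quadratic inequality in [c].  Integration by parts
   ([gaussian_divergence]) computes [\int x . grad f = \int Delta f] and
   [\int |x|^2 f = \int Delta f + n * \int f], and the value
   [c = \int Delta f / (2 * n)] yields the refined inequality
   ([refined_poincare_sobolev]). *)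

Set Implicit Arguments.
Unset Strict Implicit.
Unset Printing Implicit Defensive.
Import Order.TTheory GRing.Theory Num.Theory.
Import numFieldNormedType.Exports.
Import HBNNSimple.
Local Open Scope classical_set_scope.
Local Open Scope ring_scope.

(** * Integration against a density *)
Section density.
Context d (T : measurableType d) (R : realType).
Variables (mu nu : {measure set T -> \bar R}) (h : T -> R).
Hypotheses (mh : measurable_fun [set: T] h) (h0 : forall x, 0 <= h x).
Hypothesis nuE : forall A, measurable A -> nu A = (\int[mu]_(x in A) (h x)%:E)%E.
Local Open Scope ereal_scope.

(** Monotone convergence through the simple functions that increase to [f]
   reduces the change of measure to the case of an indicator. *)
Lemma ge0_integral_density (f : T -> \bar R) : measurable_fun [set: T] f ->
  (forall x, 0 <= f x) -> \int[nu]_x f x = \int[mu]_x (f x * (h x)%:E).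
Proof.
move=> mf f0.
pose g := nnsfun_approx measurableT mf.
have gf x : (g n x)%:E @[n --> \oo] --> f x by exact: cvg_nnsfun_approx.
have g_nd x m n : (m <= n)%N -> (g m x <= g n x)%R.
  by move=> mn; exact/lefP/nd_nnsfun_approx.
transitivity (limn (fun n => \int[nu]_x (g n x)%:E)).
  rewrite -monotone_convergence//; last 3 first.
  - by move=> n; exact/measurable_EFinP.
  - by move=> n x _; rewrite lee_fin.
  - by move=> x _ m n mn; rewrite lee_fin; exact: g_nd.
  by apply: eq_integral => x _; apply/esym/cvg_lim => //; exact: gf.
transitivity (limn (fun n => \int[mu]_x ((g n x)%:E * (h x)%:E))); last first.
  rewrite -monotone_convergence//; last 3 first.
  - by move=> n; apply: emeasurable_funM; exact/measurable_EFinP.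
  - by move=> n x _; rewrite mule_ge0 ?lee_fin.
  - by move=> x _ m n mn; rewrite lee_wpmul2r ?lee_fin//; exact: g_nd.
  apply: eq_integral => x _; apply/cvg_lim => //.
  by apply: cvgeZr => //; exact: gf.
congr (limn _); apply/funext => n.
under eq_integral do rewrite fimfunE -fsumEFin//.
rewrite ge0_integral_fsum//; last 2 first.
  - by move=> r; exact/measurable_EFinP/measurableT_comp.
  - by move=> r x _; exact: nnfun_muleindic_ge0.
under [RHS]eq_integral.
  move=> x _; rewrite fimfunE -fsumEFin// ge0_mule_fsuml; last first.
    by move=> r; exact: nnfun_muleindic_ge0.
  over.
rewrite [RHS]ge0_integral_fsum//; last 2 first.
  - move=> r; apply: emeasurable_funM; last exact/measurable_EFinP.
    exact/measurable_EFinP/measurableT_comp.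
  - by move=> r x _; rewrite mule_ge0 ?lee_fin//; exact: nnfun_muleindic_ge0.
apply: eq_fsbigr => r /set_mem [x0 _ <-].
have step (k : R) A : (0 <= k)%R -> measurable A ->
    \int[nu]_x (k * \1_A x)%:E = \int[mu]_x ((k * \1_A x)%:E * (h x)%:E).
  move=> k0 mA; have m1 : measurable_fun [set: T] (fun x => (\1_A x)%:E : \bar R).
    exact/measurable_EFinP/measurable_indic.
  under eq_integral do rewrite EFinM.
  rewrite ge0_integralZl//.
  rewrite integral_indic// setIT nuE//.
  under [RHS]eq_integral do rewrite EFinM -muleA.
  rewrite [RHS]ge0_integralZl//; last 2 first.
  - by apply: emeasurable_funM => //; exact/measurable_EFinP.
  - by move=> x _; rewrite mule_ge0 ?lee_fin.
  congr (_ * _); rewrite integral_mkcond; apply: eq_integral => x _.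
  by rewrite patchE indicE; case: ifPn => _; rewrite ?mul1e ?mul0e.
apply: step; last exact: measurable_sfunP.
by [].
Qed.

End density.

Section integral_helpers.
Context d (T : measurableType d) (R : realType) (mu : {measure set T -> \bar R}).
Local Open Scope ereal_scope.

Lemma ge0_integralMl (D : set T) (k : R) (f : T -> \bar R) :
  measurable D -> (0 <= k)%R ->
  measurable_fun D f -> (forall x, D x -> 0 <= f x) ->
  \int[mu]_(x in D) (k%:E * f x) = k%:E * \int[mu]_(x in D) f x.
Proof. by move=> mD k0 mf f0; rewrite ge0_integralZl ?lee_fin. Qed.

Lemma ge0_le_integralT (f g : T -> \bar R) :
  measurable_fun [set: T] f -> measurable_fun [set: T] g ->
  (forall x, 0 <= f x) -> (forall x, f x <= g x) ->
  \int[mu]_x f x <= \int[mu]_x g x.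
Proof. by move=> mf mg f0 fg; apply: ge0_le_integral. Qed.

Lemma ge0_integralDT (f g : T -> \bar R) :
  measurable_fun [set: T] f -> measurable_fun [set: T] g ->
  (forall x, 0 <= f x) -> (forall x, 0 <= g x) ->
  \int[mu]_x (f x + g x) = \int[mu]_x f x + \int[mu]_x g x.
Proof. by move=> mf mg f0 g0; rewrite ge0_integralD. Qed.

Lemma ge0_integral_prod (f g : T -> \bar R) :
  measurable_fun [set: T] f -> measurable_fun [set: T] g ->
  (forall x, 0 <= f x) -> (forall x, 0 <= g x) ->
  \int[mu]_z \int[mu]_y (f y * g z) = (\int[mu]_y f y) * (\int[mu]_z g z).
Proof.
move=> mf mg f0 g0; under eq_integral => z _ do rewrite ge0_integralZr//.
by rewrite ge0_integralZl//; exact: integral_ge0.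
Qed.

End integral_helpers.

Lemma integral_prob_cst d (T : measurableType d) (R : realType)
  (P : probability T R) (k : R) : (\int[P]_x k%:E = k%:E)%E.
Proof.
transitivity (k%:E * P [set: T])%E; first exact: integral_cst.
by rewrite probability_setT mule1.
Qed.

(** * The standard Gaussian measure on the line *)
Section ftc_everywhere.
Context (R : realType).
Let mu : {measure set (measurableTypeR R) -> \bar R} := @lebesgue_measure R.
Variables (F f : R -> R).
Hypotheses (dF : forall x : R, is_derive x (1 : R) F (f x)) (cf : continuous f).

Lemma continuous_of_is_derive : continuous F.
Proof.
by move=> x; apply/differentiable_continuous/derivable1_diffP; have [] := dF x.
Qed.

Lemma integral_is_derive a b : a <= b ->
  (\int[mu]_(x in `[a, b]) (f x)%:E = (F b - F a)%:E)%E.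
Proof.
have cF := continuous_of_is_derive.
rewrite le_eqVlt => /predU1P[<-|ab].
  by rewrite set_itv1 integral_set1 subrr.
rewrite (continuous_FTC2 (F := F))//.
- exact: continuous_subspaceT.
- split => [x _||]; first by have [] := dF x.
  + exact/cvg_at_right_filter/cF.
  + exact/cvg_at_left_filter/cF.
- by move=> x _; rewrite derive1E; apply: derive_val.
Qed.

Lemma integraly_is_derive a l : (forall x, a <= x -> 0 <= f x) ->
  F x @[x --> +oo] --> l ->
  (\int[mu]_(x in `[a, +oo[) (f x)%:E = (l - F a)%:E)%E.
Proof.
have cF := continuous_of_is_derive.
move=> f0 Fl; rewrite (ge0_continuous_FTC2y (F := F) (l := l))//.
- exact: continuous_subspaceT.
- exact/cvg_at_right_filter/cF.
- by move=> x _; rewrite derive1E; apply: derive_val.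
Qed.

End ftc_everywhere.

Section gauss1.
Context (R : realType).
Local Notation leb := (@lebesgue_measure R).
Local Notation gamma1 := (@normal_prob R 0 1).
Local Notation phi := (@normal_pdf R 0 1).

Lemma phiE x : phi x = @normal_peak R 1 * expR (- (x ^+ 2 / 2)).
Proof.
by rewrite normal_pdfE// /normal_fun subr0 expr1n mulNr.
Qed.

Lemma phi_gt0 x : 0 < phi x.
Proof. by rewrite phiE mulr_gt0 ?expR_gt0// normal_peak_gt0. Qed.

Lemma phiN x : phi (- x) = phi x.
Proof. by rewrite !phiE sqrrN. Qed.

(** This ratio is the exponential that appears in the Monge-Ampere equation of
   a transport towards the Gaussian measure, see [transport_cost1]. *)
Lemma phi_ratio s x : phi s = expR (x ^+ 2 / 2 - s ^+ 2 / 2) * phi x.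
Proof. by rewrite !phiE mulrCA -expRD; congr (_ * expR _); lra. Qed.

Lemma continuous_phi : continuous phi.
Proof. exact: continuous_normal_pdf. Qed.

Lemma is_derive_phi (x : R) : is_derive x (1 : R) (phi : R -> R) (- (x * phi x)).
Proof.
rewrite (_ : (phi : R -> R) = fun x => normal_peak 1 * expR (- (x ^+ 2 / 2))); last first.
  by apply/funext => y; exact: phiE.
apply: is_derive_eq.
by rewrite /GRing.scale /=; field.
Qed.

Lemma phi_cvgy : phi x @[x --> +oo] --> (0 : R).
Proof.
rewrite (_ : (phi : R -> R) = fun x => normal_peak 1 * expR (- (x ^+ 2 / 2))); last first.
  by apply/funext => y; exact: phiE.
rewrite -[X in _ --> X](mulr0 (normal_peak 1)).
apply: cvgMl_tmp.
apply: (@squeeze_cvgr _ _ _ _ (fun=> 0) (fun x => expR (- x) : R)); last 2 first.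
- exact: cvg_cst.
- exact: cvgr_expR.
near=> x; rewrite expR_ge0 ler_expR lerN2.
have x2 : 2 <= x by near: x; exact: nbhs_pinfty_ge.
by nra.
Unshelve. all: by end_near. Qed.

Lemma gamma1E (A : set R) : gamma1 A = (\int[leb]_(x in A) (phi x)%:E)%E.
Proof. by []. Qed.

Lemma ge0_integral_gamma1 (f : R -> \bar R) :
  measurable_fun [set: R] f -> (forall x, 0 <= f x)%E ->
  (\int[gamma1]_x f x = \int[leb]_x (f x * (phi x)%:E))%E.
Proof.
move=> mf f0; apply: ge0_integral_density => //.
- exact: measurable_normal_pdf.
- by move=> x; exact: normal_pdf_ge0.
Qed.

Lemma gamma1_set1 (a : R) : gamma1 [set a] = 0%E.
Proof. by rewrite gamma1E integral_set1. Qed.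

Lemma gamma1_ray_add (s : R) : (gamma1 `]-oo, s[ + gamma1 `]s, +oo[ = 1)%E.
Proof.
have <- : gamma1 `]-oo, s] = gamma1 `]-oo, s[.
  rewrite -(@setUitv1 _ _ _ _ true)//= measureU//=; first by rewrite gamma1_set1 adde0.
  by rewrite -subset0 => x []/= /[swap] ->; rewrite in_itv/= ltxx.
have -> : `]s, +oo[%classic = ~` `]-oo, s]%classic :> set R by rewrite setCitvl.
by rewrite probability_setC//; rewrite addeC subeK// fin_num_measure.
Qed.

End gauss1.

Section gauss1_moments.
Context (R : realType).
Local Notation leb := (@lebesgue_measure R).
Local Notation gamma1 := (@normal_prob R 0 1).
Local Notation phi := (@normal_pdf R 0 1).
Local Open Scope ereal_scope.

Lemma gamma1_exp_lty : \int[gamma1]_x (expR (x ^+ 2 / 4))%:E < +oo.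
Proof.
rewrite ge0_integral_gamma1//; last first.
  apply/measurable_EFinP/measurableT_comp => //.
  by apply: measurable_funM => //; exact: measurable_funX.
have s0 : Num.sqrt 2 != 0%R :> R by rewrite sqrtr_eq0 -ltNge.
have E (x : R) : (expR (x ^+ 2 / 4))%:E * (phi x)%:E =
    (normal_peak 1 / normal_peak (Num.sqrt 2))%:E *
    (normal_pdf 0 (Num.sqrt 2) x)%:E.
  rewrite phiE normal_pdfE// -!EFinM; congr EFin.
  rewrite /normal_fun subr0 sqr_sqrtr// mulrCA -expRD -[RHS]mulrA mulKf; last first.
    by rewrite gt_eqF// normal_peak_gt0.
  by congr (_ * expR _)%R; field.
under eq_integral do rewrite E.
rewrite integralZl//; last exact: integrable_normal_pdf.
by rewrite integral_normal_pdf mule1 ltry.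
Qed.

Lemma gamma1_integrable (f : R -> R) (C : R) : measurable_fun [set: R] f ->
  (forall x, (`|f x| <= C * expR (x ^+ 2 / 4))%R) ->
  gamma1.-integrable [set: R] (EFin \o f).
Proof.
move=> mf fC.
have me : measurable_fun [set: R] (fun x : R => expR (x ^+ 2 / 4)).
  apply: measurableT_comp => //.
  by apply: measurable_funM => //; exact: measurable_funX.
have ie : gamma1.-integrable [set: R] (EFin \o (fun x : R => expR (x ^+ 2 / 4))).
  apply/integrableP; split; first exact/measurable_EFinP.
  under eq_integral do rewrite /= ger0_norm ?expR_ge0//.
  exact: gamma1_exp_lty.
apply: (le_integrable _ _ _ (integrableZl measurableT C ie)) => //.
  exact/measurable_EFinP.
by move=> x _ /=; rewrite lee_fin; apply: (le_trans (fC x)); exact: ler_norm.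
Qed.

Lemma gamma1_integrable_id : gamma1.-integrable [set: R] (EFin \o id).
Proof.
apply: (@gamma1_integrable _ 1%R) => // x; rewrite mul1r.
apply: le_trans (expR_ge1Dx _).
have := sqr_ge0 (x / 2 - 1); have := sqr_ge0 (x / 2 + 1).
by case: (ger0P x) => _; lra.
Qed.

Lemma gamma1_integrable_sqr :
  gamma1.-integrable [set: R] (EFin \o (fun x => x ^+ 2)%R).
Proof.
apply: (@gamma1_integrable _ 4%R) => [|x]; first exact: measurable_funX.
rewrite ger0_norm ?sqr_ge0//.
by have := expR_ge1Dx (x ^+ 2 / 4); lra.
Qed.

Lemma gamma1N (A : set R) : measurable A ->
  pushforward gamma1 (-%R : _ -> measurableTypeR R) A = gamma1 A.
Proof.
move=> mA; rewrite /pushforward !gamma1E.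
under eq_integral do rewrite -phiN.
transitivity (\int[pushforward leb (-%R : _ -> measurableTypeR R)]_(y in A) (phi y)%:E).
  rewrite ge0_integral_pushforward//=; last first.
    by move=> y _; rewrite lee_fin normal_pdf_ge0.
  apply/measurable_EFinP; apply: measurable_funTS; exact: measurable_normal_pdf.
by apply: eq_measure_integral => B mB _; exact: lebesgue_measureN.
Qed.

(** The mean of the Gaussian measure vanishes by this symmetry, without any
   explicit primitive on the left half-line. *)
Lemma gamma1_reflect (s : R) :
  \int[gamma1]_(y in `]-oo, s[) y%:E = - \int[gamma1]_(y in `](- s)%R, +oo[) y%:E.
Proof.
have iy : gamma1.-integrable `](- s)%R, +oo[ (EFin \o id).
  exact: (integrableS _ _ _ gamma1_integrable_id).
rewrite -integralN; last first.
  by apply: integrable_add_def.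
transitivity (\int[pushforward gamma1 (-%R : _ -> measurableTypeR R)]_(y in `](- s)%R, +oo[) (- y%:E)).
  rewrite integral_pushforward//=.
  - rewrite (_ : _ @^-1` _ = `]-oo, s[%classic :> set R); last first.
      by apply/seteqP; split => x /=; rewrite !in_itv/= andbT ltrNl opprK.
    by apply: eq_integral => y _; rewrite opprK.
  - exact/measurable_EFinP.
  - rewrite (_ : _ @^-1` _ = `]-oo, s[%classic :> set R); last first.
      by apply/seteqP; split => x /=; rewrite !in_itv/= andbT ltrNl opprK.
    rewrite (_ : _ \o _ = EFin \o id); last first.
      by apply/funext => y /=; rewrite opprK.
    exact: (integrableS _ _ _ gamma1_integrable_id).
by apply: eq_measure_integral => A mA _; exact: gamma1N.
Qed.

Lemma gamma1_split (s : R) (f : R -> \bar R) : measurable_fun [set: R] f ->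
  \int[gamma1]_y f y =
    \int[gamma1]_(y in `]-oo, s[) f y + \int[gamma1]_(y in `]s, +oo[) f y.
Proof.
move=> mf.
have -> : [set: R] = `]-oo, s[%classic `|` (`]s, +oo[%classic `|` [set s]).
  apply/seteqP; split => // x _ /=; rewrite !in_itv/= andbT.
  by case: (ltgtP x s) => H; [left|right;left|right;right].
rewrite integral_setU//=; last 3 first.
- exact: measurableU.
- exact: measurable_funTS.
- apply/disj_setPS => x [] /=; rewrite !in_itv/= andbT => xs [sx|xE].
    by have := lt_trans xs sx; rewrite ltxx.
  by move: xs; rewrite xE ltxx.
congr (_ + _); rewrite integral_setU//=; last 2 first.
- exact: measurable_funTS.
- by apply/disj_setPS => x [] /=; rewrite !in_itv/= andbT => sx xE; move: sx; rewrite xE ltxx.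
rewrite [X in _ + X]null_set_integral ?adde0//; first exact: measurable_funTS.
exact: gamma1_set1.
Qed.

Lemma gamma1_mean : \int[gamma1]_y y%:E = 0.
Proof.
rewrite (gamma1_split 0 (@EFin_measurable R setT)) gamma1_reflect oppr0.
rewrite addeC subee//; apply: integrable_fin_num => //.
exact: (integrableS _ _ _ gamma1_integrable_id).
Qed.

(** [- phi] is a primitive of [y * phi y], and the integrand has a sign on
   this half-line; the other half-lines follow from [gamma1_mean]. *)
Lemma gamma1_tail_ge0 (s : R) : (0 <= s)%R ->
  \int[gamma1]_(y in `]s, +oo[) y%:E = (phi s)%:E.
Proof.
move=> s0.
rewrite integral_mkcond ge0_integral_gamma1//; last 2 first.
- apply/(measurable_restrictT _ _).1 => //; exact/measurable_EFinP.
- move=> x; rewrite patchE; case: ifPn => //; rewrite inE/= in_itv/= andbT => xs.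
  by rewrite lee_fin (le_trans s0)// ltW.
transitivity (\int[leb]_(y in `[s, +oo[) (y * phi y)%:E).
  rewrite -integral_itv_obnd_cbnd//; last first.
    apply/measurable_EFinP/measurable_funTS/measurable_funM => //.
    exact: measurable_normal_pdf.
  rewrite [RHS]integral_mkcond; apply: eq_integral => y _.
  by rewrite !patchE; case: ifPn; rewrite ?mul0e ?EFinM.
rewrite (@integraly_is_derive _ (fun x => - phi x)%R _ _ _ _ 0%R)//.
- by rewrite opprK add0r.
- by move=> x; have := @is_derive_phi R x => ?; apply: is_derive_eq; rewrite opprK.
- move=> x; apply: cvgM; [exact: cvg_id|exact: continuous_phi].
- by move=> x sx; rewrite mulr_ge0 ?(le_trans s0 sx)// ltW// phi_gt0.
- by rewrite -[X in _ --> X]oppr0; apply: cvgN; exact: phi_cvgy.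
Qed.

Lemma gamma1_tail (s : R) : \int[gamma1]_(y in `]s, +oo[) y%:E = (phi s)%:E.
Proof.
have [s0|s0] := leP 0%R s; first exact: gamma1_tail_ge0.
have := gamma1_mean; rewrite (gamma1_split s (@EFin_measurable R setT)) gamma1_reflect.
rewrite (@gamma1_tail_ge0 (- s)%R) ?oppr_ge0 ?ltW// phiN => /eqP.
rewrite addeC sube_eq//.
  by rewrite add0e => /eqP.
apply: integrable_fin_num => //.
exact: (integrableS _ _ _ gamma1_integrable_id).
Qed.

Lemma gamma1_tailN (s : R) : \int[gamma1]_(y in `]-oo, s[) y%:E = (- phi s)%:E.
Proof. by rewrite gamma1_reflect gamma1_tail phiN. Qed.

End gauss1_moments.

(** * The interval kernel *)
Section kappa.
Context (R : realType).
Local Notation leb := (@lebesgue_measure R).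
Local Notation gamma1 := (@normal_prob R 0 1).
Local Notation phi := (@normal_pdf R 0 1).

(** The length of the interval with endpoints [y] and [z] if [s] is interior to
   it, and [0] otherwise.  Its two uses are that
   [\int_s kappa s y z * q s ds = (y - z) * \int_z^y q], and that its mean in
   [y], [z] under the Gaussian measure is [2 * phi s]: together they replace
   integration by parts for functions that need not be differentiable. *)
Definition kappa (s y z : R) : R :=
  if (z < s < y) || (y < s < z) then `|y - z| else 0.

Lemma kappa_ge0 s y z : 0 <= kappa s y z.
Proof. by rewrite /kappa; case: ifP. Qed.

Lemma kappaC s y z : kappa s y z = kappa s z y.
Proof. by rewrite /kappa orbC distrC. Qed.

Lemma measurable_kappa d (T : measurableType d) (a b c : T -> R) :
  measurable_fun [set: T] a -> measurable_fun [set: T] b ->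
  measurable_fun [set: T] c ->
  measurable_fun [set: T] (fun t => kappa (a t) (b t) (c t)).
Proof.
move=> ma mb mc; apply: measurable_fun_ifT => //.
- by apply: measurable_or; apply: measurable_and; exact: measurable_fun_ltr.
- by apply: measurableT_comp => //; exact: measurable_funB.
Qed.

Local Open Scope ereal_scope.

Lemma kappa_integral1 (s z : R) :
  \int[gamma1]_y (kappa s y z)%:E =
  (if (z < s)%R then phi s - z * fine (gamma1 `]s, +oo[)
   else if (s < z)%R then phi s + z * fine (gamma1 `]-oo, s[) else 0)%:E.
Proof.
have mk : measurable_fun [set: R] (fun y => (kappa s y z)%:E).
  by apply/measurable_EFinP; exact: measurable_kappa.
have iy D : measurable D -> gamma1.-integrable D (EFin \o id).
  by move=> mD; exact: (integrableS _ _ _ (gamma1_integrable_id R)).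
have ic D : measurable D -> gamma1.-integrable D (EFin \o cst z).
  by move=> mD; exact: finite_measure_integrable_cst.
rewrite (gamma1_split s mk).
have [zs|sz|zs] := ltgtP z s.
- rewrite (eq_integral (cst 0)); last first.
    move=> y; rewrite inE/= in_itv/= => ys.
    by rewrite /kappa zs (ltNge s y) (ltW ys)/= (ltNge s z) (ltW zs) andbF.
  rewrite integral0 add0e (eq_integral ((fun y : measurableTypeR R => y%:E - z%:E) : _ -> \bar R)); last first.
    move=> y; rewrite inE/= in_itv/= andbT => ys.
    by rewrite /kappa zs ys/= gtr0_norm ?EFinB// subr_gt0 (lt_trans zs).
  rewrite (integralB_EFin _ (iy _ _) (ic _ _))// gamma1_tail.
  by rewrite (integral_cst _ _ z%:E)// EFinB EFinM fineK// fin_num_measure.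
- rewrite [X in _ + X](eq_integral (cst 0)); last first.
    move=> y; rewrite inE/= in_itv/= andbT => ys.
    by rewrite /kappa (ltNge z s) (ltW sz) (ltNge y s) (ltW ys).
  rewrite integral0 adde0 (eq_integral ((fun y : measurableTypeR R => z%:E - y%:E) : _ -> \bar R)); last first.
    move=> y; rewrite inE/= in_itv/= => ys.
    by rewrite /kappa sz ys/= orbT ltr0_norm ?opprB ?EFinB// subr_lt0 (lt_trans ys).
  rewrite (integralB_EFin _ (ic _ _) (iy _ _))// gamma1_tailN.
  rewrite (integral_cst _ _ z%:E)// EFinN oppeK addeC.
  by rewrite EFinD EFinM fineK// fin_num_measure.
- rewrite [X in X + _](eq_integral (cst 0)); last first.
    by move=> y _; rewrite /kappa zs !ltxx/= andbF.
  rewrite [X in _ + X](eq_integral (cst 0)); last first.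
    by move=> y _; rewrite /kappa zs !ltxx/= andbF.
  by rewrite !integral0 adde0.
Qed.

(** By [kappa_integral1] the inner integral is affine in [z] on either side of
   [s], so only the masses [p], [q] and the first moments [phi s], [- phi s] of
   the two half-lines enter; the masses cancel because [p + q = 1]. *)
Lemma kappa_integral (s : R) :
  \int[gamma1]_z \int[gamma1]_y (kappa s y z)%:E = (2 * phi s)%:E.
Proof.
have iy D : measurable D -> gamma1.-integrable D (EFin \o id).
  by move=> mD; exact: (integrableS _ _ _ (gamma1_integrable_id R)).
have ic D (k : R) : measurable D -> gamma1.-integrable D (EFin \o cst k).
  by move=> mD; exact: finite_measure_integrable_cst.
under eq_integral do rewrite kappa_integral1.
have [p pE] : {p : R | gamma1 `]s, +oo[ = p%:E}.
  by exists (fine (gamma1 `]s, +oo[)); rewrite fineK// fin_num_measure.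
have [q qE] : {q : R | gamma1 `]-oo, s[ = q%:E}.
  by exists (fine (gamma1 `]-oo, s[)); rewrite fineK// fin_num_measure.
have pq : (q + p = 1)%R.
  by have := gamma1_ray_add s; rewrite pE qE -EFinD => -[].
rewrite pE qE/= (gamma1_split s); last first.
  apply/measurable_EFinP; apply: measurable_fun_ifT; first exact: measurable_fun_ltr.
    by apply: measurable_funB => //; exact: measurable_funM.
  apply: measurable_fun_ifT => //; first exact: measurable_fun_ltr.
  by apply: measurable_funD => //; exact: measurable_funM.
rewrite [X in X + _](eq_integral ((fun z : measurableTypeR R => (phi s)%:E - p%:E * z%:E) : _ -> \bar R)); last first.
  by move=> z; rewrite inE/= in_itv/= => ->; rewrite EFinB EFinM muleC.
rewrite [X in _ + X](eq_integral ((fun z : measurableTypeR R => (phi s)%:E + q%:E * z%:E) : _ -> \bar R)); last first.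
  move=> z; rewrite inE/= in_itv/= andbT => sz.
  by rewrite sz (ltNge z s) (ltW sz)/= EFinD EFinM muleC.
rewrite integralB//=; [|exact: ic|exact: (integrableZl _ _ (iy _ _))].
rewrite integralD//=; [|exact: ic|exact: (integrableZl _ _ (iy _ _))].
rewrite !integralZl//; [|exact: iy|exact: iy].
rewrite gamma1_tail gamma1_tailN.
rewrite (_ : \int[gamma1]_(_ in `]-oo, s[) _ = (phi s)%:E * q%:E); last first.
  by rewrite -qE; exact: integral_cst.
rewrite (_ : \int[gamma1]_(_ in `]s, +oo[) _ = (phi s)%:E * p%:E); last first.
  by rewrite -pE; exact: integral_cst.
rewrite -!EFinM -EFinB -!EFinD.
by congr EFin; have -> : q = (1 - p)%R by [lra]; ring.
Qed.

End kappa.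

(** * The Poincare inequality on the line *)
Section tonelli3.
Context d1 d2 (T1 : measurableType d1) (T2 : measurableType d2) (R : realType).
Variables (mu : {sigma_finite_measure set T1 -> \bar R})
  (lam : {sigma_finite_measure set T2 -> \bar R}).
Local Open Scope ereal_scope.

Lemma tonelli3 (K : T2 -> T1 -> T1 -> \bar R) :
  measurable_fun [set: T1 * T2 * T1] (fun p => K p.1.2 p.2 p.1.1) ->
  (forall t y z, 0 <= K t y z) ->
  \int[mu]_z \int[mu]_y \int[lam]_t K t y z =
  \int[lam]_t \int[mu]_z \int[mu]_y K t y z.
Proof.
move=> mK K0.
transitivity (\int[mu]_z \int[lam]_t \int[mu]_y K t y z).
  apply: eq_integral => z _.
  apply: (@fubini_tonelli _ _ _ _ _ mu lam (fun p => K p.2 p.1 z)) => //.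
  apply: (measurableT_comp mK (g := fun p : T1 * T2 => ((z, p.2), p.1))).
  by apply: measurable_fun_pair => //; exact: measurable_fun_pair.
apply: (@fubini_tonelli _ _ _ _ _ mu lam (fun p => \int[mu]_y K p.2 y p.1)).
  exact: (@measurable_fun_fubini_tonelli_F _ _ _ _ _ mu
    (fun p : T1 * T2 * T1 => K p.1.2 p.2 p.1.1)).
by move=> p; exact: integral_ge0.
Qed.

End tonelli3.

Section poincare1.
Context (R : realType).
Local Notation leb := (@lebesgue_measure R).
Local Notation gamma1 := (@normal_prob R 0 1).
Local Notation phi := (@normal_pdf R 0 1).
Local Open Scope ereal_scope.

Lemma kappa_layer_cake (q : R -> R) : measurable_fun [set: R] q ->
  (forall t, 0 <= q t)%R ->
  \int[gamma1]_z \int[gamma1]_y \int[leb]_t (kappa t y z * q t)%:E =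
  2%:E * \int[gamma1]_t (q t)%:E.
Proof.
move=> mq q0.
rewrite (@tonelli3 _ _ _ _ _ gamma1 leb (fun t y z => (kappa t y z * q t)%:E)); last 2 first.
- apply/measurable_EFinP/measurable_funM.
    by apply: measurable_kappa => //; exact: measurableT_comp.
  apply: (measurableT_comp mq); exact: measurableT_comp.
- by move=> t y z; rewrite lee_fin mulr_ge0// kappa_ge0.
rewrite ge0_integral_gamma1//; last exact/measurable_EFinP.
rewrite -ge0_integralMl//; last 2 first.
- by apply: emeasurable_funM; apply/measurable_EFinP => //; exact: measurable_normal_pdf.
- by move=> t _; rewrite mule_ge0// lee_fin// normal_pdf_ge0.
apply: eq_integral => t _.
transitivity ((q t)%:E * \int[gamma1]_z \int[gamma1]_y (kappa t y z)%:E).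
  rewrite -ge0_integralMl//; last 2 first.
  - apply: (@measurable_fun_fubini_tonelli_F _ _ _ _ _ gamma1
      (fun p : R * R => (kappa t p.2 p.1)%:E)).
      by apply/measurable_EFinP; apply: measurable_kappa.
    by move=> p; rewrite lee_fin kappa_ge0.
  - by move=> z _; apply: integral_ge0 => y _; rewrite lee_fin kappa_ge0.
  apply: eq_integral => z _.
  rewrite -ge0_integralMl//; last 2 first.
  - by apply/measurable_EFinP; exact: measurable_kappa.
  - by move=> y _; rewrite lee_fin kappa_ge0.
  by apply: eq_integral => y _; rewrite mulrC.
by rewrite kappa_integral EFinM muleCA.
Qed.

Lemma integral_kappa (q : R -> R) (z y : R) : (z < y)%R -> measurable_fun [set: R] q ->
  (forall t, 0 <= q t)%R ->
  \int[leb]_t (kappa t y z * q t)%:E = (y - z)%:E * \int[leb]_(t in `[z, y]) (q t)%:E.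
Proof.
move=> zy mq q0.
rewrite integral_itv_bndoo//; last exact/measurable_EFinP/measurable_funTS.
rewrite -ge0_integralMl//; last 3 first.
- by rewrite subr_ge0 ltW.
- exact/measurable_EFinP/measurable_funTS.
- by move=> t _; rewrite lee_fin.
rewrite [RHS]integral_mkcond; apply: eq_integral => t _.
rewrite patchE -EFinM; case: ifPn => [/set_mem|/negP tzy]/=.
  by rewrite in_itv/= /kappa => ->; rewrite gtr0_norm// subr_gt0.
rewrite /kappa ifF ?mul0r//; apply/negP => /orP[zty|/andP[yt tz]].
  by apply: tzy; apply/mem_set; rewrite /= in_itv.
by have := lt_trans yt (lt_trans tz zy); rewrite ltxx.
Qed.

(** Cauchy-Schwarz for [u y - u z = \int_z^y u'].  It is obtained by integrating
   the tangent bound [2 * c * u' - c ^+ 2 <= u' ^+ 2] where [c] is the mean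
   slope, which is the optimal constant. *)
Lemma sqr_incr_le (u u' : R -> R) (z y : R) :
  (forall x : R, is_derive x (1 : R)%R u (u' x)) -> continuous u' ->
  ((u y - u z) ^+ 2)%:E <= \int[leb]_t (kappa t y z * u' t ^+ 2)%:E.
Proof.
move=> du cu'.
have mu' : measurable_fun [set: R] u' by exact: continuous_measurable_fun.
wlog zy : y z / (z < y)%R.
  move=> wlg; have [zy|yz|->] := ltgtP z y; first exact: wlg.
  - rewrite -sqrrN opprB; apply: (le_trans (wlg _ _ yz)).
    by under eq_integral do rewrite kappaC.
  - rewrite subrr expr0n/=; apply: integral_ge0 => t _.
    by rewrite lee_fin mulr_ge0 ?kappa_ge0 ?sqr_ge0.
rewrite integral_kappa//; last 2 first.
- exact: measurable_funX.
- by move=> t; exact: sqr_ge0.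
have yz0 : (y - z != 0)%R by rewrite subr_eq0 gt_eqF.
pose c := ((u y - u z) / (y - z))%R.
have cE : (c * (y - z) = u y - u z)%R by rewrite /c divfK.
pose g t := (2 * c * u' t - c ^+ 2)%R.
have cg : continuous g.
  move=> t; apply: cvgB; last exact: cvg_cst.
  by apply: cvgMl_tmp; exact: cu'.
have dF (x : R) : is_derive x (1 : R)%R (fun t => 2 * c * u t - c ^+ 2 * t)%R (g x).
  have := du x => ?; apply: is_derive_eq.
  by rewrite /g /GRing.scale /=; ring.
have := integral_is_derive dF cg (ltW zy).
rewrite (_ : _ - _ = c * (u y - u z))%R; last first.
  transitivity (2 * c * (u y - u z) - c * (c * (y - z)))%R; first by ring.
  by rewrite cE; ring.
move=> gE.
have -> : ((u y - u z) ^+ 2)%:E = (y - z)%:E * (c * (u y - u z))%:E.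
  by rewrite -EFinM -cE; congr EFin; ring.
rewrite lee_pmul2l ?lte_fin ?subr_gt0// -gE.
apply: le_integral => //.
- apply: continuous_compact_integrable; first exact: segment_compact.
  exact: continuous_subspaceT.
- apply: continuous_compact_integrable; first exact: segment_compact.
  apply: continuous_subspaceT => t.
  exact: (cvgM (cu' t) (cu' t)).
- by move=> t _; rewrite lee_fin -subr_ge0 (_ : _ - _ = (u' t - c) ^+ 2)%R ?sqr_ge0// /g; ring.
Qed.

(** The left-hand side is twice the variance.  Integrating [sqr_incr_le] in [y]
   and [z] averages [kappa] to [2 * phi], see [kappa_layer_cake]. *)
Lemma poincare1 (u u' : R -> R) :
  (forall x : R, is_derive x (1 : R)%R u (u' x)) -> continuous u' ->
  \int[gamma1]_z \int[gamma1]_y ((u y - u z) ^+ 2)%:E <=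
  2%:E * \int[gamma1]_t (u' t ^+ 2)%:E.
Proof.
move=> du cu'.
have mu' : measurable_fun [set: R] u' by exact: continuous_measurable_fun.
have mu : measurable_fun [set: R] u.
  by apply: continuous_measurable_fun; exact: (continuous_of_is_derive du).
rewrite -kappa_layer_cake//; last 2 first.
- exact: measurable_funX.
- by move=> t; exact: sqr_ge0.
have md : measurable_fun [set: R * measurableTypeR R] (fun p : R * measurableTypeR R => ((u p.2 - u p.1) ^+ 2)%:E).
  apply/measurable_EFinP/measurable_funX/measurable_funB; exact: measurableT_comp.
have mk : measurable_fun [set: R * measurableTypeR R * measurableTypeR R]
    (fun p : R * measurableTypeR R * measurableTypeR R => (kappa p.2 p.1.2 p.1.1 * u' p.2 ^+ 2)%:E).
  apply/measurable_EFinP/measurable_funM.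
    by apply: measurable_kappa => //; exact: measurableT_comp.
  by apply: measurable_funX; exact: measurableT_comp.
have k0 (p : R * measurableTypeR R * measurableTypeR R) : 0 <= (kappa p.2 p.1.2 p.1.1 * u' p.2 ^+ 2)%:E.
  by rewrite lee_fin mulr_ge0 ?kappa_ge0 ?sqr_ge0.
have mki := measurable_fun_fubini_tonelli_F (m2 := leb) _ mk k0.
apply: ge0_le_integral => //.
- by move=> z _; apply: integral_ge0 => y _; rewrite lee_fin sqr_ge0.
- by apply: (measurable_fun_fubini_tonelli_F (m2 := gamma1) _ md) => p; rewrite lee_fin sqr_ge0.
- apply: (measurable_fun_fubini_tonelli_F (m2 := gamma1) _ mki) => p; exact: integral_ge0.
- move=> z _; apply: ge0_le_integral => //.
  + by move=> y _; rewrite lee_fin sqr_ge0.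
  + exact: (measurableT_comp md (pair1_measurable z)).
  + exact: (measurableT_comp mki (pair1_measurable z)).
  + by move=> y _; exact: sqr_incr_le.
Qed.

(** The second moment is the case [q = 1] of [kappa_layer_cake], which is an
   equation of the form [2 * M = 2 * 1]. *)
Lemma gamma1_sqr_dist (z : R) : \int[gamma1]_y ((z - y) ^+ 2)%:E = (z ^+ 2 + 1)%:E.
Proof.
have iy := gamma1_integrable_id R.
have iy2 := gamma1_integrable_sqr R.
have ic (k : R) : gamma1.-integrable [set: R] (EFin \o cst k).
  exact: finite_measure_integrable_cst.
have [M ME] : {M : R | \int[gamma1]_y (y ^+ 2)%:E = M%:E}.
  exists (fine (\int[gamma1]_y (y ^+ 2)%:E)); rewrite fineK//.
  exact: integrable_fin_num iy2.
have E x : \int[gamma1]_y ((x - y) ^+ 2)%:E = (x ^+ 2 + M)%:E.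
  transitivity (\int[gamma1]_y ((x ^+ 2)%:E + ((- 2 * x)%:E * y%:E + (y ^+ 2)%:E))).
    by apply: eq_integral => y _; rewrite -EFinM -!EFinD; congr EFin; ring.
  rewrite integralD//; [|exact: ic|by apply: integrableD => //; exact: integrableZl].
  rewrite integralD//; [|exact: integrableZl].
  rewrite integralZl// gamma1_mean mule0 add0e ME.
  by rewrite integral_prob_cst.
rewrite E; congr (_ + _)%:E%R.
have := @kappa_layer_cake (cst 1%R) (measurable_cst _) (fun _ => ler01).
rewrite integral_prob_cst mule1.
have K (y x : R) : \int[leb]_t (kappa t y x * cst (1:R) t)%:E = ((x - y) ^+ 2)%:E.
  wlog xy : x y / (x < y)%R.
    move=> wlg; have [xy|yx|->] := ltgtP x y; first exact: wlg.
    - rewrite -sqrrN opprB -wlg//; apply: eq_integral => t _; by rewrite kappaC.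
    - rewrite subrr expr0n/= integral0_eq// => t _.
      by rewrite /kappa orbb subrr normr0 if_same mul0r.
  rewrite integral_kappa// (_ : \int[leb]_(_ in _) _ = (y - x)%:E); last first.
    transitivity (1%:E * leb `[x, y]); first by rewrite /=; exact: integral_cst.
    by rewrite mul1e lebesgue_measure_itv/= lte_fin xy EFinB.
  by rewrite -EFinM -sqrrN opprB expr2.
under eq_integral do under eq_integral do rewrite K.
under eq_integral do rewrite E.
move=> H.
have : \int[gamma1]_y (y ^+ 2 + M)%:E = 2%:E * M%:E.
  under eq_integral do rewrite EFinD.
  rewrite integralD//; [|exact: ic].
  by rewrite ME integral_prob_cst -EFinD -EFinM; congr EFin; ring.
rewrite H -EFinM => -[]; lra.
Qed.

End poincare1.

(** * Monotone transport on the line *)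
Section transport1.
Context (R : realType).
Local Notation leb := (@lebesgue_measure R).
Local Notation gamma1 := (@normal_prob R 0 1).
Local Notation phi := (@normal_pdf R 0 1).
Local Open Scope ereal_scope.
(* [S] transports the density [m] to the Gaussian measure and is monotone on a
   set [E] that contains the points where [m] is positive: the quantile map is
   monotone only where the distribution function is in ]0, 1[. *)
Variables (m S : R -> R) (E : set R).
Hypotheses (mm : measurable_fun [set: R] m) (m0 : forall x, (0 <= m x)%R).
Hypotheses (mS : measurable_fun [set: R] S) (mE : forall x, (0 < m x)%R -> E x).
Hypothesis S_nd : forall x y, E x -> E y -> (x <= y)%R -> (S x <= S y)%R.
Hypothesis S_push : forall f : R -> \bar R, measurable_fun [set: R] f ->
  (forall y, 0 <= f y) -> \int[gamma1]_x (f (S x) * (m x)%:E) = \int[gamma1]_y f y.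

Let ind (t : R) : R := if (0 < m t)%R then 1%R else 0%R.

Let K (t y z : R) : \bar R :=
  (kappa (S t) (S y) (S z) * ind t)%:E * ((m y)%:E * (m z)%:E).

Let ind0 t : (0 <= ind t)%R.
Proof. by rewrite /ind; case: ifP. Qed.

Let mind : measurable_fun [set: R] ind.
Proof. by apply: measurable_fun_ifT => //; exact: measurable_fun_ltr. Qed.

Let K0 t y z : 0 <= K t y z.
Proof. by rewrite /K !mule_ge0// lee_fin// mulr_ge0// kappa_ge0. Qed.

Let mK d (T : measurableType d) (a b c : T -> R) : measurable_fun [set: T] a ->
  measurable_fun [set: T] b -> measurable_fun [set: T] c ->
  measurable_fun [set: T] (fun p => K (a p) (b p) (c p)).
Proof.
move=> ma mb mc; apply: emeasurable_funM.
  apply/measurable_EFinP/measurable_funM; last exact: measurableT_comp.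
  by apply: measurable_kappa; exact: measurableT_comp.
by apply: emeasurable_funM; apply/measurable_EFinP; exact: measurableT_comp.
Qed.

Let mass1 : \int[gamma1]_x (m x)%:E = 1.
Proof.
have := @S_push (cst 1%:E) (measurable_cst _) (fun=> lee01).
rewrite (integral_prob_cst gamma1 1) => <-.
by apply: eq_integral => x _; rewrite mul1e.
Qed.

(** If [S t] is strictly between [S y] and [S z] then, [S] being monotone, [t] is
   between [y] and [z]; so the integral is at most
   [|y - z| * |S y - S z|], and the two factors have the same sign. *)
Let integral_K_le y z :
  \int[leb]_t K t y z <= ((y - z) * (S y - S z) * (m y * m z))%:E.
Proof.
have mk (a b : R) : measurable_fun [set: R] (fun t => kappa (S t) a b * ind t)%R.
  by apply: measurable_funM => //; exact: measurable_kappa.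
rewrite /K.
have [yP|] := ltP 0%R (m y); last first.
  move=> my; have -> : m y = 0%R by apply/eqP; rewrite eq_le my m0.
  by rewrite mul0r mulr0 integral0_eq// => t _; rewrite mul0e mule0.
have [zP|] := ltP 0%R (m z); last first.
  move=> mz; have -> : m z = 0%R by apply/eqP; rewrite eq_le mz m0.
  by rewrite mulr0 mulr0 integral0_eq// => t _; rewrite !mule0.
rewrite -EFinM ge0_integralZr ?lee_fin ?mulr_ge0//; last 2 first.
- by apply/measurable_EFinP; exact: mk.
- by move=> t _; rewrite lee_fin mulr_ge0 ?kappa_ge0.
rewrite [leRHS]EFinM lee_wpmul2r ?lee_fin ?mulr_ge0//.
wlog zy : y z yP zP / (z < y)%R.
  move=> wlg; have [zy|yz|->] := ltgtP z y; first exact: wlg.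
  - rewrite (_ : _ * _ = (z - y) * (S z - S y))%R; last by ring.
    apply: le_trans (wlg z y zP yP yz).
    by under eq_integral do rewrite kappaC.
  - rewrite subrr mul0r integral0_eq// => t _.
    by rewrite /kappa orbb subrr normr0 if_same mul0r.
have Szy := S_nd (mE zP) (mE yP) (ltW zy).
apply: (@le_trans _ _ (\int[leb]_(t in `[z, y]) (S y - S z)%:E)); last first.
  rewrite (_ : \int[leb]_(_ in _) _ = (S y - S z)%:E * leb `[z, y]); last first.
    exact: integral_cst.
  by rewrite lebesgue_measure_itv/= lte_fin zy -EFinB -EFinM mulrC.
rewrite [leRHS]integral_mkcond; apply: ge0_le_integralT.
- by apply/measurable_EFinP; exact: mk.
- by apply/(measurable_restrictT _ _).1 => //; exact: measurable_cst.
- by move=> t; rewrite lee_fin mulr_ge0 ?kappa_ge0.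
move=> t; rewrite patchE; case: ifPn => [_|/negP tzy] /=.
  have kle : (kappa (S t) (S y) (S z) <= S y - S z)%R.
    by rewrite /kappa; case: ifP => _; rewrite ?subr_ge0// ger0_norm ?subr_ge0.
  by rewrite /ind lee_fin; case: ifP => _; rewrite ?mulr1 ?mulr0 ?subr_ge0.
have [tP|tP] := ltP 0%R (m t); last by rewrite /ind ltNge tP/= mulr0; exact: lexx.
rewrite /ind tP mulr1 /kappa ifF; first exact: lexx.
 apply/negP => /orP[/andP[zt ty]|/andP[yt tz]].
  apply: tzy; apply/mem_set; rewrite /= in_itv/=; apply/andP; split.
    by rewrite leNgt; apply/negP => tz; have := lt_le_trans zt (S_nd (mE tP) (mE zP) (ltW tz)); rewrite ltxx.
  by rewrite leNgt; apply/negP => yt; have := lt_le_trans ty (S_nd (mE yP) (mE tP) (ltW yt)); rewrite ltxx.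
by have := lt_le_trans (lt_trans yt tz) Szy; rewrite ltxx.
Qed.

Let integral_K : \int[gamma1]_z \int[gamma1]_y \int[leb]_t K t y z =
  2%:E * \int[leb]_t (ind t * phi (S t))%:E.
Proof.
rewrite tonelli3//; last by apply: mK => //; exact: measurableT_comp.
rewrite -ge0_integralMl//; last 2 first.
- apply/measurable_EFinP/measurable_funM => //; apply: (measurableT_comp _ mS).
  exact: measurable_normal_pdf.
- by move=> t _; rewrite lee_fin mulr_ge0// normal_pdf_ge0.
apply: eq_integral => t _; rewrite /K.
pose G (z : R) := \int[gamma1]_y (kappa (S t) y z)%:E.
have mG : measurable_fun [set: R] G.
  apply: (@measurable_fun_fubini_tonelli_F _ _ _ _ _ gamma1
      (fun p : R * R => (kappa (S t) p.2 p.1)%:E)).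
    by apply/measurable_EFinP; apply: measurable_kappa.
  by move=> p; rewrite lee_fin kappa_ge0.
have G0 z : 0 <= G z by apply: integral_ge0 => y _; rewrite lee_fin kappa_ge0.
transitivity (\int[gamma1]_z ((ind t)%:E * (G (S z) * (m z)%:E))).
  apply: eq_integral => z _.
  rewrite /G -(S_push (f := fun y => (kappa (S t) y (S z))%:E)); last 2 first.
  - by apply/measurable_EFinP; exact: measurable_kappa.
  - by move=> y; rewrite lee_fin kappa_ge0.
  have mk : measurable_fun [set: R] (fun y => (kappa (S t) (S y) (S z))%:E * (m y)%:E).
    by apply: emeasurable_funM; apply/measurable_EFinP => //; exact: measurable_kappa.
  rewrite -ge0_integralZr ?lee_fin//; last by move=> y _; rewrite mule_ge0 ?lee_fin ?kappa_ge0.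
  rewrite -ge0_integralMl//; last 2 first.
  - by apply: emeasurable_funM => //; exact: measurable_cst.
  - by move=> y _; rewrite !mule_ge0 ?lee_fin ?kappa_ge0.
  by apply: eq_integral => y _; rewrite EFinM -!muleA muleCA.
rewrite ge0_integralMl//; last 2 first.
- by apply: emeasurable_funM; [exact: measurableT_comp|exact/measurable_EFinP].
- by move=> z _; rewrite mule_ge0 ?lee_fin.
rewrite (S_push mG G0) /G kappa_integral -!EFinM; congr EFin; ring.
Qed.

Let A := \int[gamma1]_x (2^-1 * (x - S x) ^+ 2 * m x)%:E.
Let B := \int[gamma1]_x (2^-1 * (x ^+ 2 + 1) * m x)%:E.

Let mA : measurable_fun [set: R] (fun x => (2^-1 * (x - S x) ^+ 2 * m x)%R).
Proof.
apply: measurable_funM => //; apply: measurable_funM => //.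
by apply: measurable_funX; exact: measurable_funB.
Qed.

Let q (y z : R) : R := (2^-1 * (z - S y) ^+ 2 * (m y * m z))%R.

Let q0 y z : 0 <= (q y z)%:E.
Proof.
rewrite lee_fin; apply: mulr_ge0; last exact: mulr_ge0.
by apply: mulr_ge0 => //; exact: sqr_ge0.
Qed.

Let a0 x : 0 <= (2^-1 * (x - S x) ^+ 2 * m x)%:E.
Proof.
rewrite lee_fin; apply: mulr_ge0 => //.
by apply: mulr_ge0 => //; exact: sqr_ge0.
Qed.

Let mq d (T : measurableType d) (a b : T -> R) : measurable_fun [set: T] a ->
  measurable_fun [set: T] b -> measurable_fun [set: T] (fun t => (q (a t) (b t))%:E).
Proof.
move=> ma mb; apply/measurable_EFinP/measurable_funM.
  apply: measurable_funM => //; apply: measurable_funX; apply: measurable_funB => //.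
  exact: measurableT_comp.
by apply: measurable_funM; exact: measurableT_comp.
Qed.

Let integral_q : \int[gamma1]_z \int[gamma1]_y (q y z)%:E = B.
Proof.
apply: eq_integral => z _.
have mz : measurable_fun [set: R] (fun y => ((z - y) ^+ 2)%:E).
  by apply/measurable_EFinP/measurable_funX/measurable_funB.
transitivity ((2^-1 * m z)%:E * \int[gamma1]_y (((z - S y) ^+ 2)%:E * (m y)%:E)).
  rewrite -ge0_integralMl ?mulr_ge0//; last 2 first.
  - by apply: emeasurable_funM; [exact: (measurableT_comp mz)|exact/measurable_EFinP].
  - by move=> y _; rewrite mule_ge0 ?lee_fin ?sqr_ge0.
  by apply: eq_integral => y _; rewrite -!EFinM /q; congr EFin; ring.
rewrite (S_push (f := fun y => ((z - y) ^+ 2)%:E))//; last first.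
  by move=> y; rewrite lee_fin sqr_ge0.
by rewrite gamma1_sqr_dist -EFinM; congr EFin; ring.
Qed.

(** At a point of differentiability the change of variables
   [m * phi = phi (S) * S'] makes the exponential in the second integral equal
   to [S'].  The inequality is thus the one-dimensional form of
   [\int S' d nu <= Cov_nu(x, S x)], with [nu] the law of density [m].  It is
   proved without derivatives: the integral of [K] over [t], [y], [z] is twice
   the second integral because [S] pushes [m] to the Gaussian measure
   ([kappa_integral]), and it is at most the mean of
   [(y - z) * (S y - S z)] over independent [y], [z] of law [nu]
   ([integral_K_le]).  Expanding this product in squares gives the claim. *)
Lemma transport_cost1 :
  \int[gamma1]_x (2^-1 * (x - S x) ^+ 2 * m x)%:E +
  \int[gamma1]_x (expR (x ^+ 2 / 2 - S x ^+ 2 / 2 - ln (m x)) * m x)%:E <=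
  \int[gamma1]_x (2^-1 * (x ^+ 2 + 1) * m x)%:E.
Proof.
have -> : \int[gamma1]_x (expR (x ^+ 2 / 2 - S x ^+ 2 / 2 - ln (m x)) * m x)%:E =
    \int[leb]_t (ind t * phi (S t))%:E.
  rewrite ge0_integral_gamma1; last 2 first.
  - apply/measurable_EFinP/measurable_funM => //; apply: measurableT_comp => //.
    apply: measurable_funB; last exact: measurableT_comp.
    by apply: measurable_funB; apply: measurable_funM => //; exact: measurable_funX.
  - by move=> x; rewrite lee_fin mulr_ge0 ?expR_ge0.
  apply: eq_integral => x _; rewrite -EFinM /ind; congr EFin.
  case: ltP => [mx|mx]; last first.
    have -> : m x = 0%R by apply/eqP; rewrite eq_le mx m0.
    by rewrite mulr0 !mul0r.
  by rewrite (phi_ratio (S x) x) mul1r expRD expRN lnK// mulfVK ?gt_eqF.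
set P := \int[leb]_t _.
rewrite -/A -/B.
have P0 : 0 <= P by apply: integral_ge0 => t _; rewrite lee_fin mulr_ge0// normal_pdf_ge0.
have A0 : 0 <= A by apply: integral_ge0 => x _; exact: a0.
rewrite -(@lee_pmul2l _ 2%:E)// ge0_muleDr//.
have -> : 2%:E * A = \int[gamma1]_z \int[gamma1]_y ((2^-1 * (y - S y) ^+ 2 * m y)%:E * (m z)%:E) +
    \int[gamma1]_z \int[gamma1]_y ((m y)%:E * (2^-1 * (z - S z) ^+ 2 * m z)%:E).
  have mm' : measurable_fun [set: R] (fun x => (m x)%:E) by exact/measurable_EFinP.
  have mA' : measurable_fun [set: R] (fun x => (2^-1 * (x - S x) ^+ 2 * m x)%:E).
    exact/measurable_EFinP.
  have m0' x : 0 <= (m x)%:E by rewrite lee_fin.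
  by rewrite !ge0_integral_prod// -/A mass1 mule1 mul1e mule_natl mule2n.
have -> : 2%:E * B = \int[gamma1]_z \int[gamma1]_y ((q z y)%:E + (q y z)%:E).
  transitivity (\int[gamma1]_z (\int[gamma1]_y (q z y)%:E + \int[gamma1]_y (q y z)%:E)).
    rewrite ge0_integralDT; last 4 first.
    - apply: (@measurable_fun_fubini_tonelli_F _ _ _ _ _ gamma1
        (fun p : R * R => (q p.1 p.2)%:E)) => //; exact: mq.
    - apply: (@measurable_fun_fubini_tonelli_F _ _ _ _ _ gamma1
        (fun p : R * R => (q p.2 p.1)%:E)) => //; exact: mq.
    - by move=> z; exact: integral_ge0.
    - by move=> z; exact: integral_ge0.
    rewrite (@fubini_tonelli _ _ _ _ _ gamma1 gamma1 (fun p : R * R => (q p.1 p.2)%:E))//=.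
      by rewrite integral_q mule_natl mule2n.
    exact: mq.
  by apply: eq_integral => z _; rewrite ge0_integralDT//; exact: mq.
rewrite -integral_K.
pose f1 (p : R * R) := (2^-1 * (p.2 - S p.2) ^+ 2 * m p.2)%:E * (m p.1)%:E.
pose f2 (p : R * R) := (m p.2)%:E * (2^-1 * (p.1 - S p.1) ^+ 2 * m p.1)%:E.
pose f3 (p : R * R) := \int[leb]_t K t p.2 p.1.
pose f4 (p : R * R) := (q p.1 p.2)%:E + (q p.2 p.1)%:E.
have m0' x : 0 <= (m x)%:E by rewrite lee_fin.
have mm' : measurable_fun [set: R] (fun x => (m x)%:E) by exact/measurable_EFinP.
have mA' : measurable_fun [set: R] (fun x => (2^-1 * (x - S x) ^+ 2 * m x)%:E).
  exact/measurable_EFinP.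
have mf1 : measurable_fun [set: R * R] f1.
  apply: emeasurable_funM; first exact: (measurableT_comp mA').
  exact: (measurableT_comp mm').
have mf2 : measurable_fun [set: R * R] f2.
  apply: emeasurable_funM; first exact: (measurableT_comp mm').
  exact: (measurableT_comp mA').
have mf3 : measurable_fun [set: R * R] f3.
  apply: (@measurable_fun_fubini_tonelli_F _ _ _ _ _ leb
      (fun p : R * R * _ => K p.2 p.1.2 p.1.1)) => //.
  by apply: mK => //; exact: measurableT_comp.
have mf4 : measurable_fun [set: R * R] f4.
  by apply: emeasurable_funD; exact: mq.
have f10 p : 0 <= f1 p by rewrite mule_ge0.
have f20 p : 0 <= f2 p by rewrite mule_ge0.
have f30 p : 0 <= f3 p by apply: integral_ge0.
have f40 p : 0 <= f4 p by rewrite adde_ge0.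
rewrite -(fubini_tonelli1 (m1 := gamma1) (m2 := gamma1) _ mf1 f10).
rewrite -(fubini_tonelli1 (m1 := gamma1) (m2 := gamma1) _ mf2 f20).
rewrite -(fubini_tonelli1 (m1 := gamma1) (m2 := gamma1) _ mf3 f30).
rewrite -(fubini_tonelli1 (m1 := gamma1) (m2 := gamma1) _ mf4 f40).
rewrite -ge0_integralDT// -ge0_integralDT//; last 2 first.
- exact: emeasurable_funD.
- by move=> p; rewrite adde_ge0.
apply: ge0_le_integralT => //.
- by do 2 apply: emeasurable_funD => //.
- by move=> p; do 2 apply: adde_ge0 => //.
move=> [z y]; rewrite /f1 /f2 /f4 /f3 /=.
apply: le_trans (leeD2l _ (integral_K_le y z)) _.
rewrite -!EFinM -!EFinD lee_fin /q le_eqVlt; apply/orP; left; apply/eqP.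
by field.
Qed.

End transport1.

(** * Quantile transport to the Gaussian measure *)
Section density_prob.
Context d (T : measurableType d) (R : realType) (mu : {measure set T -> \bar R}).
Variables (h : T -> R) (hd : probability_density mu h).
Local Open Scope ereal_scope.

Lemma measurable_density : measurable_fun [set: T] h.
Proof. by case: hd. Qed.

Lemma density_ge0 x : (0 <= h x)%R.
Proof. by case: hd. Qed.

Lemma integral_density : \int[mu]_x (h x)%:E = 1.
Proof. by case: hd. Qed.

Lemma integrable_density : mu.-integrable [set: T] (EFin \o h).
Proof.
case: hd => mh h0 h1; apply/integrableP; split; first exact/measurable_EFinP.
rewrite (eq_integral (EFin \o h)) ?h1 ?ltry// => x _ /=.
by rewrite ger0_norm.
Qed.

(** The proof [hd] is an argument so that the structure of probability measure
   can be attached to this constant. *)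
Definition density_prob of probability_density mu h := density_measure mu h.

Let dens0 : density_prob hd set0 = 0.
Proof. exact: integral_set0. Qed.

Let dens_ge0 A : 0 <= density_prob hd A.
Proof. by apply: integral_ge0 => x _; rewrite lee_fin density_ge0. Qed.

Let dens_sigma_additive : semi_sigma_additive (density_prob hd).
Proof.
move=> F mF tF mUF; rewrite /density_prob /density_measure integral_bigcup//; last first.
  exact: (integrableS _ _ (subsetT _) integrable_density).
apply: is_cvg_ereal_nneg_natsum_cond => n _ _.
by apply: integral_ge0 => x _; rewrite lee_fin density_ge0.
Qed.

HB.instance Definition _ := isMeasure.Build _ _ _
  (density_prob hd) dens0 dens_ge0 dens_sigma_additive.

Let dens_setT : density_prob hd [set: T] = 1.
Proof. exact: integral_density. Qed.

HB.instance Definition _ :=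
  @Measure_isProbability.Build _ _ R (density_prob hd) dens_setT.

End density_prob.

Section quantile.
Context (R : realType).
Local Notation leb := (@lebesgue_measure R).
Local Notation gamma1 := (@normal_prob R 0 1).
Local Notation phi := (@normal_pdf R 0 1).
Local Open Scope ereal_scope.

Definition cdf1 (m : R -> R) (x : R) : R :=
  fine (\int[gamma1]_(t in `]-oo, x]) (m t)%:E).

Lemma gamma1_itv_le (a b : R) : (a <= b)%R ->
  gamma1 `]a, b] <= (normal_peak 1 * (b - a))%:E.
Proof.
rewrite le_eqVlt => /predU1P[->|ab].
  by rewrite set_itvoc0 measure0 subrr mulr0.
rewrite gamma1E; apply: (@le_trans _ _ (\int[leb]_(t in `]a, b]) (normal_peak (1:R))%:E)).
  apply: ge0_le_integral => //.
  - by move=> t _; rewrite lee_fin normal_pdf_ge0.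
  - apply/measurable_EFinP; apply: measurable_funTS; exact: measurable_normal_pdf.
  - by move=> t _; rewrite lee_fin normal_pdf_ub.
rewrite (_ : \int[leb]_(_ in _) _ = (normal_peak (1:R))%:E * leb `]a, b]); last first.
  exact: integral_cst.
by rewrite lebesgue_measure_itv/= lte_fin ab -EFinB -EFinM.
Qed.

Section cdf1_facts.
Variables (m : R -> R) (md : probability_density gamma1 m).
Let nu := density_prob md.

(* The identity, seen as a real random variable: [nu] lives on the line with
   its Borel structure. *)
Let idTR : measurableTypeR R -> R := idfun.
#[local] HB.instance Definition _ :=
  @isMeasurableFun.Build _ _ _ _ idTR (@measurable_id _ _ setT).

Lemma cdf1E x : nu `]-oo, x] = (cdf1 m x)%:E.
Proof. by rewrite /cdf1 fineK// (fin_num_measure nu). Qed.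

Lemma cdf1_ge0 x : (0 <= cdf1 m x)%R.
Proof. by rewrite -lee_fin -cdf1E. Qed.

Lemma cdf1_le1 x : (cdf1 m x <= 1)%R.
Proof. by rewrite -lee_fin -cdf1E; apply: (probability_le1 nu). Qed.

Lemma cdf1_nd x y : (x <= y)%R -> (cdf1 m x <= cdf1 m y)%R.
Proof.
move=> xy; rewrite -lee_fin -!cdf1E; apply: (le_measure nu); rewrite ?inE//.
exact: subset_itvl.
Qed.

Lemma cdf1_inc x y : (x <= y)%R -> nu `]x, y] = (cdf1 m y - cdf1 m x)%:E.
Proof.
move=> xy; rewrite EFinB -!cdf1E.
have -> : nu `]-oo, y] = nu `]-oo, x] + nu `]x, y].
  rewrite (@itv_bndbnd_setU _ _ -oo%O (BRight x) (BRight y))//.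
  apply: (measureU nu) => //=.
  by rewrite -subset0 => t []/=; rewrite !in_itv/= => tx /andP[/lt_le_trans/(_ tx)]; rewrite ltxx.
by rewrite addeAC subee ?add0e// (fin_num_measure nu).
Qed.

Lemma continuous_cdf1 : continuous (cdf1 m).
Proof.
have im := integrable_density md.
have step (e : R) : (0 < e)%R -> exists2 r : R, (0 < r)%R &
    forall a b, (a <= b)%R -> (b - a < r)%R -> (cdf1 m b - cdf1 m a < e)%R.
  move=> e0; have [k [k0 Hk]] := integral_normr_continuous im e0.
  exists (k / normal_peak 1)%R; first by rewrite divr_gt0// normal_peak_gt0.
  move=> a b ab abr; rewrite -lte_fin -cdf1_inc//.
  have := Hk `]a, b]%classic; rewrite /Rintegral.
  under eq_integral => t _ do rewrite ger0_norm ?(density_ge0 md)//.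
  rewrite -lte_fin fineK; last exact: (fin_num_measure nu).
  apply=> //; apply: le_lt_trans (gamma1_itv_le ab) _.
  by rewrite lte_fin mulrC -ltr_pdivlMr// normal_peak_gt0.
move=> x; apply/cvgrPdist_lt => e e0.
have [r r0 Hr] := step e e0.
near=> y.
have yx : (`|x - y| < r)%R by near: y; apply: cvgr_dist_lt => //; exact: cvg_id.
have [xy|yx'] := leP x y.
  rewrite ler0_norm ?subr_le0 ?cdf1_nd// opprB; apply: Hr => //.
  by rewrite -[ltLHS]opprB -[ltLHS]ler0_norm// ?subr_le0.
rewrite ger0_norm ?subr_ge0 ?cdf1_nd ?ltW//; apply: Hr; first exact: ltW.
by rewrite -[ltLHS]ger0_norm// subr_ge0 ltW.
Unshelve. all: by end_near. Qed.

Lemma cdf1_lo e : (0 < e)%R -> exists x, (cdf1 m x < e)%R.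
Proof.
move=> e0; have /fine_cvg := @cvg_cdfNy0 _ _ _ nu (idTR : {RV nu >-> R}).
move=> /cvgr_lt/(_ e e0) [M [_ HM]]; exists (M - 1)%R.
by have /= := HM (M - 1)%R; apply; rewrite ltrBlDr ltrDl.
Qed.

Lemma cdf1_hi e : (e < 1)%R -> exists x, (e < cdf1 m x)%R.
Proof.
move=> e1; have /fine_cvg := @cvg_cdfy1 _ _ _ nu (idTR : {RV nu >-> R}).
move=> /cvgr_gt/(_ e e1) [M [_ HM]]; exists (M + 1)%R.
by have /= := HM (M + 1)%R; apply; rewrite ltrDl.
Qed.

Lemma cdf1_surj u : (0 < u < 1)%R -> exists x, cdf1 m x = u.
Proof.
move=> /andP[u0 u1].
have [a au] := cdf1_lo u0; have [b ub] := cdf1_hi u1.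
have ab : (a <= b)%R.
  rewrite leNgt; apply/negP => ba.
  by have := cdf1_nd (ltW ba); rewrite leNgt (lt_trans au ub).
have [| |c _ <-] := @IVT R (cdf1 m) a b u ab; last by exists c.
  by apply: continuous_subspaceT; exact: continuous_cdf1.
by rewrite ge_min le_max (ltW au) (ltW ub) orbT.
Qed.

Lemma measurable_cdf1 : measurable_fun [set: R] (cdf1 m).
Proof. by apply: continuous_measurable_fun; exact: continuous_cdf1. Qed.

Lemma measurable_cdf1_set (A : set R) : measurable A ->
  measurable (cdf1 m @^-1` A : set (measurableTypeR R)).
Proof. by move=> mA; rewrite -[X in measurable X]setTI; exact: measurable_cdf1. Qed.

(** A continuous distribution function sends its own law to the uniform law on
   [0, 1]. *)
Lemma cdf1_law u : (0 <= u <= 1)%R -> nu (cdf1 m @^-1` `]-oo, u]) = u%:E.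
Proof.
move=> /andP[u0 u1].
have mF v : measurable (cdf1 m @^-1` `]-oo, v] : set (measurableTypeR R)).
  exact: measurable_cdf1_set.
apply/eqP; rewrite eq_le; apply/andP; split.
  apply/lee_addgt0Pr => e e0.
  have [ue1|ue1] := leP 1%R (u + e)%R.
    by apply: (le_trans (probability_le1 nu (mF u))); rewrite -EFinD lee_fin.
  have [b bE] : exists b, cdf1 m b = (u + e)%R by apply: cdf1_surj; rewrite ue1 ltr_wpDl.
  rewrite -EFinD -bE -cdf1E; apply: (le_measure nu); rewrite ?inE//.
  move=> x /=; rewrite !in_itv/= => xu; rewrite leNgt; apply/negP => bx.
  by have := le_trans (cdf1_nd (ltW bx)) xu; rewrite bE leNgt ltrDl e0.
move: u0; rewrite (le_eqVlt 0%R u) => /predU1P[<-|u0]; first exact: measure_ge0.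
move: u1; rewrite (le_eqVlt u 1%R) => /predU1P[u1|u1].
  have -> : cdf1 m @^-1` `]-oo, u] = [set: R].
    by apply/seteqP; split => // x _ /=; rewrite in_itv/= u1 cdf1_le1.
  by rewrite u1 -(probability_setT nu).
have [b bE] : exists b, cdf1 m b = u by apply: cdf1_surj; rewrite u0.
rewrite -[in leLHS]bE -cdf1E; apply: (le_measure nu); rewrite ?inE//.
by move=> x /=; rewrite !in_itv/= => xb; rewrite -bE cdf1_nd.
Qed.

Lemma cdf1_inside : nu (~` (cdf1 m @^-1` `]0%R, 1%R[)) = 0.
Proof.
have mF v : measurable (cdf1 m @^-1` `]-oo, v] : set (measurableTypeR R)).
  exact: measurable_cdf1_set.
have mF1 v : measurable (cdf1 m @^-1` `[v, +oo[ : set (measurableTypeR R)).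
  exact: measurable_cdf1_set.
have F0 : nu (cdf1 m @^-1` `]-oo, 0%R]) = 0 by rewrite cdf1_law// lexx ler01.
have F1 : nu (cdf1 m @^-1` `[1%R, +oo[) = 0.
  apply/eqP; rewrite eq_le measure_ge0 andbT; apply/lee_addgt0Pr => e e0.
  rewrite add0e; have [e1|e1] := leP 1%R e.
    by apply: (le_trans (probability_le1 nu (mF1 _))); rewrite lee_fin.
  apply: (@le_trans _ _ (nu (~` (cdf1 m @^-1` `]-oo, (1 - e)%R])))).
    apply: (le_measure nu); rewrite ?inE//; first exact: measurableC.
    by move=> x /=; rewrite !in_itv/= andbT => x1; apply/negP; rewrite -ltNge (lt_le_trans _ x1)// ltrBlDr ltrDl.
  have -> : nu (~` (cdf1 m @^-1` `]-oo, (1 - e)%R])) = 1 - (1 - e)%:E.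
    rewrite -[(1 - e)%:E]cdf1_law; first exact: (probability_setC nu).
    by rewrite subr_ge0 (ltW e1) gerBl ltW.
  by rewrite -EFinB lee_fin opprB addrC subrK.
apply/eqP; rewrite eq_le measure_ge0 andbT.
apply: (@le_trans _ _ (nu (cdf1 m @^-1` `]-oo, 0%R] `|` cdf1 m @^-1` `[1%R, +oo[))).
  apply: (le_measure nu); rewrite ?inE//; [|exact: measurableU|].
    by apply: measurableC; exact: measurable_cdf1_set.
  move=> x /=; rewrite !in_itv/= andbT => /negP.
  by rewrite negb_and -!leNgt => /orP.
apply: (le_trans (measureU2 nu (mF _) (mF1 _))).
by rewrite -[leRHS]adde0; apply: leeD; [rewrite -F0|rewrite -F1].
Qed.

Lemma density_prob_cdf1_inside (A : set R) : measurable A ->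
  nu A = nu (A `&` cdf1 m @^-1` `]0%R, 1%R[).
Proof.
move=> mA; set E := cdf1 m @^-1` _.
have mE : measurable (E : set (measurableTypeR R)) by exact: measurable_cdf1_set.
apply/eqP; rewrite eq_le; apply/andP; split; last first.
  by apply: (le_measure nu); rewrite ?inE//; exact: measurableI.
apply: (@le_trans _ _ (nu ((A `&` E) `|` ~` E))).
  apply: (le_measure nu); rewrite ?inE//.
    by apply: measurableU; [exact: measurableI|exact: measurableC].
  by move=> x Ax; have [Ex|nEx] := pselect (E x); [left|right].
apply: (le_trans (measureU2 nu (measurableI _ _ mA mE) (measurableC mE))).
by rewrite -[leRHS]adde0 leeD2l// -cdf1_inside.
Qed.

End cdf1_facts.

Lemma gamma1_density : probability_density gamma1 (cst (1%R : R)).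
Proof. by split => //; rewrite integral_prob_cst. Qed.

Local Notation Phi := (cdf1 (cst 1%R)).

Lemma gamma1_density_prob (A : set R) : measurable A ->
  density_prob gamma1_density A = gamma1 A.
Proof.
move=> mA; transitivity (1%:E * gamma1 A); last by rewrite mul1e.
by rewrite /density_prob /density_measure /=; exact: integral_cst.
Qed.

(** The value [0] outside ]0, 1[ is arbitrary: the infimum there would be over
   an empty set or a set without lower bound. *)
Definition quantile (u : R) : R :=
  if (0 < u < 1)%R then inf [set y | (u <= Phi y)%R] else 0%R.

(** The Galois connection between [Phi] and its generalized inverse; the strict
   form holds because [Phi] is continuous. *)
Lemma quantile_gt (u a : R) : (0 < u < 1)%R -> (a < quantile u)%R = (Phi a < u)%R.
Proof.
move=> u01; rewrite /quantile u01.
have Phi_lt x y : (Phi x < Phi y)%R -> (x < y)%R.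
  by apply: contraTT; rewrite -!leNgt; exact: (cdf1_nd gamma1_density).
have /andP[u0 u1] := u01.
have [x0 x0u] := cdf1_lo gamma1_density u0.
have lbP b : (Phi b < u)%R -> lbound [set y | (u <= Phi y)%R] b.
  by move=> bu y /= uy; apply/ltW/Phi_lt/(lt_le_trans bu).
apply/idP/idP => [|au].
  apply: contraTT; rewrite -!leNgt => ua.
  by apply: ge_inf => //; exists x0; exact: lbP.
have a0 := cdf1_ge0 gamma1_density a.
have [b bE] : exists b, Phi b = ((Phi a + u) / 2)%R.
  by apply: (cdf1_surj gamma1_density); apply/andP; split; lra.
apply: (@lt_le_trans _ _ b); first by apply: Phi_lt; rewrite bE; lra.
apply: lb_le_inf; last by apply: lbP; rewrite bE; lra.
by have [y yu] := cdf1_hi gamma1_density u1; exists y; exact: ltW.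
Qed.

Lemma quantile_nd u v : (0 < u < 1)%R -> (0 < v < 1)%R -> (u <= v)%R ->
  (quantile u <= quantile v)%R.
Proof.
move=> u01 v01 uv; rewrite leNgt quantile_gt// -leNgt.
apply: (le_trans uv); rewrite leNgt; apply/negP => H.
by have := quantile_gt (quantile v) v01; rewrite H ltxx.
Qed.

Lemma measurable_quantile : measurable_fun [set: R] quantile.
Proof.
apply: (measurability _ (RGenOInfty.measurableE R)) => // _ [_ [a ->] <-]; rewrite setTI.
pose A := if (a < 0)%R then ~` `]0%R, 1%R[%classic else set0 : set R.
have -> : quantile @^-1` `]a, +oo[ = (`]0%R, 1%R[ `&` `](Phi a), +oo[) `|` A.
  apply/seteqP; split => u; rewrite /A /= !in_itv/= !andbT.
    case: (boolP (0 < u < 1)%R) => [u01|u01].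
      by rewrite quantile_gt// => ?; left; split.
    rewrite /quantile (negbTE u01) => a0; right; rewrite a0/= in_itv/=.
    exact/negP.
  move=> [[u01 au]|]; first by rewrite quantile_gt.
  case: ifP => // a0 /=; rewrite in_itv/= => /negP u01.
  by rewrite /quantile (negbTE u01).
apply: measurableU; first exact: measurableI.
by rewrite /A; case: ifP => // _; exact: measurableC.
Qed.

Section quantile_transport.
Variables (m : R -> R) (md : probability_density gamma1 m).
Let nu := density_prob md.
Let S x := quantile (cdf1 m x).

Lemma quantile_transport_law (A : set R) : measurable A ->
  pushforward nu (S : R -> measurableTypeR R) A = gamma1 A.
Proof.
have mS : measurable_fun setT (S : measurableTypeR R -> measurableTypeR R).
  exact: (measurableT_comp measurable_quantile (measurable_cdf1 md)).
move=> mA.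
pose G : set (set R) := [set A | exists x, A = `]x, +oo[%classic].
apply: (@measure_unique _ _ (measurableTypeR R) G (fun n => `](- n%:R)%R, +oo[%classic)) => //.
- exact: RGenOInfty.measurableE.
- move=> _ _ [x ->] [y ->]; exists (Num.max x y).
  by apply/seteqP; split => z /=; rewrite !in_itv/= !andbT gt_max => /andP.
- by move=> n; exists (- n%:R)%R.
- apply/seteqP; split => // x _; exists (Num.truncn (- x)).+1 => //=.
  by rewrite in_itv/= andbT ltrNl truncnS_gt.
- move=> _ [a ->]; rewrite /pushforward.
  have mray : measurable (cdf1 m @^-1` `](Phi a), +oo[ : set (measurableTypeR R)).
    exact: measurable_cdf1_set.
  have mrayS : measurable (S @^-1` `]a, +oo[ : set (measurableTypeR R)).
    by rewrite -[X in measurable X]setTI; exact: mS.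
  transitivity (nu (S @^-1` `]a, +oo[ `&` cdf1 m @^-1` `]0%R, 1%R[)).
    exact: density_prob_cdf1_inside.
  have -> : S @^-1` `]a, +oo[ `&` cdf1 m @^-1` `]0%R, 1%R[ =
      cdf1 m @^-1` `](Phi a), +oo[ `&` cdf1 m @^-1` `]0%R, 1%R[.
    apply/seteqP; split => x /= [+ x01]; rewrite !in_itv/= !andbT in x01 *;
      by rewrite /S quantile_gt.
  transitivity (nu (cdf1 m @^-1` `](Phi a), +oo[)).
    by apply/esym; exact: density_prob_cdf1_inside.
  have -> : cdf1 m @^-1` `](Phi a), +oo[ = ~` (cdf1 m @^-1` `]-oo, (Phi a)]).
    by rewrite preimage_setC setCitvl.
  have -> : `]a, +oo[%classic = ~` `]-oo, a]%classic :> set R by rewrite setCitvl.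
  transitivity (1 - (Phi a)%:E).
    rewrite -[(Phi a)%:E](cdf1_law md); last first.
      by rewrite (cdf1_ge0 gamma1_density) (cdf1_le1 gamma1_density).
    by apply: (probability_setC nu); exact: measurable_cdf1_set.
  rewrite -(cdf1E gamma1_density) gamma1_density_prob//.
  by apply/esym; apply: (probability_setC gamma1).
- move=> k; rewrite /pushforward; apply: (@le_lt_trans _ _ 1); last exact: ltry.
  apply: (probability_le1 nu).
  by rewrite -[X in measurable X]setTI; exact: mS.
Qed.

Lemma measurable_quantile_transport : measurable_fun [set: R] S.
Proof. exact: (measurableT_comp measurable_quantile (measurable_cdf1 md)). Qed.

Lemma quantile_transport_push (f : R -> \bar R) : measurable_fun [set: R] f ->
  (forall y, 0 <= f y) ->
  \int[gamma1]_x (f (S x) * (m x)%:E) = \int[gamma1]_y f y.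
Proof.
move=> mf f0; have mS := measurable_quantile_transport.
rewrite -(@ge0_integral_density _ _ _ gamma1 nu m (measurable_density md)
  (density_ge0 md) (fun A _ => erefl) (f \o S))//; last 2 first.
- exact: (measurableT_comp mf mS).
- by move=> x /=.
transitivity (\int[pushforward nu (S : R -> measurableTypeR R)]_y f y).
  by rewrite ge0_integral_pushforward.
by apply: eq_measure_integral => A mA _; exact: quantile_transport_law.
Qed.

(* The density [m] with the null set where [quantile] takes its arbitrary value
   removed, so that the transport is monotone wherever [mh] is positive. *)
Let mh (x : R) : R := if (0 < cdf1 m x < 1)%R then m x else 0%R.

Let restrict_inside (F : R -> \bar R) : measurable_fun [set: R] F ->
  (forall x, 0 <= F x) ->
  \int[gamma1]_x (F x * (m x)%:E) = \int[gamma1]_x (F x * (mh x)%:E).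
Proof.
move=> mF F0.
have mm := measurable_density md; have m0 := density_ge0 md.
pose E := cdf1 m @^-1` `]0%R, 1%R[.
have mE : measurable (E : set (measurableTypeR R)) by exact: measurable_cdf1_set.
have dens G := @ge0_integral_density _ _ _ gamma1 nu m mm m0 (fun A _ => erefl) G.
rewrite -dens//.
rewrite (ge0_negligible_integral _ _ _ _ (cdf1_inside md))//; last first.
  exact: measurableC.
rewrite setDE setCK setTI -/E integral_mkcond dens//.
- apply: eq_integral => x _; rewrite patchE /mh; case: ifPn.
    by move=> /set_mem; rewrite /E /= in_itv/= => ->.
  move=> /negP xE; rewrite ifF; first by rewrite mule0; exact: mul0e.
  by apply/negP => x01; apply: xE; apply/mem_set; rewrite /E /= in_itv.
- by apply/(measurable_restrictT _ _).1 => //; exact: measurable_funTS.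
- by move=> x; rewrite patchE; case: ifP.
Qed.

Lemma quantile_transport_cost :
  \int[gamma1]_x (2^-1 * (x - S x) ^+ 2 * m x)%:E +
  \int[gamma1]_x (expR (x ^+ 2 / 2 - S x ^+ 2 / 2 - ln (m x)) * m x)%:E <=
  \int[gamma1]_x (2^-1 * (x ^+ 2 + 1) * m x)%:E.
Proof.
have mS := measurable_quantile_transport.
have mm := measurable_density md; have m0 := density_ge0 md.
have mmh : measurable_fun [set: R] mh.
  apply: measurable_fun_ifT => //; apply: measurable_and.
    by apply: measurable_fun_ltr => //; exact: measurable_cdf1.
  by apply: measurable_fun_ltr => //; exact: measurable_cdf1.
have mh0 x : (0 <= mh x)%R by rewrite /mh; case: ifP.
have mhE (g : R -> R) : measurable_fun [set: R] g -> (forall x, 0 <= g x)%R ->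
    \int[gamma1]_x (g x * m x)%:E = \int[gamma1]_x (g x * mh x)%:E.
  move=> mg g0; under eq_integral do rewrite EFinM.
  under [RHS]eq_integral do rewrite EFinM.
  by apply: restrict_inside => [|x]; [exact/measurable_EFinP|rewrite lee_fin].
have mx2 : measurable_fun [set: R] (fun x : R => x ^+ 2)%R by exact: measurable_funX.
rewrite !mhE; last 6 first.
- by apply: measurable_funM => //; apply: measurable_funD => //; exact: mx2.
- by move=> x; apply: mulr_ge0 => //; apply: addr_ge0 => //; exact: sqr_ge0.
- by apply: measurable_funM => //; apply: measurable_funX; exact: measurable_funB.
- by move=> x; apply: mulr_ge0 => //; exact: sqr_ge0.
- apply: measurableT_comp => //; apply: measurable_funB; last exact: measurableT_comp.
  by apply: measurable_funB; apply: measurable_funM => //; exact: measurable_funX.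
- by move=> x; exact: expR_ge0.
rewrite [X in _ + X <= _](_ : _ = \int[gamma1]_x
    (expR (x ^+ 2 / 2 - S x ^+ 2 / 2 - ln (mh x)) * mh x)%:E); last first.
  by apply: eq_integral => x _; rewrite /mh; case: ifP => // _; rewrite !mulr0.
apply: (@transport_cost1 _ _ _ [set x | 0 < cdf1 m x < 1]%R) => //.
- by move=> x; rewrite /mh /=; case: ifP => //; rewrite ltxx.
- by move=> x y /= x01 y01 xy; apply: quantile_nd => //; exact: (cdf1_nd md).
- move=> f mf f0; rewrite -restrict_inside; first exact: quantile_transport_push.
    exact: (measurableT_comp mf mS).
  by move=> x.
Qed.

End quantile_transport.
End quantile.

(** * Disintegration along the first coordinate *)
Section rV_cons.
Context (R : realType) (n : nat).
Implicit Types (x : 'rV[R]_n.+1) (t : R) (y : 'rV[R]_n).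

Definition rV_head x : R := x ord0 ord0.
Definition rV_tail x : 'rV[R]_n := \row_j x ord0 (lift ord0 j).

Lemma cons_rV0 t y : cons_rV (t, y) ord0 ord0 = t.
Proof.
rewrite /cons_rV /=.
transitivity (row_mx (const_mx t : 'rV[R]_1) y ord0 (lshift n (ord0 : 'I_1))).
  by congr fun_of_matrix; exact: val_inj.
by rewrite row_mxEl mxE.
Qed.

Lemma cons_rVS t y (j : 'I_n) : cons_rV (t, y) ord0 (lift ord0 j) = y ord0 j.
Proof.
rewrite /cons_rV /=.
have -> : lift ord0 j = rshift 1 j :> 'I_(1 + n) by exact: val_inj.
exact: row_mxEr.
Qed.

Lemma rV_head_cons p : rV_head (cons_rV p) = p.1.
Proof. by case: p => t y; exact: cons_rV0. Qed.

Lemma rV_tail_cons p : rV_tail (cons_rV p) = p.2.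
Proof. by case: p => t y; apply/rowP => j; rewrite mxE; exact: cons_rVS. Qed.

Lemma cons_rVB t y s z : cons_rV (t, y) - cons_rV (s, z) = cons_rV (t - s, y - z).
Proof.
apply/rowP => i; case: (unliftP ord0 i) => [j|] ->.
  by rewrite cons_rVS [LHS]mxE [X in _ + X]mxE !cons_rVS [RHS]mxE [X in _ = _ + X]mxE.
by rewrite cons_rV0 [LHS]mxE [X in _ + X]mxE !cons_rV0.
Qed.

Lemma sqnorm_cons t y : sqnorm (cons_rV (t, y)) = t ^+ 2 + sqnorm y.
Proof.
rewrite /sqnorm big_ord_recl cons_rV0; congr (_ + _).
by apply: eq_bigr => j _; rewrite cons_rVS.
Qed.

Lemma measurable_rV_head : measurable_fun [set: 'rV[R]_n.+1] rV_head.
Proof. exact: (measurable_rV_coord ord0). Qed.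

Lemma measurable_rV_tail : measurable_fun [set: 'rV[R]_n.+1] rV_tail.
Proof.
apply: measurable_fun_rV => i.
rewrite (_ : _ \o _ = rV_coord (lift ord0 i)); first exact: measurable_rV_coord.
by apply/funext => x; rewrite /= /rV_coord mxE.
Qed.

Lemma measurable_sqnorm_comp d (T : measurableType d) k (f : T -> 'rV[R]_k) :
  measurable_fun [set: T] f -> measurable_fun [set: T] (fun w => sqnorm (f w)).
Proof.
move=> mf; rewrite /sqnorm; apply: measurable_sum => i.
apply: measurable_funX; exact: (measurableT_comp (measurable_rV_coord i) mf).
Qed.

Lemma measurable_rVB d (T : measurableType d) k (f g : T -> 'rV[R]_k) :
  measurable_fun [set: T] f -> measurable_fun [set: T] g ->
  measurable_fun [set: T] (fun w => f w - g w).
Proof.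
move=> mf mg; apply: measurable_fun_rV => i.
rewrite (_ : _ \o _ = fun w => rV_coord i (f w) - rV_coord i (g w)); last first.
  by apply/funext => w; rewrite /= /rV_coord !mxE.
apply: measurable_funB.
  exact: (measurableT_comp (measurable_rV_coord i) mf).
exact: (measurableT_comp (measurable_rV_coord i) mg).
Qed.

End rV_cons.

Lemma sqnorm_ge0 (R : realType) n (x : 'rV[R]_n) : 0 <= sqnorm x.
Proof. by apply: sumr_ge0 => i _; exact: sqr_ge0. Qed.

Section gaussian_tonelli.
Context (R : realType) (n : nat).
Local Notation gamma1 := (@normal_prob R 0 1).
Local Open Scope ereal_scope.

Lemma ge0_integral_gaussianS (f : 'rV[R]_n.+1 -> \bar R) :
  measurable_fun [set: 'rV[R]_n.+1] f -> (forall x, 0 <= f x) ->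
  \int[gaussian R n.+1]_x f x =
  \int[gaussian R n]_y \int[gamma1]_t f (cons_rV (t, y)).
Proof.
move=> mf f0.
transitivity (\int[(gamma1 \x gaussian R n)%E]_p (f \o @cons_rV R n) p).
  rewrite -[LHS]/(\int[pushforward (gamma1 \x gaussian R n) (@cons_rV R n)]_x f x).
  by rewrite ge0_integral_pushforward.
rewrite fubini_tonelli2//; last by move=> p /=.
have mc := @measurable_cons_rV R n.
exact: (measurableT_comp mf mc).
Qed.

End gaussian_tonelli.

Section disintegration.
Context (R : realType) (n : nat) (h : 'rV[R]_n.+1 -> R).
Local Notation gamma1 := (@normal_prob R 0 1).
Hypothesis hd : probability_density (gaussian R n.+1) h.
Local Open Scope ereal_scope.

Definition marginal (y : 'rV[R]_n) : R :=
  fine (\int[gamma1]_t (h (cons_rV (t, y)))%:E).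

(** The value [1] on the null fibres keeps [conditional y] a probability density
   for every [y]. *)
Definition conditional (y : 'rV[R]_n) (t : R) : R :=
  if (0 < marginal y)%R then (h (cons_rV (t, y)) / marginal y)%R else 1%R.

Let mh : measurable_fun [set: 'rV[R]_n.+1] h.
Proof. exact: measurable_density hd. Qed.

Let h0 x : (0 <= h x)%R.
Proof. exact: density_ge0 hd x. Qed.

Let mhc : measurable_fun [set: measurableTypeR R * 'rV[R]_n]
  (fun p => h (cons_rV p)).
Proof. by have mc := @measurable_cons_rV R n; exact: (measurableT_comp mh mc). Qed.

Let G (y : 'rV[R]_n) := \int[gamma1]_t (h (cons_rV (t, y)))%:E.

Let mG : measurable_fun [set: 'rV[R]_n] G.
Proof.
apply: (@measurable_fun_fubini_tonelli_G _ _ _ _ _ gamma1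
  (fun p : _ * 'rV[R]_n => (h (cons_rV p))%:E)).
  exact/measurable_EFinP.
by move=> p; rewrite lee_fin.
Qed.

Let G0 y : 0 <= G y.
Proof. by apply: integral_ge0 => t _; rewrite lee_fin. Qed.

Let integral_G : \int[gaussian R n]_y G y = 1.
Proof.
rewrite -(integral_density hd) ge0_integral_gaussianS//.
  exact/measurable_EFinP.
Qed.

Lemma marginal_ge0 y : (0 <= marginal y)%R.
Proof. exact/fine_ge0/G0. Qed.

Lemma measurable_marginal : measurable_fun [set: 'rV[R]_n] marginal.
Proof. exact: measurableT_comp. Qed.

Let marginalE : {ae gaussian R n, forall y, G y = (marginal y)%:E}.
Proof.
have iG : (gaussian R n).-integrable [set: 'rV[R]_n] G.
  apply/integrableP; split => //.
  by under eq_integral do rewrite gee0_abs//; rewrite integral_G ltry.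
by apply: filterS (integrable_ae measurableT iG) => y /(_ I) /fineK ->.
Qed.

Lemma marginal_density : probability_density (gaussian R n) marginal.
Proof.
split; [exact: measurable_marginal|exact: marginal_ge0|].
rewrite -integral_G; apply: ge0_ae_eq_integral => //.
- by apply/measurable_EFinP; exact: measurable_marginal.
- by move=> y _; rewrite lee_fin marginal_ge0.
- by apply: filterS marginalE => y -> _.
Qed.

Lemma measurable_conditional :
  measurable_fun [set: measurableTypeR R * 'rV[R]_n] (fun p => conditional p.2 p.1).
Proof.
have mm : measurable_fun [set: measurableTypeR R * 'rV[R]_n] (fun p => marginal p.2).
  exact: (measurableT_comp measurable_marginal).
rewrite (_ : (fun p => _) = fun p : measurableTypeR R * 'rV[R]_n =>
    if (0 < marginal p.2)%R then (h (cons_rV p) * expR (- ln (marginal p.2)))%R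
    else 1%R); last first.
  apply/funext => -[t y]; rewrite /conditional /=; case: ifP => // y0.
  by rewrite expRN lnK.
apply: measurable_fun_ifT => //; first exact: measurable_fun_ltr.
apply: measurable_funM => //; apply: measurableT_comp => //.
by apply: measurableT_comp => //; exact: measurableT_comp.
Qed.

Lemma marginalM y t : (0 < marginal y)%R ->
  h (cons_rV (t, y)) = (marginal y * conditional y t)%R.
Proof. by move=> y0; rewrite /conditional y0 mulrC divfK// gt_eqF. Qed.

Lemma conditional_ge0 y t : (0 <= conditional y t)%R.
Proof. by rewrite /conditional; case: ifP => // ?; rewrite divr_ge0// marginal_ge0. Qed.

Lemma conditional_density y : probability_density gamma1 (conditional y).
Proof.
split; [|exact: conditional_ge0|].
  exact: (measurableT_comp measurable_conditional (pair2_measurable y)).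
have [y0|y0] := ltP 0%R (marginal y); last first.
  by under eq_integral do rewrite /conditional ltNge y0/=; rewrite integral_prob_cst.
have mhy : measurable_fun [set: R] (fun t => (h (cons_rV (t, y)))%:E).
  by apply/measurable_EFinP; exact: (measurableT_comp mhc (pair2_measurable y)).
under eq_integral do rewrite /conditional y0 mulrC EFinM.
rewrite ge0_integralMl//; last 2 first.
- by rewrite invr_ge0 ltW.
- by move=> t _; rewrite lee_fin.
have Gfin : G y = (marginal y)%:E.
  move: y0; rewrite /marginal -/(G y); case: (G y) (G0 y) => [r| |]//=.
  by rewrite ltxx.
by rewrite -/(G y) Gfin -EFinM mulVf// gt_eqF.
Qed.

(** On the fibres where the marginal vanishes, [h] is almost everywhere [0] and
   both integrands vanish; the inner integral of [h] is finite only almost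
   everywhere, hence the use of equality almost everywhere. *)
Lemma disintegration (F : 'rV[R]_n.+1 -> \bar R) :
  measurable_fun [set: 'rV[R]_n.+1] F -> (forall x, 0 <= F x) ->
  \int[gaussian R n.+1]_x (F x * (h x)%:E) =
  \int[gaussian R n]_y ((marginal y)%:E *
    \int[gamma1]_t (F (cons_rV (t, y)) * (conditional y t)%:E)).
Proof.
move=> mF F0.
have mFh : measurable_fun [set: 'rV[R]_n.+1] (fun x => F x * (h x)%:E).
  by apply: emeasurable_funM => //; exact/measurable_EFinP.
have Fh0 x : 0 <= F x * (h x)%:E by rewrite mule_ge0 ?lee_fin.
have mc := @measurable_cons_rV R n.
have mFc : measurable_fun [set: measurableTypeR R * 'rV[R]_n]
    (fun p => F (cons_rV p) * (conditional p.2 p.1)%:E).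
  apply: emeasurable_funM; first exact: (measurableT_comp mF mc).
  by apply/measurable_EFinP; exact: measurable_conditional.
have Fc0 y t : 0 <= F (cons_rV (t, y)) * (conditional y t)%:E.
  by rewrite mule_ge0 ?lee_fin ?conditional_ge0.
rewrite ge0_integral_gaussianS//; apply: ge0_ae_eq_integral => //.
- exact: (@measurable_fun_fubini_tonelli_G _ _ _ _ _ gamma1
    (fun p : _ * 'rV[R]_n => F (cons_rV p) * (h (cons_rV p))%:E)
    (measurableT_comp mFh mc) (fun p => Fh0 _)).
- apply: emeasurable_funM; first by apply/measurable_EFinP; exact: measurable_marginal.
  apply: (@measurable_fun_fubini_tonelli_G _ _ _ _ _ gamma1
    (fun p : _ * 'rV[R]_n => F (cons_rV p) * (conditional p.2 p.1)%:E) mFc).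
  by move=> [t y]; exact: Fc0.
- by move=> y _; apply: integral_ge0 => t _; exact: Fh0.
- move=> y _; rewrite mule_ge0 ?lee_fin ?marginal_ge0//.
  by apply: integral_ge0 => t _; exact: Fc0.
apply: filterS marginalE => y Gy _.
have mFy : measurable_fun [set: R] (fun t => F (cons_rV (t, y)) * (conditional y t)%:E).
  exact: (measurableT_comp mFc (pair2_measurable y)).
have [y0|y0] := ltP 0%R (marginal y).
  rewrite -ge0_integralMl ?marginal_ge0//.
  by apply: eq_integral => t _; rewrite marginalM// EFinM muleCA.
have m0 : marginal y = 0%R by apply/eqP; rewrite eq_le y0 marginal_ge0.
rewrite m0 mul0e.
have mhy : measurable_fun [set: R] (fun t => (h (cons_rV (t, y)))%:E).
  by apply/measurable_EFinP; exact: (measurableT_comp mhc (pair2_measurable y)).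
have : ae_eq gamma1 [set: R] (fun t => (h (cons_rV (t, y)))%:E) (cst 0).
  apply/ae_eq_integral_abs => //.
  under eq_integral do rewrite gee0_abs ?lee_fin//.
  by rewrite -/(G y) Gy m0.
move=> ae0; rewrite -(integral0 gamma1 [set: R]); apply: ge0_ae_eq_integral => //.
  exact: (measurableT_comp mFh (measurableT_comp mc (pair2_measurable y))).
by apply: filterS ae0 => t /(_ I) -> _; rewrite mule0.
Qed.

Lemma measurable_cdf1_conditional :
  measurable_fun [set: measurableTypeR R * 'rV[R]_n]
    (fun p => cdf1 (conditional p.2) p.1).
Proof.
pose K (q : measurableTypeR R * 'rV[R]_n * measurableTypeR R) : \bar R :=
  (if (q.2 <= q.1.1)%R then conditional q.1.2 q.2 else 0%R)%:E.
have mK : measurable_fun [set: measurableTypeR R * 'rV[R]_n * measurableTypeR R] K.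
  apply/measurable_EFinP; apply: measurable_fun_ifT => //.
    by apply: measurable_fun_ler => //; exact: measurableT_comp.
  apply: (measurableT_comp measurable_conditional
    (g := fun q : measurableTypeR R * 'rV[R]_n * measurableTypeR R => (q.2, q.1.2))).
  by apply: measurable_fun_pair => //; exact: measurableT_comp.
have K0 q : 0 <= K q by rewrite /K lee_fin; case: ifP => // _; exact: conditional_ge0.
have := measurable_fun_fubini_tonelli_F (m2 := gamma1) _ mK K0.
move=> mKi; rewrite (_ : (fun p => _) = fine \o fubini_F gamma1 K).
  exact: measurableT_comp.
apply/funext => -[t y]; rewrite /cdf1 /=; congr fine.
rewrite /fubini_F [LHS]integral_mkcond.
apply: eq_integral => s _.
rewrite patchE /K /=; case: ifPn => [/set_mem|/negP sP].
  by rewrite /= in_itv/= => ->.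
rewrite ifF//; apply/negP => st; apply: sP; apply/mem_set.
by rewrite /= in_itv.
Qed.

End disintegration.

(** * Triangular transport in several dimensions *)

(** The graph of [expR] lies above its tangent at [c]. *)
Lemma expR_tangent (R : realType) (c u : R) : expR c * (1 + u - c) <= expR u.
Proof.
have -> : expR u = expR c * expR (u - c) by rewrite -expRD addrC subrK.
rewrite ler_wpM2l ?expR_ge0//.
by apply: le_trans (expR_ge1Dx _); lra.
Qed.

(** Weighted arithmetic-geometric mean inequality for [expR a] and [n] copies of
   [expR (b / n)].  For [n = 0] the quotient [b / n] is [0], and the inequality
   is false unless [b] vanishes. *)
Lemma expR_am_gm (R : realType) (n : nat) (a b : R) : (n = 0%N -> b = 0) ->
  n.+1%:R * expR ((a + b) / n.+1%:R) <= expR a + n%:R * expR (b / n%:R).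
Proof.
case: n => [/(_ erefl) -> | n _]; first by rewrite mul1r mul0r divr1 !addr0.
set c := (a + b) / _.
have cE : c * n.+2%:R = a + b by rewrite /c divfK.
have H1 := expR_tangent c a.
have H2 := expR_tangent c (b / n.+1%:R).
have k0 : n.+1%:R != 0 :> R by rewrite pnatr_eq0.
have kE : n.+2%:R = n.+1%:R + 1 :> R by rewrite -natr1.
rewrite kE in cE *; move: n.+1%:R k0 cE H2 (ler0n R n.+1) => {kE} k k0 cE H2 kp.
have {}H2 : expR c * (k + b - k * c) <= k * expR (b / k).
  apply: le_trans (ler_wpM2l kp H2).
  by rewrite le_eqVlt; apply/orP; left; apply/eqP; field.
apply: le_trans (lerD H1 H2); rewrite -mulrDr mulrC ler_wpM2l ?expR_ge0//.
by lra.
Qed.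

Section gaussian_transport.
Context (R : realType).
Local Notation gamma1 := (@normal_prob R 0 1).
Local Open Scope ereal_scope.

Lemma integral_gaussian0 (f : 'rV[R]_0 -> \bar R) :
  measurable_fun [set: 'rV[R]_0] f -> \int[gaussian R 0]_x f x = f 0%R.
Proof. by move=> mf; rewrite /= integral_dirac// diracT mul1e. Qed.

(** If [S] transports [h] to the Gaussian measure then, by the Monge-Ampere
   equation, this is [n] times the [n]-th root of the Jacobian determinant of
   [S]. *)
Definition transport_gain n (h : 'rV[R]_n -> R) (S : 'rV[R]_n -> 'rV[R]_n)
    (x : 'rV[R]_n) : R :=
  (n%:R * expR ((sqnorm x / 2 - sqnorm (S x) / 2 - ln (h x)) / n%:R))%R.

Lemma transport_gain_ge0 n h S (x : 'rV[R]_n) : (0 <= transport_gain h S x)%R.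
Proof. by apply: mulr_ge0 => //; exact: expR_ge0. Qed.

Lemma measurable_transport_gain n (h : 'rV[R]_n -> R) (S : 'rV[R]_n -> 'rV[R]_n) :
  measurable_fun [set: 'rV[R]_n] h -> measurable_fun [set: 'rV[R]_n] S ->
  measurable_fun [set: 'rV[R]_n] (transport_gain h S).
Proof.
move=> mh mS; apply: measurable_funM => //; apply: measurableT_comp => //.
apply: measurable_funM => //; apply: measurable_funB; last exact: measurableT_comp.
apply: measurable_funB; apply: measurable_funM => //; apply: measurable_sqnorm_comp => //.
Qed.

Lemma density_dim0 n (g : 'rV[R]_n -> R) (y z : 'rV[R]_n) : n = 0%N ->
  probability_density (gaussian R n) g ->
  (sqnorm y / 2 - sqnorm z / 2 - ln (g y) = 0)%R.
Proof.
move=> n0; subst n => gd; rewrite /sqnorm !big_ord0 mul0r subrr sub0r.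
have -> : y = 0%R by rewrite (thinmx0 y).
have := integral_density gd; rewrite integral_gaussian0.
  by move=> -[->]; rewrite ln1 oppr0.
by apply/measurable_EFinP; exact: (measurable_density gd).
Qed.

(** The Knothe map: the first coordinate is transported by the quantile map of
   its conditional density given the other coordinates, which are transported by
   the map of their marginal density.  The cost is additive over coordinates,
   and so is the diagonal of the triangular Jacobian matrix; [expR_am_gm] bounds
   its determinant by its trace one coordinate at a time. *)
Lemma gaussian_transport n (h : 'rV[R]_n -> R) :
  probability_density (gaussian R n) h ->
  exists S : 'rV[R]_n -> 'rV[R]_n, [/\ measurable_fun [set: 'rV[R]_n] S,
    (forall f : 'rV[R]_n -> \bar R, measurable_fun [set: 'rV[R]_n] f ->
      (forall x, 0 <= f x) ->
      \int[gaussian R n]_x (f (S x) * (h x)%:E) = \int[gaussian R n]_x f x) &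
    \int[gaussian R n]_x ((sqnorm (x - S x) / 2 + transport_gain h S x)%:E * (h x)%:E)
    <= \int[gaussian R n]_x (((sqnorm x + n%:R) / 2)%:E * (h x)%:E)].
Proof.
elim: n => [|n IH] in h * => hd.
  have mh := measurable_density hd; have h0 := density_ge0 hd.
  have h1 : h 0%R = 1%R.
    have := integral_density hd; rewrite integral_gaussian0; first by move=> -[].
    exact/measurable_EFinP.
  exists id; split => //.
    move=> f mf f0; rewrite !integral_gaussian0//; first by rewrite h1 mule1.
    by apply: emeasurable_funM => //; exact/measurable_EFinP.
  apply: ge0_le_integralT => //.
  - apply: emeasurable_funM; apply/measurable_EFinP => //; apply: measurable_funD.
      by apply: measurable_funM => //; apply: measurable_sqnorm_comp; exact: measurable_rVB.
    exact: measurable_transport_gain.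
  - apply: emeasurable_funM; apply/measurable_EFinP => //.
    by apply: measurable_funM => //; apply: measurable_funD => //; exact: measurable_sqnorm_comp.
  - move=> x; rewrite mule_ge0 ?lee_fin ?addr_ge0 ?transport_gain_ge0//.
    by rewrite divr_ge0 ?sqnorm_ge0.
  - move=> x; rewrite lee_wpmul2r ?lee_fin// /transport_gain mul0r.
    by rewrite /sqnorm !big_ord0 !addr0.
have mh := measurable_density hd; have h0 := density_ge0 hd.
have [S' [mS' pS' cS']] := IH _ (marginal_density hd).
pose g := marginal h.
have g0 y : (0 <= g y)%R by exact: (marginal_ge0 hd).
have mg : measurable_fun [set: 'rV[R]_n] g by exact: (measurable_marginal hd).
pose m := conditional h.
have m0 y t : (0 <= m y t)%R by exact: (conditional_ge0 hd).
have md y : probability_density gamma1 (m y) by exact: (conditional_density hd).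
have mm := measurable_conditional hd.
pose T y t := quantile (cdf1 (m y) t).
have mT : measurable_fun [set: measurableTypeR R * 'rV[R]_n] (fun p => T p.2 p.1).
  exact: (measurableT_comp (@measurable_quantile R) (measurable_cdf1_conditional hd)).
pose S (x : 'rV[R]_n.+1) : 'rV[R]_n.+1 :=
  cons_rV (T (rV_tail x) (rV_head x), S' (rV_tail x)).
have Sc t y : S (cons_rV (t, y)) = cons_rV (T y t, S' y).
  by rewrite /S rV_head_cons rV_tail_cons.
have mc := @measurable_cons_rV R n.
have mhd := @measurable_rV_head R n; have mtl := @measurable_rV_tail R n.
have mS : measurable_fun [set: 'rV[R]_n.+1] S.
  apply: (measurableT_comp mc (g := fun x => (T (rV_tail x) (rV_head x), S' (rV_tail x)))).
  apply: measurable_fun_pair.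
    apply: (measurableT_comp mT (g := fun x => (rV_head x, rV_tail x))).
    exact: measurable_fun_pair.
  exact: (measurableT_comp mS' mtl).
exists S; split => //.
- move=> f mf f0.
  rewrite (@disintegration _ _ _ hd (f \o S))//; last 2 first.
  - exact: (measurableT_comp mf mS).
  - by move=> x /=.
  pose H (w : 'rV[R]_n) := \int[gamma1]_t f (cons_rV (t, w)).
  have mfc : measurable_fun [set: measurableTypeR R * 'rV[R]_n] (fun p => f (cons_rV p)).
    exact: (measurableT_comp mf mc).
  have mH : measurable_fun [set: 'rV[R]_n] H.
    exact: (@measurable_fun_fubini_tonelli_G _ _ _ _ _ gamma1
      (fun p : _ * 'rV[R]_n => f (cons_rV p)) mfc (fun p => f0 _)).
  rewrite ge0_integral_gaussianS// -/H -(pS' H)//; last first.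
    by move=> w; apply: integral_ge0 => t _.
  apply: eq_integral => y _; rewrite muleC; congr (_ * _).
  under eq_integral do rewrite /= Sc.
  rewrite (quantile_transport_push (md y) (f := fun s => f (cons_rV (s, S' y))))//.
  exact: (measurableT_comp mfc (pair2_measurable (S' y))).
- pose L x := (sqnorm (x - S x) / 2 + transport_gain h S x)%R.
  pose B y := (sqnorm (y - S' y) / 2 + transport_gain g S' y)%R.
  pose A t y := (2^-1 * (t - T y t) ^+ 2 +
    expR (t ^+ 2 / 2 - T y t ^+ 2 / 2 - ln (m y t)))%R.
  have mL : measurable_fun [set: 'rV[R]_n.+1] L.
    apply: measurable_funD; last exact: measurable_transport_gain.
    by apply: measurable_funM => //; apply: measurable_sqnorm_comp; exact: measurable_rVB.
  have L0r x : (0 <= L x)%R.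
    by rewrite addr_ge0 ?transport_gain_ge0// divr_ge0 ?sqnorm_ge0.
  have L0 x : 0 <= (L x)%:E by rewrite lee_fin.
  have mB : measurable_fun [set: 'rV[R]_n] B.
    apply: measurable_funD; last exact: measurable_transport_gain.
    by apply: measurable_funM => //; apply: measurable_sqnorm_comp; exact: measurable_rVB.
  have B0r y : (0 <= B y)%R.
    by rewrite addr_ge0 ?transport_gain_ge0// divr_ge0 ?sqnorm_ge0.
  have B0 y : 0 <= (B y)%:E by rewrite lee_fin.
  have LAB y t : (0 < g y)%R -> (0 < m y t)%R -> (L (cons_rV (t, y)) <= A t y + B y)%R.
    move=> gy my; rewrite /L /A /B Sc cons_rVB sqnorm_cons /transport_gain.
    rewrite Sc !sqnorm_cons (marginalM _ gy) lnM ?posrE//.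
    set a := (t ^+ 2 / 2 - T y t ^+ 2 / 2 - ln (m y t))%R.
    set b := (sqnorm y / 2 - sqnorm (S' y) / 2 - ln (g y))%R.
    have n0b : n = 0%N -> b = 0%R.
      by move=> n0; apply: density_dim0 => //; exact: marginal_density.
    have := expR_am_gm a n0b.
    rewrite (_ : (_ / n.+1%:R)%R = ((t ^+ 2 + sqnorm y) / 2 - (T y t ^+ 2 +
      sqnorm (S' y)) / 2 - (ln (marginal h y) + ln (conditional h y t))) / n.+1%:R)%R;
      last by rewrite /a /b; congr (_ / _)%R; rewrite /g /m; ring.
    lra.
  pose D y := \int[gamma1]_t ((2^-1 * (t ^+ 2 + 1))%:E * (m y t)%:E).
  have mDi y : measurable_fun [set: R] (fun t : R => (2^-1 * (t ^+ 2 + 1))%:E).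
    by apply/measurable_EFinP; apply: measurable_funM => //; apply: measurable_funD => //; exact: measurable_funX.
  have mtm : measurable_fun [set: measurableTypeR R * 'rV[R]_n]
      (fun p => (2^-1 * (p.1 ^+ 2 + 1))%:E * (m p.2 p.1)%:E).
    apply: emeasurable_funM; apply/measurable_EFinP => //.
    apply: measurable_funM => //; apply: measurable_funD => //.
    by apply: measurable_funX; exact: measurable_fst.
  have q0 (t : R) : (0 <= 2^-1 * (t ^+ 2 + 1))%R.
    by apply: mulr_ge0 => //; apply: addr_ge0 => //; exact: sqr_ge0.
  have D0 y : 0 <= D y.
    by apply: integral_ge0 => t _; rewrite mule_ge0 ?lee_fin.
  have mD : measurable_fun [set: 'rV[R]_n] D.
    apply: (@measurable_fun_fubini_tonelli_G _ _ _ _ _ gamma1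
      (fun p : _ * 'rV[R]_n => (2^-1 * (p.1 ^+ 2 + 1))%:E * (m p.2 p.1)%:E) mtm).
    by move=> p; rewrite mule_ge0 ?lee_fin.
  rewrite (@disintegration _ _ _ hd (EFin \o L))//; last exact/measurable_EFinP.
  rewrite (@disintegration _ _ _ hd (fun x => ((sqnorm x + n.+1%:R) / 2)%:E))//; last 2 first.
  + apply/measurable_EFinP; apply: measurable_funM => //; apply: measurable_funD => //.
    exact: measurable_sqnorm_comp.
  + by move=> x; rewrite lee_fin divr_ge0// addr_ge0// sqnorm_ge0.
  have massm y : \int[gamma1]_t (m y t)%:E = 1 by exact: (integral_density (md y)).
  have mmy y : measurable_fun [set: R] (m y) by exact: (measurable_density (md y)).
  have mEmy y : measurable_fun [set: R] (fun t => (m y t)%:E) by exact/measurable_EFinP.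
  have Dadd (y : 'rV[R]_n) (b : R) : (0 <= b)%R ->
      \int[gamma1]_t ((2^-1 * (t ^+ 2 + 1) + b)%:E * (m y t)%:E) = D y + b%:E.
    move=> b0; transitivity (\int[gamma1]_t ((2^-1 * (t ^+ 2 + 1))%:E * (m y t)%:E +
        b%:E * (m y t)%:E)).
      by apply: eq_integral => t _; rewrite EFinD ge0_muleDl ?lee_fin.
    rewrite ge0_integralDT.
    - rewrite (@ge0_integralMl _ _ _ gamma1 setT b)//; last 2 first.
      + exact: mEmy.
      + by move=> t _; rewrite lee_fin.
      by rewrite massm mule1.
    - by apply: emeasurable_funM; [exact: mDi|exact: mEmy].
    - by apply: emeasurable_funM => //; exact: mEmy.
    - by move=> t; rewrite mule_ge0 ?lee_fin.
    - by move=> t; rewrite mule_ge0 ?lee_fin.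
  have mEg : measurable_fun [set: 'rV[R]_n] (fun y => (g y)%:E) by exact/measurable_EFinP.
  have mEB : measurable_fun [set: 'rV[R]_n] (fun y => (B y)%:E) by exact/measurable_EFinP.
  have mLc : measurable_fun [set: measurableTypeR R * 'rV[R]_n] (fun p => L (cons_rV p)).
    exact: (measurableT_comp mL mc).
  apply: (@le_trans _ _ (\int[gaussian R n]_y ((g y)%:E * (D y + (B y)%:E)))).
    apply: ge0_le_integralT.
    - apply: emeasurable_funM => //.
      apply: (@measurable_fun_fubini_tonelli_G _ _ _ _ _ gamma1
        (fun p : _ * 'rV[R]_n => (L (cons_rV p))%:E * (m p.2 p.1)%:E)).
        by apply: emeasurable_funM; exact/measurable_EFinP.
      by move=> p; rewrite mule_ge0 ?lee_fin.
    - by apply: emeasurable_funM => //; exact: emeasurable_funD.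
    - move=> y; rewrite mule_ge0 ?lee_fin//; apply: integral_ge0 => t _.
      by rewrite mule_ge0 ?lee_fin.
    - move=> y; have [gy|gy] := ltP 0%R (g y); last first.
        have -> : marginal h y = 0%R by apply/eqP; rewrite eq_le gy g0.
        have -> : g y = 0%R by apply/eqP; rewrite eq_le gy g0.
        by rewrite !mul0e.
      rewrite lee_wpmul2l ?lee_fin//.
      have mTy : measurable_fun [set: R] (T y).
        exact: (measurableT_comp mT (pair2_measurable y)).
      have msq : measurable_fun [set: R] (fun t => 2^-1 * (t - T y t) ^+ 2 * m y t)%R.
        apply: measurable_funM => //; apply: measurable_funM => //.
        by apply: measurable_funX; exact: measurable_funB.
      have mx2 : measurable_fun [set: R] (fun x : R => x ^+ 2)%R by exact: measurable_funX.
      have mex : measurable_fun [set: R]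
          (fun t => expR (t ^+ 2 / 2 - T y t ^+ 2 / 2 - ln (m y t)) * m y t)%R.
        apply: measurable_funM => //; apply: measurableT_comp => //.
        apply: measurable_funB; last exact: measurableT_comp.
        by apply: measurable_funB; apply: measurable_funM => //; exact: measurable_funX.
      have sq0 t : 0 <= (2^-1 * (t - T y t) ^+ 2 * m y t)%:E.
        by rewrite lee_fin; apply: mulr_ge0 => //; apply: mulr_ge0 => //; exact: sqr_ge0.
      have ex0 t : 0 <= (expR (t ^+ 2 / 2 - T y t ^+ 2 / 2 - ln (m y t)) * m y t)%:E.
        by rewrite lee_fin mulr_ge0 ?expR_ge0.
      have Bm0 t : 0 <= (B y)%:E * (m y t)%:E by rewrite mule_ge0 ?lee_fin.
      have mBm : measurable_fun [set: R] (fun t => (B y)%:E * (m y t)%:E).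
        by apply: emeasurable_funM => //; exact: mEmy.
      apply: (@le_trans _ _ (\int[gamma1]_t ((2^-1 * (t - T y t) ^+ 2 * m y t)%:E +
          (expR (t ^+ 2 / 2 - T y t ^+ 2 / 2 - ln (m y t)) * m y t)%:E +
          (B y)%:E * (m y t)%:E))).
        apply: ge0_le_integralT.
        + apply: emeasurable_funM; apply/measurable_EFinP; last exact: mmy.
          exact: (measurableT_comp mLc (pair2_measurable y)).
        + apply: emeasurable_funD; last exact: mBm.
          by apply: emeasurable_funD; apply/measurable_EFinP; [exact: msq|exact: mex].
        + by move=> t; rewrite mule_ge0 ?lee_fin.
        + move=> t; have [my|my] := ltP 0%R (m y t); last first.
            have -> : conditional h y t = 0%R by apply/eqP; rewrite eq_le my m0.
            by rewrite mule0 !adde_ge0.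
          rewrite -!EFinM -!EFinD lee_fin -!mulrDl ler_wpM2r//.
          exact: LAB.
      rewrite ge0_integralDT; last 4 first.
      + by apply: emeasurable_funD; apply/measurable_EFinP; [exact: msq|exact: mex].
      + exact: mBm.
      + by move=> t; apply: adde_ge0.
      + by [].
      rewrite ge0_integralDT; last 4 first.
      + by apply/measurable_EFinP; exact: msq.
      + by apply/measurable_EFinP; exact: mex.
      + by [].
      + by [].
      rewrite (@ge0_integralMl _ _ _ gamma1 setT (B y))//; last 2 first.
      + exact: mEmy.
      + by move=> t _; rewrite lee_fin.
      rewrite massm mule1 leeD2r//.
      apply: (le_trans (quantile_transport_cost (md y))).
      by rewrite /D; under eq_integral do rewrite EFinM.
  have RE y : \int[gamma1]_t (((sqnorm (cons_rV (t, y)) + n.+1%:R) / 2)%:E *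
      (conditional h y t)%:E) = D y + ((sqnorm y + n%:R) / 2)%:E.
    rewrite -Dadd; last by rewrite divr_ge0// addr_ge0// sqnorm_ge0.
    apply: eq_integral => t _; congr (_%:E * _).
    by rewrite sqnorm_cons -natr1; lra.
  under [leRHS]eq_integral do rewrite RE.
  have dist (b : 'rV[R]_n -> R) : measurable_fun [set: 'rV[R]_n] b ->
      (forall y, (0 <= b y)%R) ->
      \int[gaussian R n]_y ((g y)%:E * (D y + (b y)%:E)) =
      \int[gaussian R n]_y ((g y)%:E * D y) + \int[gaussian R n]_y ((b y)%:E * (g y)%:E).
    move=> mb b0; rewrite -ge0_integralDT.
    - by apply: eq_integral => y _; rewrite ge0_muleDr ?lee_fin// (muleC (b y)%:E).
    - by apply: emeasurable_funM.
    - by apply: emeasurable_funM => //; exact/measurable_EFinP.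
    - by move=> y; rewrite mule_ge0 ?lee_fin.
    - by move=> y; rewrite mule_ge0 ?lee_fin.
  rewrite dist// (dist (fun y => (sqnorm y + n%:R) / 2)%R)//; last 2 first.
  + apply: measurable_funM => //; apply: measurable_funD => //.
    exact: measurable_sqnorm_comp.
  + by move=> y; rewrite divr_ge0// addr_ge0// sqnorm_ge0.
  by rewrite leeD2l.
Qed.

End gaussian_transport.

(** * Moments and entropy *)
Section gaussian_moments.
Context (R : realType).
Local Notation gamma1 := (@normal_prob R 0 1).
Local Open Scope ereal_scope.

Lemma measurable_sqnorm n : measurable_fun [set: 'rV[R]_n] (@sqnorm R n).
Proof. exact: measurable_sqnorm_comp. Qed.

Lemma gaussian_exp_lty n :
  \int[gaussian R n]_x (expR (sqnorm x / 4))%:E < +oo.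
Proof.
have me k : measurable_fun [set: 'rV[R]_k] (fun x => (expR (sqnorm x / 4))%:E).
  apply/measurable_EFinP; apply: measurableT_comp => //.
  by apply: measurable_funM => //; exact: measurable_sqnorm.
elim: n => [|n IH]; first by rewrite integral_gaussian0// ltry.
rewrite ge0_integral_gaussianS//.
under eq_integral.
  move=> y _; under eq_integral do rewrite sqnorm_cons mulrDl expRD mulrC EFinM.
  rewrite ge0_integralMl ?expR_ge0//; last first.
    apply/measurable_EFinP; apply: measurableT_comp => //.
    by apply: measurable_funM => //; exact: measurable_funX.
  over.
rewrite ge0_integralZr//; last 2 first.
- exact: me.
- exact: integral_ge0.
apply: lte_mul_pinfty; [exact: integral_ge0| |exact: gamma1_exp_lty].
by rewrite ge0_fin_numE//; exact: integral_ge0.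
Qed.

Lemma gaussian_integral_sqnorm n :
  \int[gaussian R n]_x (sqnorm x)%:E = n%:R%:E.
Proof.
have me k : measurable_fun [set: 'rV[R]_k] (fun x => (sqnorm x)%:E).
  by apply/measurable_EFinP; exact: measurable_sqnorm.
have y1 : \int[gamma1]_t (t ^+ 2)%:E = 1.
  have := gamma1_sqr_dist (0 : R)%R; rewrite expr0n/= add0r => <-.
  by apply: eq_integral => t _; rewrite sub0r sqrrN.
elim: n => [|n IH]; first by rewrite integral_gaussian0// /sqnorm big_ord0.
rewrite ge0_integral_gaussianS//; last by move=> x; rewrite lee_fin sqnorm_ge0.
under eq_integral.
  move=> y _; under eq_integral do rewrite sqnorm_cons EFinD.
  rewrite ge0_integralDT//; last 3 first.
  - by apply/measurable_EFinP; exact: measurable_funX.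
  - by move=> t; rewrite lee_fin sqr_ge0.
  - by move=> t; rewrite lee_fin sqnorm_ge0.
  rewrite y1 integral_prob_cst.
  over.
rewrite ge0_integralDT//; last 2 first.
- exact: me.
- by move=> t; rewrite lee_fin sqnorm_ge0.
by rewrite integral_prob_cst IH -EFinD -natr1 addrC.
Qed.

End gaussian_moments.

Section entropy.
Context d (T : measurableType d) (R : realType) (mu : {measure set T -> \bar R}).
Variables (h : T -> R) (hd : probability_density mu h).
Local Open Scope ereal_scope.

Lemma EntE : Ent mu h = \int[mu]_x (h x * ln (h x))%:E.
Proof. by rewrite /Ent (integral_density hd) lne1 mule0 sube0. Qed.

End entropy.

(** Young's inequality for the convex conjugate pair [x ln x - x], [expR]. *)
Lemma xlnx_ge (R : realType) (a b : R) : 0 <= a -> a * b + a - expR b <= a * ln a.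
Proof.
rewrite le_eqVlt => /predU1P[<-|a0]; first by rewrite !mul0r !add0r oppr_le0 expR_ge0.
have := expR_tangent (ln a) b; rewrite lnK ?posrE//; lra.
Qed.

Section entropy_prob.
Context d (T : measurableType d) (R : realType) (P : probability T R).
Variables (h : T -> R) (hd : probability_density P h).
Local Open Scope ereal_scope.

Let f (x : T) : \bar R := (h x * ln (h x))%:E.

Lemma measurable_xlnx : measurable_fun [set: T] (fun x => h x * ln (h x))%R.
Proof.
have mh := measurable_density hd.
by apply: measurable_funM => //; exact: measurableT_comp.
Qed.

Let mf : measurable_fun [set: T] f.
Proof. by apply/measurable_EFinP; exact: measurable_xlnx. Qed.

Let int_neg_le1 : \int[P]_x f^\- x <= 1.
Proof.
rewrite -(integral_prob_cst P 1); apply: ge0_le_integralT => //.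
- exact: measurable_funeneg.
- move=> x; rewrite funenegE ge_max lee01 andbT /f -EFinN lee_fin lerNl.
  apply: le_trans (xlnx_ge 0 (density_ge0 hd x)).
  by rewrite mulr0 add0r expR0 lerBrDl addrN (density_ge0 hd).
Qed.

Let int_neg_fin : \int[P]_x f^\- x \is a fin_num.
Proof.
rewrite ge0_fin_numE; first exact: (le_lt_trans int_neg_le1 (ltry _)).
exact: integral_ge0.
Qed.

Lemma Ent_neqNy : Ent P h != -oo.
Proof.
rewrite (EntE hd) integralE.
have : \int[P]_x f^\+ x != -oo.
  by rewrite -ltNye (lt_le_trans ltNy0)// integral_ge0.
by move: int_neg_fin; case: (\int[P]_x f^\- x) => [r| |]//; case: (\int[P]_x f^\+ x).
Qed.

Lemma integrable_xlnx : Ent P h != +oo ->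
  P.-integrable [set: T] f /\ exists e, Ent P h = e%:E.
Proof.
move=> Efin.
have EF : Ent P h \is a fin_num by rewrite fin_numE Efin Ent_neqNy.
split; last by exists (fine (Ent P h)); rewrite fineK.
apply/integrableP; split => //; rewrite integral_fin_num_abs//; last exact: measurable_xlnx.
by rewrite -(EntE hd).
Qed.

(** The entropy inequality [v * h <= h ln h - h + expR v] integrated: a finite
   entropy forces [v * h] to be integrable. *)
Lemma Ent_pinfty (v : T -> R) : measurable_fun [set: T] v -> (forall x, 0 <= v x)%R ->
  \int[P]_x (expR (v x))%:E < +oo ->
  \int[P]_x (v x * h x)%:E = +oo -> Ent P h = +oo.
Proof.
move=> mv v0 ev vh.
have mh := measurable_density hd; have h0 := density_ge0 hd.
have mev : measurable_fun [set: T] (fun x => (expR (v x))%:E).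
  by apply/measurable_EFinP; exact: measurableT_comp.
have fpy : \int[P]_x f^\+ x = +oo.
  have : \int[P]_x (v x * h x)%:E <= \int[P]_x (f^\+ x + (expR (v x))%:E).
    apply: ge0_le_integralT.
    - by apply/measurable_EFinP; exact: measurable_funM.
    - by apply: emeasurable_funD => //; exact: measurable_funepos.
    - by move=> x; rewrite lee_fin mulr_ge0.
    - move=> x; apply: (@le_trans _ _ (f x + (expR (v x))%:E)).
        rewrite /f -EFinD lee_fin; have := xlnx_ge (v x) (h0 x); have := h0 x; lra.
      by rewrite leeD2r// funeposE le_max lexx.
  rewrite vh ge0_integralDT//; last exact: measurable_funepos.
  rewrite leye_eq => /eqP; move: ev.
  by case: (\int[P]_x (expR (v x))%:E) => [r| |]//; case: (\int[P]_x f^\+ x).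
rewrite (EntE hd) integralE fpy.
by move: int_neg_fin; case: (\int[P]_x f^\- x).
Qed.

End entropy_prob.

(** * The refined and the classical Talagrand inequalities *)
Section transport_coupling.
Context (R : realType) (n : nat).
Variables (h : 'rV[R]_n -> R) (hd : probability_density (gaussian R n) h).
Variables (S : 'rV[R]_n -> 'rV[R]_n).
Local Open Scope ereal_scope.
Hypothesis mS : measurable_fun [set: 'rV[R]_n] S.
Hypothesis S_push : forall f : 'rV[R]_n -> \bar R, measurable_fun [set: 'rV[R]_n] f ->
  (forall x, 0 <= f x) ->
  \int[gaussian R n]_x (f (S x) * (h x)%:E) = \int[gaussian R n]_x f x.

Let graph (x : 'rV[R]_n) : 'rV[R]_n * 'rV[R]_n := (x, S x).

Let mgraph : measurable_fun [set: 'rV[R]_n] graph.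
Proof. exact: measurable_fun_pair. Qed.

HB.instance Definition _ := isMeasurableFun.Build _ _ _ _ graph mgraph.

Let plan : probability ('rV[R]_n * 'rV[R]_n)%type R :=
  distribution (density_prob hd) graph.

Let plan_coupling :
  coupling (density_measure (gaussian R n) h) (gaussian R n) plan.
Proof.
move=> A mA; split; first by [].
have mI : measurable_fun [set: 'rV[R]_n] (fun x => (\1_A x)%:E : \bar R).
  by apply/measurable_EFinP; exact: measurable_indic.
have I0 x : 0 <= (\1_A x)%:E :> \bar R by rewrite lee_fin.
rewrite -[in RHS](setIT A) -integral_indic// -(S_push mI I0).
rewrite -[LHS]/(\int[gaussian R n]_(x in S @^-1` A) (h x)%:E) integral_mkcond.
apply: eq_integral => x _; rewrite patchE indicE.
have -> : (x \in S @^-1` A) = (S x \in A) by apply/idP/idP => /set_mem ?; exact/mem_set.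
by case: ifP => _; rewrite ?mul1e ?mul0e.
Qed.

(** The law of [(x, S x)] under the density [h] is an admissible coupling. *)
Lemma W2_transport_le : W2 (density_measure (gaussian R n) h) (gaussian R n) ^+ 2 <=
  \int[gaussian R n]_x ((sqnorm (x - S x) / 2)%:E * (h x)%:E).
Proof.
set C := (X in _ <= X).
have C0 : 0 <= C.
  apply: integral_ge0 => x _.
  by rewrite mule_ge0 ?lee_fin ?(density_ge0 hd)// divr_ge0 ?sqnorm_ge0.
have msq : measurable_fun [set: 'rV[R]_n * 'rV[R]_n]
    (fun p => (sqnorm (p.1 - p.2) / 2)%:E).
  apply/measurable_EFinP; apply: measurable_funM => //.
  by apply: measurable_sqnorm_comp; exact: measurable_rVB.
have sq0 (p : 'rV[R]_n * 'rV[R]_n) : 0 <= (sqnorm (p.1 - p.2) / 2)%:E.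
  by rewrite lee_fin divr_ge0 ?sqnorm_ge0.
have planC : \int[plan]_p (sqnorm (p.1 - p.2) / 2)%:E = C.
  rewrite ge0_integral_distribution//.
  rewrite (@ge0_integral_density _ _ _ (gaussian R n) (density_prob hd) h
    (measurable_density hd) (density_ge0 hd) (fun A _ => erefl))//.
    exact: (measurableT_comp msq mgraph).
  by move=> x; exact: (sq0 (graph x)).
have W0 : 0 <= W2 (density_measure (gaussian R n) h) (gaussian R n).
  by apply/ereal_infP => _ [pi _ <-]; exact: sqrte_ge0.
rewrite -(sqr_sqrte C0) !expe2; apply: lee_pmul => //;
  by apply: ereal_inf_lbound; exists plan => //; rewrite planC.
Qed.

End transport_coupling.

Section talagrand.
Context (R : realType) (n : nat) (n_gt0 : (0 < n)%N).
Local Open Scope ereal_scope.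
Local Notation gamma := (gaussian R n).

Section main.
Variables (h : 'rV[R]_n -> R) (hd : probability_density gamma h).

Let mh := measurable_density hd.
Let h0 := density_ge0 hd.

Let M := \int[gamma]_x (sqnorm x * h x)%:E.

Let M0 : 0 <= M.
Proof. by apply: integral_ge0 => x _; rewrite lee_fin mulr_ge0 ?sqnorm_ge0. Qed.

(** [expR (sqnorm x / 4)] is integrable, so [Ent_pinfty] applies with
   [v x = sqnorm x / 4]. *)
Lemma density_laplacian_pinfty : density_laplacian h = +oo -> Ent gamma h = +oo.
Proof.
rewrite /density_laplacian -/M => My.
apply: (@Ent_pinfty _ _ _ _ _ hd (fun x => sqnorm x / 4)%R).
- by apply: measurable_funM => //; exact: measurable_sqnorm.
- by move=> x; rewrite divr_ge0 ?sqnorm_ge0.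
- exact: gaussian_exp_lty.
- rewrite (_ : \int[gamma]_x _ = 4^-1%:E * M).
    by move: My; case: M => //= _; rewrite gt0_muley// lte_fin invr_gt0.
  rewrite -ge0_integralMl//.
  + by apply: eq_integral => x _; rewrite -EFinM mulrCA mulrA.
  + by apply/measurable_EFinP; apply: measurable_funM => //; exact: measurable_sqnorm.
  + by move=> x _; rewrite lee_fin mulr_ge0 ?sqnorm_ge0.
Qed.

Lemma density_laplacian_cases :
  density_laplacian h = +oo \/ exists2 m : R, M = m%:E &
    density_laplacian h = (m - n%:R)%:E.
Proof.
rewrite /density_laplacian -/M; move: M0; case: M => [m| |]//= _; last by left.
by right; exists m.
Qed.

(** Jensen's inequality for [expR] under the density [h], where the mean [c] of
   the exponent is computed from the three finite integrals.  It is obtained by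
   integrating the tangent at [c], whose integrand times [h] is [expR c * w]. *)
Lemma transport_gain_ge (S : 'rV[R]_n -> 'rV[R]_n) (m e : R) :
  measurable_fun [set: 'rV[R]_n] S ->
  \int[gamma]_x ((sqnorm (S x))%:E * (h x)%:E) = n%:R%:E ->
  M = m%:E -> Ent gamma h = e%:E ->
  (n%:R * expR (((m - n%:R) / 2 - e) / n%:R))%:E <=
  \int[gamma]_x ((transport_gain h S x)%:E * (h x)%:E).
Proof.
move=> mS Sn Mm Ee.
have n0 : n%:R != 0%R :> R by rewrite pnatr_eq0 -lt0n.
have Efin : Ent gamma h != +oo by rewrite Ee.
have [ihl _] := integrable_xlnx hd Efin.
have mS2 : measurable_fun [set: 'rV[R]_n] (fun x => sqnorm (S x)).
  exact: measurable_sqnorm_comp.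
have iX : gamma.-integrable [set: _] (fun x => (sqnorm x * h x)%:E).
  apply/integrableP; split.
    by apply/measurable_EFinP; apply: measurable_funM => //; exact: measurable_sqnorm.
  under eq_integral do rewrite gee0_abs ?lee_fin ?mulr_ge0 ?sqnorm_ge0//.
  by rewrite -/M Mm ltry.
have iS : gamma.-integrable [set: _] (fun x => (sqnorm (S x) * h x)%:E).
  apply/integrableP; split.
    by apply/measurable_EFinP; apply: measurable_funM.
  under eq_integral do rewrite gee0_abs ?lee_fin ?mulr_ge0 ?sqnorm_ge0// EFinM.
  by rewrite Sn ltry.
have ih : gamma.-integrable [set: _] (fun x => (h x)%:E) := integrable_density hd.
set c := (((m - n%:R) / 2 - e) / n%:R)%R.
pose w x := ((1 - c) * n%:R * h x + 2^-1 * (sqnorm x * h x) -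
  2^-1 * (sqnorm (S x) * h x) - h x * ln (h x))%R.
have iw : gamma.-integrable [set: _] (fun x => (w x)%:E) /\
    \int[gamma]_x (w x)%:E = n%:R%:E.
  have i1 := integrableZl measurableT ((1 - c) * n%:R)%R ih.
  have i2 := integrableZl measurableT 2^-1%R iX.
  have i3 := integrableZl measurableT 2^-1%R iS.
  have i12 := integrableD measurableT i1 i2.
  have i123 := integrableB measurableT i12 i3.
  split; first by apply: eq_integrable (integrableB measurableT i123 ihl).
  transitivity (\int[gamma]_x (((((1 - c) * n%:R)%:E * (h x)%:E +
    2^-1%:E * (sqnorm x * h x)%:E) - 2^-1%:E * (sqnorm (S x) * h x)%:E) -
    (h x * ln (h x))%:E)).
    by apply: eq_integral => x _; rewrite -!EFinM -!EFinD.
  rewrite (integralB _ i123 ihl)//= (integralB _ i12 i3)//= (integralD _ i1 i2)//=.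
  rewrite !integralZl// (integral_density hd) -/M Mm -(EntE hd) Ee.
  under eq_integral do rewrite EFinM.
  rewrite Sn -!EFinM -!EFinD mulr1; congr EFin; rewrite /c; field.
  by [].
have mg : measurable_fun [set: 'rV[R]_n] (transport_gain h S).
  exact: measurable_transport_gain.
apply: (@le_trans _ _ (\int[gamma]_x ((expR c)%:E * (w x)%:E))).
  by rewrite integralZl ?(iw.2)//; [rewrite -EFinM lee_fin mulrC|exact: (iw.1)].
have mgh : measurable_fun [set: 'rV[R]_n]
    (fun x => (transport_gain h S x)%:E * (h x)%:E).
  by apply: emeasurable_funM; exact/measurable_EFinP.
have [->|gy] := eqVneq (\int[gamma]_x ((transport_gain h S x)%:E * (h x)%:E)) +oo.
  exact: leey.
apply: le_integral => //.
- exact: (integrableZl measurableT _ iw.1).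
- apply/integrableP; split => //.
  under eq_integral do rewrite gee0_abs ?mule_ge0 ?lee_fin ?transport_gain_ge0//.
  by rewrite ltey.
- move=> x _; rewrite -!EFinM lee_fin.
  pose u := ((sqnorm x / 2 - sqnorm (S x) / 2 - ln (h x)) / n%:R)%R.
  have -> : w x = (n%:R * h x * (1 + u - c))%R by rewrite /w /u; field.
  rewrite /transport_gain -/u mulrCA [leRHS]mulrAC ler_wpM2l ?mulr_ge0//.
  exact: expR_tangent.
Qed.

(** The cost of the Knothe map plus its gain is at most [(m + n) / 2], and the
   gain is bounded below by Jensen's inequality.  When the entropy is infinite
   the exponential in the claim vanishes and the gain is just dropped; when the
   second moment is infinite so is the right-hand side. *)
Lemma refined_talagrand_of :
  W2 (density_measure gamma h) gamma ^+ 2 <=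
  2^-1%:E * density_laplacian h
      + n%:R%:E * (1 - expeR ((2 * n%:R)^-1%:E * density_laplacian h
                              - n%:R^-1%:E * Ent gamma h)).
Proof.
have nn0 : (0 < n%:R :> R)%R by rewrite ltr0n.
have [S [mS pS cS]] := gaussian_transport hd.
have WC := W2_transport_le hd mS pS.
have mgn : measurable_fun [set: 'rV[R]_n] (transport_gain h S).
  exact: measurable_transport_gain.
set W := W2 _ _ ^+ 2 in WC *.
have mc : measurable_fun [set: 'rV[R]_n] (fun x => sqnorm (x - S x) / 2)%R.
  by apply: measurable_funM => //; apply: measurable_sqnorm_comp; exact: measurable_rVB.
have [Dy|[m Mm ->]] := density_laplacian_cases.
  rewrite Dy (density_laplacian_pinfty Dy) !gt0_muley ?lte_fin ?invr_gt0 ?mulr_gt0//.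
  rewrite (_ : +oo - +oo = -oo :> \bar R)//= sube0 mule1 addye//; exact: leey.
set C := (X in _ <= X) in WC.
pose G := \int[gamma]_x ((transport_gain h S x)%:E * (h x)%:E).
have CG : C + G <= ((m + n%:R) / 2)%:E.
  have -> : ((m + n%:R) / 2)%:E = \int[gamma]_x (((sqnorm x + n%:R) / 2)%:E * (h x)%:E).
    transitivity (2^-1%:E * (M + n%:R%:E * \int[gamma]_x (h x)%:E)).
      by rewrite Mm (integral_density hd) mule1 -EFinD -EFinM mulrC.
    have mEh : measurable_fun [set: 'rV[R]_n] (fun x => (h x)%:E) by exact/measurable_EFinP.
    have mEX : measurable_fun [set: 'rV[R]_n] (fun x => (sqnorm x * h x)%:E).
      by apply/measurable_EFinP; apply: measurable_funM => //; exact: measurable_sqnorm.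
    have X0 (x : 'rV[R]_n) : 0 <= (sqnorm x * h x)%:E by rewrite lee_fin mulr_ge0 ?sqnorm_ge0.
    have nh0 (x : 'rV[R]_n) : 0 <= n%:R%:E * (h x)%:E by rewrite mule_ge0 ?lee_fin.
    rewrite -ge0_integralMl//; last by move=> x _; rewrite lee_fin.
    rewrite -ge0_integralDT//; last exact: emeasurable_funM.
    rewrite -ge0_integralMl//; last 2 first.
    - by apply: emeasurable_funD => //; exact: emeasurable_funM.
    - by move=> x _; rewrite adde_ge0.
    by apply: eq_integral => x _; rewrite -(EFinM n%:R) -EFinD -!EFinM; congr EFin; field.
  apply: le_trans cS; rewrite -ge0_integralDT.
  - rewrite le_eqVlt; apply/orP; left; apply/eqP; apply: eq_integral => x _.
    by rewrite -!EFinM -EFinD mulrDl.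
  - by apply: emeasurable_funM; exact/measurable_EFinP.
  - by apply: emeasurable_funM; exact/measurable_EFinP.
  - by move=> x; rewrite mule_ge0 ?lee_fin// divr_ge0 ?sqnorm_ge0.
  - by move=> x; rewrite mule_ge0 ?lee_fin ?transport_gain_ge0.
have G0 : 0 <= G.
  by apply: integral_ge0 => x _; rewrite mule_ge0 ?lee_fin ?transport_gain_ge0.
apply: (le_trans WC); have [Ey|Efin] := eqVneq (Ent gamma h) +oo.
  rewrite Ey gt0_muley ?lte_fin ?invr_gt0//= sube0 mule1 -EFinM -EFinD.
  apply: le_trans (le_trans CG _); first exact: leeDl.
  by rewrite lee_fin; lra.
have [_ [e Ee]] := integrable_xlnx hd Efin.
have Sn : \int[gamma]_x ((sqnorm (S x))%:E * (h x)%:E) = n%:R%:E.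
  rewrite (pS (fun x => (sqnorm x)%:E)) ?gaussian_integral_sqnorm//.
    by apply/measurable_EFinP; exact: measurable_sqnorm.
  by move=> x; rewrite lee_fin sqnorm_ge0.
have Gk := transport_gain_ge mS Sn Mm Ee; rewrite -/G in Gk.
have {}CG := le_trans (leeD2l C Gk) CG.
rewrite Ee; pose t := ((2 * n%:R)^-1 * (m - n%:R) - n%:R^-1 * e)%R.
rewrite -[leRHS]/((2^-1 * (m - n%:R) + n%:R * (1 - expR t))%:E).
have tE : t = (((m - n%:R) / 2 - e) / n%:R)%R by rewrite /t; field; rewrite gt_eqF.
rewrite -tE in CG.
rewrite -leeBrDr// -EFinB in CG; apply: (le_trans CG).
by rewrite lee_fin; lra.
Qed.

End main.

Lemma refined_talagrand_gaussian : refined_Talagrand R n.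
Proof. by move=> h hd; exact: (refined_talagrand_of hd). Qed.

(** [n * (1 - expR t) <= - n * t] with [t] the exponent: the second moment
   cancels and the entropy remains. *)
Lemma classical_of_refined : refined_Talagrand R n -> classical_Talagrand R n.
Proof.
move=> RT G h hd; have H := RT h hd; apply: (le_trans H) => {H RT}.
have nn0 : (0 < n%:R :> R)%R by rewrite ltr0n.
have [->|Efin] := eqVneq (Ent (gaussian R n) h) +oo; first exact: leey.
have [_ [e Ee]] := integrable_xlnx hd Efin.
have [Dy|[m Mm ->]] := density_laplacian_cases hd.
  by move: Efin; rewrite (density_laplacian_pinfty hd Dy).
rewrite Ee; pose t := ((2 * n%:R)^-1 * (m - n%:R) - n%:R^-1 * e)%R.
rewrite -[leLHS]/((2^-1 * (m - n%:R) + n%:R * (1 - expR t))%:E) lee_fin.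
have tE : (n%:R * t = 2^-1 * (m - n%:R) - e)%R.
  by rewrite /t; field; rewrite gt_eqF.
have := ler_wpM2l (ltW nn0) (expR_ge1Dx t).
rewrite mulrDr tE; lra.
Qed.

End talagrand.

(** * Topology of row vectors *)
Section rV_topology.
Context (R : realType).

Lemma cvg_rV (T : Type) (F : set_system T) (FF : Filter F) n
  (f : T -> 'rV[R]_n) (l : 'rV[R]_n) :
  (forall i, f t ord0 i @[t --> F] --> l ord0 i) -> f t @[t --> F] --> l.
Proof.
move=> fl; apply/cvg_ballP => e e0.
have H i : \forall t \near F, ball (l ord0 i) e (f t ord0 i).
  by move/cvg_ballP: (fl i); exact.
have : \forall t \near F, forall i, ball (l ord0 i) e (f t ord0 i).
  exact: filter_forall.
by apply: filterS => t Ht; split => // i j; rewrite (ord1 i).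
Qed.

Lemma continuous_rV (T : topologicalType) n (f : T -> 'rV[R]_n) :
  (forall i, continuous (fun t => f t ord0 i)) -> continuous f.
Proof. by move=> cf x; apply: cvg_rV => i; exact: cf. Qed.

Lemma continuous_rV_coord n (i : 'I_n) : continuous (fun x : 'rV[R]_n => x ord0 i).
Proof. by move=> x; exact: coord_continuous. Qed.

Lemma continuous_cons_rVl n (y : 'rV[R]_n) : continuous (fun t : R => cons_rV (t, y)).
Proof.
apply: continuous_rV => i; case: (unliftP ord0 i) => [j|] ->.
  by under eq_fun do rewrite cons_rVS; move=> x; exact: cvg_cst.
rewrite (_ : (fun t => _) = id); first by move=> x; exact: cvg_id.
by apply/funext => t; rewrite cons_rV0.
Qed.

Lemma continuous_cons_rVr n (t : R) : continuous (fun y : 'rV[R]_n => cons_rV (t, y)).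
Proof.
apply: continuous_rV => i; case: (unliftP ord0 i) => [j|] ->.
  by under eq_fun do rewrite cons_rVS; exact: continuous_rV_coord.
rewrite (_ : (fun _ => _) = cst t); first exact: cst_continuous.
by apply/funext => y; rewrite cons_rV0.
Qed.

Lemma continuous_sqnorm n : continuous (@sqnorm R n).
Proof.
apply: continuous_big => [|i _ x]; first exact: add_continuous.
apply: (@continuous_comp _ _ _ (fun y : 'rV[R]_n => y ord0 i) (fun z => z ^+ 2)).
  exact: continuous_rV_coord.
exact: exprn_continuous.
Qed.

(* Rounding the coordinates to multiples of [1 / (k + 1)]: the rounded point takes
   countably many values on measurable cells, so [f] composed with it is
   measurable for any [f]. *)
Let grid n (k : nat) (x : 'rV[R]_n) : 'rV[int]_n :=
  \row_j Num.floor (x ord0 j * k.+1%:R).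

Let ungrid n (k : nat) (v : 'rV[int]_n) : 'rV[R]_n := \row_j ((v ord0 j)%:~R / k.+1%:R).

Let grid_cvg n (x : 'rV[R]_n) : ungrid k (grid k x) @[k --> \oo] --> x.
Proof.
apply: cvg_rV => j; apply/cvgrPdist_le => e e0.
near=> k; rewrite !mxE.
have k0 : 0 < k.+1%:R :> R by [].
have fl := floor_le (x ord0 j * k.+1%:R).
have fu := floorD1_gt (x ord0 j * k.+1%:R).
have ek : e^-1 <= k.+1%:R.
  by apply: (@le_trans _ _ k%:R); [near: k; exact: nbhs_infty_ger|rewrite ler_nat].
rewrite intrD in fu; move: fl fu; set z := (_%:~R) => fl fu.
rewrite ger0_norm ?subr_ge0 ?ler_pdivrMr// lerBlDl -lerBlDr ler_pdivlMr// mulrBl.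
have : 1 <= e * k.+1%:R by rewrite -ler_pdivrMl// mulr1.
by lra.
Unshelve. all: by end_near. Qed.

(** A pointwise limit of functions that are constant on the cells of finer and
   finer grids.  This links the product topology with the sigma-algebra
   generated by the coordinates. *)
Lemma continuous_measurable_rV n (f : 'rV[R]_n -> R) : continuous f ->
  measurable_fun [set: 'rV[R]_n] f.
Proof.
move=> cf.
apply: (@measurable_fun_cvg _ _ _ _ (fun k x => f (ungrid k (grid k x)))); last first.
  by move=> x _; apply: continuous_cvg; [exact: cf|exact: grid_cvg].
move=> k _ B mB; rewrite setTI.
have -> : (fun x => f (ungrid k (grid k x))) @^-1` B =
    \bigcup_(v in [set v | B (f (ungrid k v))]) [set x | grid k x = v].
  apply/seteqP; split => [x Bx|x [v /= Bv gx]]; last by rewrite gx.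
  by exists (grid k x).
rewrite bigcup_mkcond; apply: countable_bigcupT_measurable.
  exact: countableP.
move=> v; case: ifPn => // _.
rewrite (_ : [set x | _] = \big[setI/setT]_(j < n)
    [set x : 'rV[R]_n | Num.floor (rV_coord j x * k.+1%:R) = v ord0 j]); last first.
  rewrite -bigcap_seq; apply/seteqP; split => x /=.
    by move=> <- j _ /=; rewrite mxE.
  by move=> H; apply/rowP => j; rewrite mxE; apply: (H j); rewrite /= mem_index_enum.
apply: bigsetI_measurable => j _.
rewrite (_ : [set x | _] = (fun x => rV_coord j x * k.+1%:R) @^-1`
    `[(v ord0 j)%:~R, (v ord0 j + 1)%:~R[); last first.
  apply/seteqP; split => x /=; rewrite in_itv/=.
    by move/eqP; rewrite floor_eq.
  by move=> H; apply/eqP; rewrite floor_eq.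
rewrite -[X in measurable X]setTI.
have : measurable_fun [set: 'rV[R]_n] (fun x => rV_coord j x * k.+1%:R).
  by apply: measurable_funM => //; exact: measurable_rV_coord.
by apply.
Qed.

End rV_topology.

(** * The Poincare inequality in several dimensions *)
Section sections.
Context (R : realType) (n : nat) (f : 'rV[R]_n.+1 -> R).

Lemma cons_rV_shift_head (t : R) (y : 'rV[R]_n) (h : R) :
  cons_rV (h *: 1 + t, y) = h *: delta_mx ord0 ord0 + cons_rV (t, y).
Proof.
apply/rowP => i; case: (unliftP ord0 i) => [j|] ->.
  by rewrite cons_rVS [RHS]mxE cons_rVS !mxE/= mulr0 add0r.
by rewrite cons_rV0 [RHS]mxE cons_rV0 !mxE/=.
Qed.

Lemma cons_rV_shift_tail (t : R) (y : 'rV[R]_n) (h : R) (j : 'I_n) :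
  cons_rV (t, h *: delta_mx ord0 j + y) =
  h *: delta_mx ord0 (lift ord0 j) + cons_rV (t, y).
Proof.
apply/rowP => i; case: (unliftP ord0 i) => [k|] ->.
  by rewrite cons_rVS [RHS]mxE cons_rVS !mxE (inj_eq lift_inj).
by rewrite cons_rV0 [RHS]mxE cons_rV0 !mxE/= mulr0 add0r.
Qed.

Lemma is_derive_head (t : R) (y : 'rV[R]_n) :
  derivable f (cons_rV (t, y)) (delta_mx ord0 ord0) ->
  is_derive t (1 : R) (fun s => f (cons_rV (s, y))) (partial ord0 f (cons_rV (t, y))).
Proof.
have E : (fun h => h^-1 *: (((fun s => f (cons_rV (s, y))) \o shift t) (h *: (1 : R)) -
      f (cons_rV (t, y)))) =
    (fun h => h^-1 *: ((f \o shift (cons_rV (t, y))) (h *: delta_mx ord0 ord0) -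
      f (cons_rV (t, y)))).
  by apply/funext => h /=; rewrite cons_rV_shift_head.
move=> df; apply: DeriveDef; first by rewrite /derivable E.
by rewrite /partial /derive E.
Qed.

Let quotient_tail (t : R) (y : 'rV[R]_n) (j : 'I_n) :
  (fun h => h^-1 *: (((fun z => f (cons_rV (t, z))) \o shift y) (h *: delta_mx ord0 j) -
      f (cons_rV (t, y)))) =
    (fun h => h^-1 *: ((f \o shift (cons_rV (t, y))) (h *: delta_mx ord0 (lift ord0 j)) -
      f (cons_rV (t, y)))).
Proof. by apply/funext => h /=; rewrite cons_rV_shift_tail. Qed.

Lemma derivable_tail (t : R) (y : 'rV[R]_n) (j : 'I_n) :
  derivable f (cons_rV (t, y)) (delta_mx ord0 (lift ord0 j)) ->
  derivable (fun z => f (cons_rV (t, z))) y (delta_mx ord0 j).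
Proof. by rewrite /derivable quotient_tail. Qed.

Lemma partial_tail (t : R) (y : 'rV[R]_n) (j : 'I_n) :
  partial j (fun z => f (cons_rV (t, z))) y = partial (lift ord0 j) f (cons_rV (t, y)).
Proof. by rewrite /partial /derive quotient_tail. Qed.

Lemma class_C1_tail (t : R) : class_C 1 f -> class_C 1 (fun z => f (cons_rV (t, z))).
Proof.
move=> [cf df]; split.
  move=> z; apply: (@continuous_comp _ _ _ (fun z => cons_rV (t, z)) f).
    exact: continuous_cons_rVr.
  exact: cf.
move=> j; have [dfj [cpj _]] := df (lift ord0 j); split.
  by move=> z; exact/derivable_tail/dfj.
split => //; rewrite (_ : partial _ _ = fun z => partial (lift ord0 j) f (cons_rV (t, z))).
  move=> z; apply: (@continuous_comp _ _ _ (fun z => cons_rV (t, z)) (partial (lift ord0 j) f)).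
    exact: continuous_cons_rVr.
  exact: cpj.
by apply/funext => z; exact: partial_tail.
Qed.

End sections.

Section double_integral.
Context d1 d2 (T1 : measurableType d1) (T2 : measurableType d2) (R : realType).
Variables (m1 : {sigma_finite_measure set T1 -> \bar R})
  (m2 : {sigma_finite_measure set T2 -> \bar R}).
Local Open Scope ereal_scope.
Variables f : T1 -> T2 -> \bar R.
Hypothesis mf : measurable_fun [set: T1 * T2] (fun p => f p.1 p.2).
Hypothesis f0 : forall x y, 0 <= f x y.

Lemma measurable_ge0_integral2 : measurable_fun [set: T1] (fun x => \int[m2]_y f x y).
Proof. exact: (@measurable_fun_fubini_tonelli_F _ _ _ _ _ m2 (fun p => f p.1 p.2)). Qed.

Lemma ge0_integral2C :
  \int[m1]_x \int[m2]_y f x y = \int[m2]_y \int[m1]_x f x y.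
Proof. exact: (@fubini_tonelli _ _ _ _ _ m1 m2 (fun p => f p.1 p.2)). Qed.

End double_integral.

Section double_integral_theory.
Context d1 d2 (T1 : measurableType d1) (T2 : measurableType d2) (R : realType).
Variables (m1 : {sigma_finite_measure set T1 -> \bar R})
  (m2 : {sigma_finite_measure set T2 -> \bar R}).
Local Open Scope ereal_scope.
Variables f g : T1 -> T2 -> \bar R.
Hypotheses (mf : measurable_fun [set: T1 * T2] (fun p => f p.1 p.2))
  (mg : measurable_fun [set: T1 * T2] (fun p => g p.1 p.2)).
Hypotheses (f0 : forall x y, 0 <= f x y) (g0 : forall x y, 0 <= g x y).

Lemma ge0_integral2D :
  \int[m1]_x \int[m2]_y (f x y + g x y) =
  \int[m1]_x \int[m2]_y f x y + \int[m1]_x \int[m2]_y g x y.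
Proof.
have mfx x : measurable_fun [set: T2] (f x) := measurableT_comp mf (pair1_measurable x).
have mgx x : measurable_fun [set: T2] (g x) := measurableT_comp mg (pair1_measurable x).
rewrite -ge0_integralDT; first by apply: eq_integral => x _; rewrite ge0_integralDT.
- exact: measurable_ge0_integral2.
- exact: measurable_ge0_integral2.
- by move=> x; exact: integral_ge0.
- by move=> x; exact: integral_ge0.
Qed.

Lemma ge0_le_integral2 : (forall x y, f x y <= g x y) ->
  \int[m1]_x \int[m2]_y f x y <= \int[m1]_x \int[m2]_y g x y.
Proof.
move=> fg.
have mfx x : measurable_fun [set: T2] (f x) := measurableT_comp mf (pair1_measurable x).
have mgx x : measurable_fun [set: T2] (g x) := measurableT_comp mg (pair1_measurable x).
apply: ge0_le_integralT.
- exact: measurable_ge0_integral2.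
- exact: measurable_ge0_integral2.
- by move=> x; exact: integral_ge0.
- by move=> x; exact: ge0_le_integralT.
Qed.

End double_integral_theory.

Section poincare.
Context (R : realType).
Local Notation gamma1 := (@normal_prob R 0 1).
Local Open Scope ereal_scope.

Section tensor.
Context n (F : 'rV[R]_n.+1 -> R).
Hypothesis mF : measurable_fun [set: 'rV[R]_n.+1] F.
Local Notation gamma := (gaussian R n).

Let q (s t : R) (u v : 'rV[R]_n) : R := ((F (cons_rV (s, u)) - F (cons_rV (t, v))) ^+ 2)%R.

Let mq d (T : measurableType d) (s t : T -> R) (u v : T -> 'rV[R]_n) :
  measurable_fun [set: T] s -> measurable_fun [set: T] t ->
  measurable_fun [set: T] u -> measurable_fun [set: T] v ->
  measurable_fun [set: T] (fun w => (q (s w) (t w) (u w) (v w))%:E).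
Proof.
move=> ms mt mu mv.
have mc := @measurable_cons_rV R n.
have mFc (a : T -> R) (b : T -> 'rV[R]_n) : measurable_fun [set: T] a ->
    measurable_fun [set: T] b -> measurable_fun [set: T] (fun w => F (cons_rV (a w, b w))).
  move=> ma mb; apply: (measurableT_comp mF).
  apply: (measurableT_comp mc (g := fun w => (a w, b w))).
  exact: measurable_fun_pair.
by apply/measurable_EFinP; apply: measurable_funX; apply: measurable_funB; exact: mFc.
Qed.

Let q0 s t u v : 0 <= (q s t u v)%:E.
Proof. by rewrite lee_fin sqr_ge0. Qed.

(** Subadditivity of the variance over the two factors of a product.  For four
   values [a], [b], [c], [d] at the corners of a rectangle, the two diagonals
   are controlled by the four sides,
   [(a - d)^2 + (b - c)^2 <= (a - b)^2 + (c - d)^2 + (a - c)^2 + (b - d)^2];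
   integrating over the rectangles gives twice the claim. *)
Lemma sqr_incr_tensor :
  \int[gaussian R n.+1]_x \int[gaussian R n.+1]_y ((F x - F y) ^+ 2)%:E <=
  \int[gamma]_u \int[gamma1]_s \int[gamma1]_t
    ((F (cons_rV (s, u)) - F (cons_rV (t, u))) ^+ 2)%:E +
  \int[gamma1]_s \int[gamma]_u \int[gamma]_v
    ((F (cons_rV (s, u)) - F (cons_rV (s, v))) ^+ 2)%:E.
Proof.
pose J u v := \int[gamma1]_s \int[gamma1]_t (q s t u v)%:E.
pose Q u v := \int[gamma1]_s (q s s u v)%:E.
have mJ d (T : measurableType d) (u v : T -> 'rV[R]_n) : measurable_fun [set: T] u ->
    measurable_fun [set: T] v -> measurable_fun [set: T] (fun w => J (u w) (v w)).
  move=> mu mv; apply: (measurable_ge0_integral2 gamma1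
      (f := fun w s => \int[gamma1]_t (q s t (u w) (v w))%:E)).
    apply: (measurable_ge0_integral2 gamma1
      (f := fun (w : T * measurableTypeR R) t => (q w.2 t (u w.1) (v w.1))%:E)) => //.
    have m11 := measurableT_comp (@measurable_fst _ _ T (measurableTypeR R))
      (@measurable_fst _ _ (T * measurableTypeR R)%type (measurableTypeR R)).
    apply: mq => //=.
    - exact: (measurableT_comp measurable_snd measurable_fst).
    - exact: (measurableT_comp mu m11).
    - exact: (measurableT_comp mv m11).
  by move=> w s; exact: integral_ge0.
have mQ d (T : measurableType d) (u v : T -> 'rV[R]_n) : measurable_fun [set: T] u ->
    measurable_fun [set: T] v -> measurable_fun [set: T] (fun w => Q (u w) (v w)).
  move=> mu mv; apply: (measurable_ge0_integral2 gamma1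
      (f := fun w s => (q s s (u w) (v w))%:E)) => //.
  apply: mq => //.
  - exact: (measurableT_comp mu measurable_fst).
  - exact: (measurableT_comp mv measurable_fst).
have J0 u v : 0 <= J u v by do 2 (apply: integral_ge0 => ? _).
have Q0 u v : 0 <= Q u v by apply: integral_ge0 => ? _.
have JC u v : \int[gamma1]_s \int[gamma1]_t (q t s u v)%:E = J u v.
  by rewrite /J ge0_integral2C//; apply: mq => //; exact: measurable_cst.
have mqs (s t : measurableTypeR R * measurableTypeR R -> R) u v :
    measurable_fun setT s -> measurable_fun setT t ->
    measurable_fun setT (fun p => (q (s p) (t p) u v)%:E).
  by move=> ms mt; apply: mq => //; exact: measurable_cst.
have split4 u v : J u v + J u v <= (J u u + J v v) + (Q u v + Q u v).
  pose A s t := (q s t u v)%:E + (q t s u v)%:E.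
  pose B s t := (q s t u u)%:E + (q s t v v)%:E.
  pose C s t := (q s s u v)%:E + (q t t u v)%:E.
  have MD (a b c e : measurableTypeR R * measurableTypeR R -> R) u1 v1 u2 v2 :
      measurable_fun setT a -> measurable_fun setT b ->
      measurable_fun setT c -> measurable_fun setT e ->
      measurable_fun setT (fun p => (q (a p) (b p) u1 v1)%:E + (q (c p) (e p) u2 v2)%:E).
    by move=> ma mb mc me; apply: emeasurable_funD; exact: mqs.
  have mA : measurable_fun setT (fun p : measurableTypeR R * measurableTypeR R => A p.1 p.2) by exact: MD.
  have mB : measurable_fun setT (fun p : measurableTypeR R * measurableTypeR R => B p.1 p.2) by exact: MD.
  have mC : measurable_fun setT (fun p : measurableTypeR R * measurableTypeR R => C p.1 p.2) by exact: MD.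
  have EA : \int[gamma1]_s \int[gamma1]_t A s t = J u v + J u v.
    rewrite -{2}JC; apply: (ge0_integral2D gamma1 gamma1 (f := fun s t => (q s t u v)%:E)
      (g := fun s t => (q t s u v)%:E)) => //; exact: mqs.
  have EB : \int[gamma1]_s \int[gamma1]_t B s t = J u u + J v v.
    apply: (ge0_integral2D gamma1 gamma1 (f := fun s t => (q s t u u)%:E)
      (g := fun s t => (q s t v v)%:E)) => //; exact: mqs.
  have EQ : \int[gamma1]_s \int[gamma1]_t (q s s u v)%:E = Q u v.
    by apply: eq_integral => s _; exact: (integral_prob_cst gamma1).
  have EQ' : \int[gamma1]_s \int[gamma1]_t (q t t u v)%:E = Q u v.
    rewrite -EQ; apply: (ge0_integral2C gamma1 gamma1 (f := fun s t => (q t t u v)%:E)) => //.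
    exact: mqs.
  have EC : \int[gamma1]_s \int[gamma1]_t C s t = Q u v + Q u v.
    transitivity (\int[gamma1]_s \int[gamma1]_t (q s s u v)%:E +
        \int[gamma1]_s \int[gamma1]_t (q t t u v)%:E); last by rewrite EQ EQ'.
    apply: (ge0_integral2D gamma1 gamma1 (f := fun s t => (q s s u v)%:E)
      (g := fun s t => (q t t u v)%:E)) => //; exact: mqs.
  have EBC : \int[gamma1]_s \int[gamma1]_t (B s t + C s t) = (J u u + J v v) + (Q u v + Q u v).
    by rewrite -EB -EC; apply: (ge0_integral2D gamma1 gamma1 (f := B) (g := C)) => // s t; exact: adde_ge0.
  have A0 s t : 0 <= A s t by exact: adde_ge0.
  have ABC s t : A s t <= B s t + C s t.
    rewrite /A /B /C -!EFinD lee_fin /q -subr_ge0.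
    set a := F _; set b := F _; set c := F _; set d := F _.
    rewrite (_ : _ - _ = (a - b - c + d) ^+ 2)%R ?sqr_ge0//.
    by rewrite /a /b /c /d; ring.
  have BC0 s t : 0 <= B s t + C s t by do 2 apply: adde_ge0.
  have := ge0_le_integral2 gamma1 gamma1 mA (emeasurable_funD mB mC) A0 BC0 ABC.
  by rewrite EA EBC.
have m1 : measurable_fun [set: 'rV[R]_n * 'rV[R]_n] fst by exact: measurable_fst.
have m2 : measurable_fun [set: 'rV[R]_n * 'rV[R]_n] snd by exact: measurable_snd.
have mJ2 : measurable_fun [set: 'rV[R]_n * 'rV[R]_n] (fun p => J p.1 p.2) by exact: mJ.
have mJu : measurable_fun [set: 'rV[R]_n * 'rV[R]_n] (fun p => J p.1 p.1) by exact: mJ.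
have mJv : measurable_fun [set: 'rV[R]_n * 'rV[R]_n] (fun p => J p.2 p.2) by exact: mJ.
have mQ2 : measurable_fun [set: 'rV[R]_n * 'rV[R]_n] (fun p => Q p.1 p.2) by exact: mQ.
have -> : \int[gaussian R n.+1]_x \int[gaussian R n.+1]_y ((F x - F y) ^+ 2)%:E =
    \int[gamma]_u \int[gamma]_v J u v.
  have mFxy : measurable_fun [set: 'rV[R]_n.+1 * 'rV[R]_n.+1] (fun p => ((F p.1 - F p.2) ^+ 2)%:E).
    apply/measurable_EFinP; apply: measurable_funX; apply: measurable_funB.
      exact: (measurableT_comp mF measurable_fst).
    exact: (measurableT_comp mF measurable_snd).
  have d0 x y : 0 <= ((F x - F y) ^+ 2)%:E by rewrite lee_fin sqr_ge0.
  rewrite ge0_integral_gaussianS; last 2 first.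
  - exact: measurable_ge0_integral2.
  - by move=> x; exact: integral_ge0.
  apply: eq_integral => u _.
  transitivity (\int[gamma1]_s \int[gamma]_v \int[gamma1]_t (q s t u v)%:E).
    apply: eq_integral => s _; rewrite ge0_integral_gaussianS//.
    exact: (measurableT_comp mFxy (pair1_measurable _)).
  apply: (ge0_integral2C gamma1 gamma (f := fun s v => \int[gamma1]_t (q s t u v)%:E)).
    apply: (measurable_ge0_integral2 gamma1
      (f := fun (w : measurableTypeR R * 'rV[R]_n) t => (q w.1 t u w.2)%:E)) => //.
    apply: mq => //=.
    - exact: (measurableT_comp measurable_fst measurable_fst).
    - exact: (measurableT_comp measurable_snd measurable_fst).
  by move=> s v; exact: integral_ge0.
have ZE : \int[gamma]_u \int[gamma]_v Q u v = \int[gamma1]_s \int[gamma]_u \int[gamma]_v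
    ((F (cons_rV (s, u)) - F (cons_rV (s, v))) ^+ 2)%:E.
  apply: (@tonelli3 _ _ _ _ _ gamma gamma1 (fun s v u => (q s s u v)%:E)) => //.
  apply: mq => //=.
  - exact: (measurableT_comp measurable_snd measurable_fst).
  - exact: (measurableT_comp measurable_snd measurable_fst).
  - exact: (measurableT_comp measurable_fst measurable_fst).
have YE : \int[gamma]_u \int[gamma]_v J u u = \int[gamma]_u J u u.
  apply: eq_integral => u _; transitivity (J u u * gamma setT); first exact: integral_cst.
  by rewrite probability_setT mule1.
rewrite -ZE.
set X := leLHS; set Y := (X in _ <= X + _); set Z := (X in _ <= _ + X).
suff : X + X <= (Y + Z) + (Y + Z).
  by rewrite -!mule2n -!mule_natl lee_pmul2l// lte_fin.
have YE' : \int[gamma]_u \int[gamma]_v J v v = \int[gamma]_u J u u.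
  apply: etrans YE.
  exact: (ge0_integral2C gamma gamma (f := fun u v => J v v) mJv (fun u v => J0 v v)).
have EX : \int[gamma]_u \int[gamma]_v (J u v + J u v) = X + X.
  exact: (ge0_integral2D gamma gamma (f := J) (g := J) mJ2 mJ2 J0 J0).
have EY : \int[gamma]_u \int[gamma]_v (J u u + J v v) = Y + Y.
  transitivity (\int[gamma]_u \int[gamma]_v J u u + \int[gamma]_u \int[gamma]_v J v v).
    exact: (ge0_integral2D gamma gamma (f := fun u v => J u u) (g := fun u v => J v v)
      mJu mJv (fun u v => J0 u u) (fun u v => J0 v v)).
  exact: (congr2 adde YE YE').
have EZ : \int[gamma]_u \int[gamma]_v (Q u v + Q u v) = Z + Z.
  exact: (ge0_integral2D gamma gamma (f := Q) (g := Q) mQ2 mQ2 Q0 Q0).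
pose JJ u v := J u u + J v v.
pose QQ u v := Q u v + Q u v.
have mXX := emeasurable_funD mJ2 mJ2.
have mYY : measurable_fun setT (fun p => JJ p.1 p.2) := emeasurable_funD mJu mJv.
have mZZ : measurable_fun setT (fun p => QQ p.1 p.2) := emeasurable_funD mQ2 mQ2.
have XX0 u v : 0 <= J u v + J u v by exact: adde_ge0.
have YY0 u v : 0 <= JJ u v by exact: adde_ge0.
have ZZ0 u v : 0 <= QQ u v by exact: adde_ge0.
have YZ0 u v : 0 <= JJ u v + QQ u v by exact: adde_ge0.
have EYZ : \int[gamma]_u \int[gamma]_v (JJ u v + QQ u v) = (Y + Y) + (Z + Z).
  exact: etrans (ge0_integral2D gamma gamma mYY mZZ YY0 ZZ0) (congr2 adde EY EZ).
have := ge0_le_integral2 gamma gamma mXX (emeasurable_funD mYY mZZ) XX0 YZ0 split4.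
by rewrite EX EYZ addeACA.
Qed.

End tensor.

(** Induction on the dimension: [sqr_incr_tensor] splits off the first
   coordinate, where [poincare1] applies. *)
Lemma poincare_gaussian n (f : 'rV[R]_n -> R) : class_C 1 f ->
  \int[gaussian R n]_x \int[gaussian R n]_y ((f x - f y) ^+ 2)%:E <=
  2%:E * \int[gaussian R n]_x (sqnorm (gradient f x))%:E.
Proof.
elim: n f => [|n IH] f Cf.
  rewrite integral0_eq; first by rewrite mule_ge0// integral_ge0// => x _; rewrite lee_fin sqnorm_ge0.
  move=> x _; rewrite integral0_eq// => y _.
  by rewrite (thinmx0 x) (thinmx0 y) subrr expr0n.
have [cf df] := Cf.
have mf : measurable_fun [set: _] f by exact: continuous_measurable_rV.
have md0 : measurable_fun [set: _] (partial ord0 f).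
  by apply: continuous_measurable_rV; have [_ []] := df ord0.
have mdS j : measurable_fun [set: _] (partial (lift ord0 j) f).
  by apply: continuous_measurable_rV; have [_ []] := df (lift ord0 j).
pose D0 x := ((partial ord0 f x) ^+ 2)%:E.
pose D1 x := (\sum_j (partial (lift ord0 j) f x) ^+ 2)%:E.
have mD0 : measurable_fun [set: 'rV[R]_n.+1] D0.
  by apply/measurable_EFinP; exact: measurable_funX.
have mD1 : measurable_fun [set: 'rV[R]_n.+1] D1.
  apply/measurable_EFinP; apply: measurable_sum => j; apply: measurable_funX; exact: mdS.
have D00 x : 0 <= D0 x by rewrite lee_fin sqr_ge0.
have D10 x : 0 <= D1 x by rewrite lee_fin sumr_ge0// => j _; rewrite sqr_ge0.
have mc := @measurable_cons_rV R n.
have mS (D : 'rV[R]_n.+1 -> \bar R) : measurable_fun [set: _] D ->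
    measurable_fun [set: measurableTypeR R * 'rV[R]_n] (fun p => D (cons_rV (p.1, p.2))).
  move=> mD; apply: (measurableT_comp mD); apply: (measurableT_comp mc).
  exact: measurable_fun_pair.
have mS' (D : 'rV[R]_n.+1 -> \bar R) : measurable_fun [set: _] D ->
    measurable_fun [set: 'rV[R]_n * measurableTypeR R] (fun p => D (cons_rV (p.2, p.1))).
  move=> mD; apply: (measurableT_comp mD); apply: (measurableT_comp mc).
  exact: measurable_fun_pair.
have mfxy : measurable_fun [set: 'rV[R]_n.+1 * 'rV[R]_n.+1] (fun p => ((f p.1 - f p.2) ^+ 2)%:E).
  apply/measurable_EFinP; apply: measurable_funX; apply: measurable_funB.
    exact: (measurableT_comp mf measurable_fst).
  exact: (measurableT_comp mf measurable_snd).
have d0 x y : 0 <= ((f x - f y) ^+ 2)%:E by rewrite lee_fin sqr_ge0.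
have -> : \int[gaussian R n.+1]_x (sqnorm (gradient f x))%:E =
    \int[gaussian R n]_u \int[gamma1]_s D0 (cons_rV (s, u)) +
    \int[gamma1]_s \int[gaussian R n]_u D1 (cons_rV (s, u)).
  rewrite (ge0_integral2C gamma1 (gaussian R n) (f := fun s u => D1 (cons_rV (s, u))))//; last exact: mS.
  rewrite -!ge0_integral_gaussianS// -ge0_integralDT//; apply: eq_integral => x _.
  rewrite -EFinD; congr EFin; rewrite /sqnorm big_ord_recl mxE; congr (_ + _)%R.
  by apply: eq_bigr => j _; rewrite mxE.
apply: le_trans (sqr_incr_tensor mf) _.
rewrite ge0_muleDr; [|by do 2 (apply: integral_ge0 => ? _)..].
have mI0 : measurable_fun setT (fun u => \int[gamma1]_s D0 (cons_rV (s, u))).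
  by apply: (measurable_ge0_integral2 gamma1 (f := fun u s => D0 (cons_rV (s, u)))) => //; exact: mS'.
have mI1 : measurable_fun setT (fun s => \int[gaussian R n]_u D1 (cons_rV (s, u))).
  by apply: (measurable_ge0_integral2 (gaussian R n) (f := fun s u => D1 (cons_rV (s, u)))) => //; exact: mS.
apply: leeD.
- rewrite -ge0_integralMl//; last by move=> u _; exact: integral_ge0.
  apply: ge0_le_integralT.
  + apply: (measurable_ge0_integral2 gamma1 (f := fun u s => \int[gamma1]_t
      ((f (cons_rV (s, u)) - f (cons_rV (t, u))) ^+ 2)%:E)).
      apply: (measurable_ge0_integral2 gamma1 (f := fun (p : 'rV[R]_n * measurableTypeR R) t =>
        ((f (cons_rV (p.2, p.1)) - f (cons_rV (t, p.1))) ^+ 2)%:E)) => //.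
      have m1 : measurable_fun setT (fun w : 'rV[R]_n * measurableTypeR R * measurableTypeR R =>
          cons_rV (w.1.2, w.1.1)).
        apply: (measurableT_comp mc); apply: measurable_fun_pair => /=.
          exact: (measurableT_comp measurable_snd measurable_fst).
        exact: (measurableT_comp measurable_fst measurable_fst).
      have m2 : measurable_fun setT (fun w : 'rV[R]_n * measurableTypeR R * measurableTypeR R =>
          cons_rV (w.2, w.1.1)).
        apply: (measurableT_comp mc); apply: measurable_fun_pair => //=.
        exact: (measurableT_comp measurable_fst measurable_fst).
      exact: (measurableT_comp mfxy (measurable_fun_pair m1 m2)).
    by move=> u s; exact: integral_ge0.
  + exact: emeasurable_funM.
  + by move=> u; do 2 (apply: integral_ge0 => ? _).
  + move=> u.
    under eq_integral do under eq_integral do rewrite -sqrrN opprB.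
    apply: (poincare1 (u := fun s => f (cons_rV (s, u)))
      (u' := fun s => partial ord0 f (cons_rV (s, u)))).
      by move=> s; apply: is_derive_head; have [+ _] := df ord0; exact.
    move=> s; apply: (@continuous_comp _ _ _ (fun s : R => cons_rV (s, u)) (partial ord0 f)).
      exact: continuous_cons_rVl.
    by have [_ [c _]] := df ord0; exact: c.
- rewrite -ge0_integralMl//; last by move=> u _; exact: integral_ge0.
  apply: ge0_le_integralT.
  + apply: (measurable_ge0_integral2 (gaussian R n) (f := fun s u => \int[gaussian R n]_v
      ((f (cons_rV (s, u)) - f (cons_rV (s, v))) ^+ 2)%:E)).
      apply: (measurable_ge0_integral2 (gaussian R n) (f := fun (p : measurableTypeR R * 'rV[R]_n) v =>
        ((f (cons_rV (p.1, p.2)) - f (cons_rV (p.1, v))) ^+ 2)%:E)) => //.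
      have m1 : measurable_fun setT (fun w : measurableTypeR R * 'rV[R]_n * 'rV[R]_n =>
          cons_rV (w.1.1, w.1.2)).
        apply: (measurableT_comp mc); apply: measurable_fun_pair => /=.
          exact: (measurableT_comp measurable_fst measurable_fst).
        exact: (measurableT_comp measurable_snd measurable_fst).
      have m2 : measurable_fun setT (fun w : measurableTypeR R * 'rV[R]_n * 'rV[R]_n =>
          cons_rV (w.1.1, w.2)).
        apply: (measurableT_comp mc); apply: measurable_fun_pair => //=.
        exact: (measurableT_comp measurable_fst measurable_fst).
      exact: (measurableT_comp mfxy (measurable_fun_pair m1 m2)).
    by move=> u s; exact: integral_ge0.
  + exact: emeasurable_funM.
  + by move=> u; do 2 (apply: integral_ge0 => ? _).
  + move=> s.
    apply: le_trans (IH _ (class_C1_tail s Cf)) _.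
    rewrite le_eqVlt; apply/orP; left; apply/eqP; congr (_ * _).
    apply: eq_integral => u _; congr EFin; rewrite /sqnorm.
    by apply: eq_bigr => j _; rewrite mxE partial_tail.
Qed.

End poincare.

(** * Integration by parts *)
Section stein.
Context (R : realType).
Local Notation leb := (@lebesgue_measure R).
Local Notation gamma1 := (@normal_prob R 0 1).
Local Notation phi := (@normal_pdf R 0 1).

(** [(u' t - t * u t) * phi t] is the derivative of [u t * phi t], which has
   compact support.  The shift by [M] makes the integrand nonnegative, so that
   Tonelli's theorem applies when the identity is lifted to several dimensions. *)
Lemma gamma1_stein (u u' : R -> R) (a M : R) :
  (forall x : R, is_derive x (1 : R) u (u' x)) -> continuous u' ->
  (forall t, a <= `|t| -> u t = 0 /\ u' t = 0) ->
  (forall t, 0 <= u' t - t * u t + M) ->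
  (\int[gamma1]_t (u' t - t * u t + M)%:E = M%:E)%E.
Proof.
move=> du cu' ua wM.
wlog a0 : a ua / 0 <= a.
  move=> wlg; apply: (wlg `|a|) => // t at_; apply: ua; exact: le_trans (ler_norm a) at_.
have cu : continuous u := continuous_of_is_derive du.
have M0 : 0 <= M.
  by have := wM a; have [|-> ->] := ua a; [rewrite ger0_norm|rewrite mulr0 subrr add0r].
have mw : measurable_fun [set: R] (fun t => u' t - t * u t + M).
  apply: continuous_measurable_fun => t; apply: cvgD; last exact: cvg_cst.
  by apply: cvgB; [exact: cu'|apply: cvgM; [exact: cvg_id|exact: cu]].
have dF (x : R) : is_derive x (1 : R) (fun t => u t * phi t) ((u' x - x * u x) * phi x).
  have := du x => ?; have := @is_derive_phi R x => ?; apply: is_derive_eq.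
  by rewrite /GRing.scale /=; ring.
have cphi := @continuous_phi R.
have cf : continuous (fun x => (u' x - x * u x) * phi x).
  move=> t; apply: cvgM; last exact: cphi.
  by apply: cvgB; [exact: cu'|apply: cvgM; [exact: cvg_id|exact: cu]].
have aa : - a <= a by rewrite ge0_cp.
have IA := integral_is_derive dF cf aa.
have mphi : measurable_fun [set: R] phi := measurable_normal_pdf _ _.
have -> : (M%:E = \int[leb]_t ((M * phi t)%:E))%E.
  by rewrite -[LHS](integral_prob_cst gamma1) ge0_integral_gamma1.
rewrite ge0_integral_gamma1//; last exact/measurable_EFinP.
have mA : measurable (`[-a, a]%classic : set R) by [].
have splitA (g : R -> \bar R) : measurable_fun [set: R] g -> (forall t, 0 <= g t)%E ->
    (\int[leb]_t g t = \int[leb]_(t in `[(- a)%R, a]) g t + \int[leb]_(t in ~` `[(- a)%R, a]%classic) g t)%E.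
  move=> mg g0; rewrite -ge0_integral_setU ?setUv//; first exact: measurableC.
  by apply/disj_setPS => x [].
rewrite !splitA//; last 4 first.
- by apply/measurable_EFinP; exact: measurable_funM.
- by move=> t; rewrite lee_fin mulr_ge0// ltW// phi_gt0.
- by apply: emeasurable_funM; apply/measurable_EFinP.
- by move=> t; rewrite mule_ge0// lee_fin ?wM// ltW// phi_gt0.
congr (_ + _)%E; last first.
  apply: eq_integral => t /set_mem /=; rewrite in_itv/= -ler_norml => /negP.
  by rewrite -ltNge => /ltW /ua[-> ->]; rewrite mulr0 subrr add0r.
have iA (g : R -> R) : continuous g -> leb.-integrable `[-a, a] (EFin \o g).
  move=> cg; apply: continuous_compact_integrable; first exact: segment_compact.
  exact: continuous_subspaceT.
transitivity (\int[leb]_(t in `[(- a)%R, a]) (((u' t - t * u t) * phi t)%:E + (M * phi t)%:E))%E.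
  by apply: eq_integral => t _; rewrite -EFinM mulrDl EFinD.
rewrite integralD//; last 2 first.
- exact: iA.
- by apply: iA => t; apply: cvgMl_tmp; exact: cphi.
rewrite IA (proj1 (ua a _)) ?ger0_norm// (proj1 (ua (- a) _)) ?normrN ?ger0_norm//.
by rewrite !mul0r subrr add0e.
Qed.

Lemma gaussian_stein_shifted n (i : 'I_n) (u : 'rV[R]_n -> R) (a M : R) :
  continuous u -> (forall x, derivable u x (delta_mx ord0 i)) ->
  continuous (partial i u) ->
  (forall x : 'rV[R]_n, a <= `|x ord0 i| -> u x = 0 /\ partial i u x = 0) ->
  (forall x, 0 <= partial i u x - x ord0 i * u x + M) ->
  (\int[gaussian R n]_x (partial i u x - x ord0 i * u x + M)%:E = M%:E)%E.
Proof.
elim: n i u => [[]//|n IH] i u cu du cdu ua wM.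
have mw : measurable_fun [set: 'rV[R]_n.+1]
    (fun x => (partial i u x - x ord0 i * u x + M)%:E).
  apply/measurable_EFinP; apply: measurable_funD => //.
  apply: measurable_funB; first exact: continuous_measurable_rV.
  by apply: measurable_funM; [exact: measurable_rV_coord|exact: continuous_measurable_rV].
rewrite ge0_integral_gaussianS//.
case: (unliftP ord0 i) => [j|] iE; subst i.
- rewrite -(ge0_integral2C gamma1 (gaussian R n) (f := fun t y =>
    (partial (lift ord0 j) u (cons_rV (t, y)) -
     cons_rV (t, y) ord0 (lift ord0 j) * u (cons_rV (t, y)) + M)%:E)); last 2 first.
  + apply: (measurableT_comp mw (g := fun p : measurableTypeR R * 'rV[R]_n => cons_rV (p.1, p.2))).
    by apply: (measurableT_comp (@measurable_cons_rV R n)); exact: measurable_fun_pair.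
  + by move=> t y; rewrite lee_fin.
  rewrite -[RHS](integral_prob_cst gamma1); apply: eq_integral => t _.
  rewrite -[RHS](IH j (fun y => u (cons_rV (t, y)))).
  + by apply: eq_integral => y _; rewrite partial_tail cons_rVS.
  + move=> y; apply: (@continuous_comp _ _ _ (fun z => cons_rV (t, z)) u); last exact: cu.
    exact: continuous_cons_rVr.
  + by move=> y; exact/derivable_tail/du.
  + rewrite (_ : partial _ _ = fun z => partial (lift ord0 j) u (cons_rV (t, z))).
      move=> z; apply: (@continuous_comp _ _ _ (fun z => cons_rV (t, z)) (partial (lift ord0 j) u)).
        exact: continuous_cons_rVr.
      exact: cdu.
    by apply/funext => z; exact: partial_tail.
  + by move=> y ay; rewrite partial_tail; apply: ua; rewrite cons_rVS.
  + by move=> y; have := wM (cons_rV (t, y)); rewrite partial_tail cons_rVS.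
- rewrite -[RHS](integral_prob_cst (gaussian R n)); apply: eq_integral => y _.
  rewrite -[RHS](@gamma1_stein (fun t => u (cons_rV (t, y)))
    (fun t => partial ord0 u (cons_rV (t, y))) a).
  + by apply: eq_integral => t _; rewrite cons_rV0.
  + by move=> t; exact/is_derive_head/du.
  + move=> t; apply: (@continuous_comp _ _ _ (fun s : R => cons_rV (s, y)) (partial ord0 u)).
      exact: continuous_cons_rVl.
    exact: cdu.
  + by move=> t at_; apply: ua; rewrite cons_rV0.
  + by move=> t; have := wM (cons_rV (t, y)); rewrite cons_rV0.
Qed.

Lemma continuous_support_bounded n (g : 'rV[R]_n -> R) (a : R) : continuous g ->
  (forall x, a <= sqnorm x -> g x = 0) -> exists M, forall x, `|g x| <= M.
Proof.
move=> cg ga.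
have cA : compact [set x : 'rV[R]_n | forall i, x ord0 i \in `[- (1 + `|a|), 1 + `|a| ]].
  exact: (@rV_compact _ _ (fun=> `[- (1 + `|a|), 1 + `|a| ]%classic) (fun=> @segment_compact _ _ _)).
have [M [_ HM]] : bounded_set (g @` [set x : 'rV[R]_n | forall i, x ord0 i \in `[- (1 + `|a|), 1 + `|a| ]]).
  by apply/compact_bounded/continuous_compact => //; exact: continuous_subspaceT.
exists (`|M| + 1) => x.
have [xA|] := pselect (forall i, x ord0 i \in `[- (1 + `|a|), 1 + `|a| ]).
  apply: (HM (`|M| + 1)); first by rewrite (le_lt_trans (ler_norm M))// ltrDl.
  by exists x.
move=> /existsNP[i /negP]; rewrite in_itv/= -ler_norml -ltNge => xi.
rewrite ga ?normr0 ?addr_ge0//.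
apply: le_trans (ler_norm a) _; rewrite /sqnorm (bigD1 i)//= -[leLHS]addr0.
apply: lerD; last by apply: sumr_ge0 => j _; exact: sqr_ge0.
rewrite -(real_normK (num_real _)).
have := normr_ge0 a; nra.
Qed.

Lemma gaussian_stein n (i : 'I_n) (u : 'rV[R]_n -> R) (a : R) :
  continuous u -> (forall x, derivable u x (delta_mx ord0 i)) ->
  continuous (partial i u) ->
  (forall x, a <= sqnorm x -> u x = 0 /\ partial i u x = 0) ->
  (gaussian R n).-integrable setT (fun x => (partial i u x - x ord0 i * u x)%:E) /\
  (\int[gaussian R n]_x (partial i u x - x ord0 i * u x)%:E = 0)%E.
Proof.
move=> cu du cdu ua.
have cw : continuous (fun x => partial i u x - x ord0 i * u x).
  by move=> x; apply: (cvgB (f := partial i u) (cdu x)); apply: cvgM; [exact: continuous_rV_coord|exact: cu].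
have [M HM] : exists M, forall x, `|partial i u x - x ord0 i * u x| <= M.
  by apply: (continuous_support_bounded (a := a) cw) => x /ua[-> ->]; rewrite mulr0 subrr.
have iw : (gaussian R n).-integrable setT (fun x => (partial i u x - x ord0 i * u x)%:E).
  apply: measurable_bounded_integrable => //.
  - by rewrite /= ltey_eq fin_num_measure.
  - exact: continuous_measurable_rV.
  - exists M; split; first exact: num_real.
    by move=> y My x _; exact: le_trans (HM x) (ltW My).
split => //.
have := @gaussian_stein_shifted _ i u (1 + `|a|) M cu du cdu _ _.
have ub (x : 'rV[R]_n) : 1 + `|a| <= `|x ord0 i| -> u x = 0 /\ partial i u x = 0.
  move=> xi; apply: ua.
  apply: le_trans (ler_norm a) _; rewrite /sqnorm (bigD1 i)//= -[leLHS]addr0.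
  apply: lerD; last by apply: sumr_ge0 => j _; exact: sqr_ge0.
  rewrite -(real_normK (num_real _)).
  have := normr_ge0 a; nra.
have wM x : 0 <= partial i u x - x ord0 i * u x + M.
  by have := HM x; rewrite ler_norml => /andP[]; lra.
move=> /(_ ub wM); under eq_integral do rewrite EFinD.
rewrite integralD//; last exact: finite_measure_integrable_cst.
rewrite integral_prob_cst -(fineK (integrable_fin_num _ iw))// -EFinD => -[].
by move=> /(canRL (addrK _)); rewrite subrr => ->.
Qed.

End stein.

(** * The divergence theorem for the Gaussian measure *)
Section cutoff.
Context (R : realType).

Lemma is_derive_line (V : normedModType R) (f : V -> R) (x v : V) (df : R) :
  is_derive (0 : R) (1 : R) (fun h => f (h *: v + x)) df -> is_derive x v f df.
Proof.
have E : (fun h : R => h^-1 *: (((fun h => f (h *: v + x)) \o shift (0 : R)) (h *: (1 : R)) -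
      f ((0 : R) *: v + x))) =
    (fun h => h^-1 *: ((f \o shift x) (h *: v) - f x)).
  by apply/funext => h /=; rewrite scale0r add0r addr0 [h *: 1]mulr1.
move=> [d1 d2]; apply: DeriveDef; first by move: d1; rewrite /derivable E.
by move: d2; rewrite /derive E.
Qed.

(** The remainder of the first-order expansion is at most [h ^+ 2], also across
   the kink of [Num.max 0]. *)
Lemma is_derive_max0_sqr (t : R) :
  is_derive t (1 : R) (fun t => Num.max 0 t ^+ 2) (2 * Num.max 0 t).
Proof.
suff H : (fun h : R => h^-1 *: (((fun t => Num.max 0 t ^+ 2) \o shift t) (h *: (1 : R)) -
    Num.max 0 t ^+ 2)) @ 0^' --> (2 * Num.max 0 t : R).
  by apply: DeriveDef; [apply/cvg_ex; exists (2 * Num.max 0 t)|apply/cvg_lim].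
apply/cvgrPdist_le => e e0; near=> h.
have h0 : h != 0 by near: h; exact: nbhs_dnbhs_neq.
have he : `|h| <= e.
  near: h; apply: dnbhs0_le; exact: e0.
apply: le_trans he; rewrite /= [h *: 1]mulr1.
have -> : 2 * Num.max 0 t - h^-1 *: (Num.max 0 (h + t) ^+ 2 - Num.max 0 t ^+ 2) =
    h^-1 * (2 * Num.max 0 t * h - (Num.max 0 (h + t) ^+ 2 - Num.max 0 t ^+ 2)).
  by rewrite /GRing.scale/=; field.
rewrite normrM normfV ler_pdivrMl ?normr_gt0// -normrM -expr2 [`|h ^+ 2|]ger0_norm ?sqr_ge0//.
rewrite ler_norml; case: (leP 0 t) => t0; case: (leP 0 (h + t)) => ht0; apply/andP; split; nra.
Unshelve. all: by end_near. Qed.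

Lemma sqnorm_shift n (x : 'rV[R]_n) (i : 'I_n) (h : R) :
  sqnorm (h *: delta_mx ord0 i + x) = sqnorm x + 2 * h * x ord0 i + h ^+ 2.
Proof.
rewrite /sqnorm (bigD1 i)//= [in RHS](bigD1 i)//= !mxE !eqxx/= mulr1.
rewrite (eq_bigr (fun j => x ord0 j ^+ 2)); first by ring.
by move=> j /negPf ji; rewrite !mxE ji andbF mulr0 add0r.
Qed.

(** A continuously differentiable cutoff with compact support: the square removes
   the kink of [Num.max 0]. *)
Definition cutoff n (k : nat) (x : 'rV[R]_n) : R := Num.max 0 (1 - sqnorm x / k.+1%:R) ^+ 2.

Definition cutoff' n (k : nat) (i : 'I_n) (x : 'rV[R]_n) : R :=
  - (4 * x ord0 i / k.+1%:R) * Num.max 0 (1 - sqnorm x / k.+1%:R).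

Lemma is_derive_cutoff n k (i : 'I_n) (x : 'rV[R]_n) :
  is_derive x (delta_mx ord0 i) (cutoff k) (cutoff' k i x).
Proof.
apply: is_derive_line.
pose l (h : R) : R := 1 - (sqnorm x + 2 * h * x ord0 i + h ^+ 2) / k.+1%:R.
rewrite (_ : (fun h => _) = (fun t => Num.max 0 t ^+ 2) \o l); last first.
  by apply/funext => h; rewrite /cutoff sqnorm_shift.
have dl : is_derive (0 : R) (1 : R) l (- (2 * x ord0 i / k.+1%:R)).
  by apply: is_derive_eq; rewrite /GRing.scale/=; ring.
have dm := is_derive_max0_sqr (l 0).
have := @is_derive1_comp R (fun t => Num.max 0 t ^+ 2) l 0 _ _ dm dl.
rewrite (_ : _ * _ = cutoff' k i x)//.
rewrite /cutoff' (_ : l 0 = 1 - sqnorm x / k.+1%:R); first by ring.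
by rewrite /l mulr0 mul0r expr0n/= !addr0.
Qed.

Let continuous_max0 : continuous (fun s : R => Num.max 0 s).
Proof.
move=> s; have c0 : {for s, continuous (cst 0 : R -> R^o)} by exact: cst_continuous.
have c1 : {for s, continuous (id : R -> R^o)} by exact: cvg_id.
exact: (continuous_max c0 c1).
Qed.

Let continuous_base (k : nat) : continuous (fun s : R => Num.max 0 (1 - s / k.+1%:R)).
Proof.
move=> s; apply: (@continuous_comp _ _ _ (fun s : R => 1 - s / k.+1%:R)); last exact: continuous_max0.
by apply: cvgB; [exact: cvg_cst|apply: cvgMr_tmp; exact: cvg_id].
Qed.

Lemma continuous_cutoff n k : continuous (@cutoff n k).
Proof.
move=> x; apply: (@continuous_comp _ _ _ (@sqnorm R n)
  (fun s : R => Num.max 0 (1 - s / k.+1%:R) ^+ 2)); first exact: continuous_sqnorm.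
by apply: cvgM; exact: continuous_base.
Qed.

Lemma continuous_cutoff' n k i : continuous (@cutoff' n k i).
Proof.
move=> x; apply: (continuousM (s := fun x : 'rV[R]_n => - (4 * x ord0 i / k.+1%:R))
  (t := fun x : 'rV[R]_n => Num.max 0 (1 - sqnorm x / k.+1%:R))).
  apply: (@continuous_comp _ _ _ (fun x : 'rV[R]_n => x ord0 i)
    (fun s : R => - (4 * s / k.+1%:R))); first exact: continuous_rV_coord.
  by apply: cvgN; apply: cvgMr_tmp; apply: cvgMl_tmp; exact: cvg_id.
apply: (@continuous_comp _ _ _ (@sqnorm R n)
  (fun s : R => Num.max 0 (1 - s / k.+1%:R))); first exact: continuous_sqnorm.
exact: continuous_base.
Qed.

Lemma cutoff_support n k (i : 'I_n) (x : 'rV[R]_n) : k.+1%:R <= sqnorm x ->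
  cutoff k x = 0 /\ cutoff' k i x = 0.
Proof.
move=> kx; rewrite /cutoff /cutoff' (max_idPl _) ?expr0n ?mulr0//.
by rewrite subr_le0 ler_pdivlMr// mul1r.
Qed.

Lemma cutoff01 n k (x : 'rV[R]_n) : 0 <= cutoff k x <= 1.
Proof.
rewrite sqr_ge0/= expr_le1 ?le_max ?lexx// ge_max ler01/=.
by rewrite lerBlDr lerDl divr_ge0// sqnorm_ge0.
Qed.

Lemma cutoff'_le n k (i : 'I_n) (x : 'rV[R]_n) : `|cutoff' k i x| <= 4.
Proof.
have [kx|xk] := leP k.+1%:R (sqnorm x).
  by rewrite (proj2 (cutoff_support i kx)) normr0.
have K0 : 0 < k.+1%:R :> R by [].
have m01 : 0 <= Num.max 0 (1 - sqnorm x / k.+1%:R) <= 1.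
  by rewrite le_max lexx/= ge_max ler01/= lerBlDr lerDl divr_ge0// sqnorm_ge0.
have xi : `|x ord0 i| <= k.+1%:R.
  have : x ord0 i ^+ 2 <= sqnorm x.
    by rewrite /sqnorm (bigD1 i)//= lerDl; apply: sumr_ge0 => j _; exact: sqr_ge0.
  rewrite -(real_normK (num_real _)).
  have : 1 <= k.+1%:R :> R by rewrite ler1n.
  have := normr_ge0 (x ord0 i); nra.
rewrite /cutoff' normrM normrN normrM normfV normrM [`|4|]ger0_norm// [`|k.+1%:R|]ger0_norm//.
rewrite -[leRHS]mulr1; case/andP: m01 => m0 m1; apply: ler_pM => //.
- by rewrite ler_pdivrMr// ler_pM2l.
- by rewrite ger0_norm.
Qed.

Let scaled_base n (x : 'rV[R]_n) : continuous (fun s : R => Num.max 0 (1 - sqnorm x * s)).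
Proof.
move=> s; apply: (@continuous_comp _ _ _ (fun s : R => 1 - sqnorm x * s)); last exact: continuous_max0.
by apply: cvgB; [exact: cvg_cst|apply: cvgMl_tmp; exact: cvg_id].
Qed.

Lemma cutoff_cvg n (x : 'rV[R]_n) : cutoff k x @[k --> \oo] --> (1 : R).
Proof.
have -> : (1 : R) = Num.max 0 (1 - sqnorm x * 0) ^+ 2.
  by rewrite mulr0 subr0 (max_idPr _)// expr1n.
apply: (@continuous_cvg _ _ _ _ _ (@harmonic R) (fun s : R => Num.max 0 (1 - sqnorm x * s) ^+ 2)).
  by apply: cvgM; exact: scaled_base.
exact: cvg_harmonic.
Qed.

Lemma cutoff'_cvg n (i : 'I_n) (x : 'rV[R]_n) : cutoff' k i x @[k --> \oo] --> (0 : R).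
Proof.
have -> : (0 : R) = - (4 * x ord0 i * 0) * Num.max 0 (1 - sqnorm x * 0).
  by rewrite mulr0 oppr0 mul0r.
apply: (@continuous_cvg _ _ _ _ _ (@harmonic R)
  (fun s : R => - (4 * x ord0 i * s) * Num.max 0 (1 - sqnorm x * s))).
  apply: cvgM; last exact: scaled_base.
  by apply: cvgN; apply: cvgMl_tmp; exact: cvg_id.
exact: cvg_harmonic.
Qed.

End cutoff.

Section divergence.
Context (R : realType) (n : nat).
Variables V W : 'I_n -> 'rV[R]_n -> R.
Hypothesis cV : forall i, continuous (V i).
Hypothesis cW : forall i, continuous (W i).
Hypothesis dV : forall i (x : 'rV[R]_n), is_derive x (delta_mx ord0 i) (V i) (W i x).
Local Notation gamma := (gaussian R n).
Hypothesis iV : forall i, gamma.-integrable setT (EFin \o V i).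
Hypothesis ixV : gamma.-integrable setT (fun x => (\sum_i x ord0 i * V i x)%:E).
Hypothesis iW : gamma.-integrable setT (fun x => (\sum_i W i x)%:E).

Let u k i x := cutoff k x * V i x.
Let u' k i x := cutoff k x * W i x + cutoff' k i x * V i x.

Let du k i (x : 'rV[R]_n) : is_derive x (delta_mx ord0 i) (u k i) (u' k i x).
Proof.
have := dV i x => ?; have := is_derive_cutoff k i x => ?; apply: is_derive_eq.
by rewrite /GRing.scale/= /u' mulrC [in LHS]addrC [V i x * _]mulrC addrC.
Qed.

Let u'E k i : partial i (u k i) = u' k i.
Proof. by apply/funext => x; rewrite /partial; have := du k i x => ?; rewrite derive_val. Qed.

Let cu k i : continuous (u k i).
Proof.
move=> x; apply: (continuousM (s := cutoff k) (t := V i)); last exact: cV.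
exact: continuous_cutoff.
Qed.

Let cu' k i : continuous (u' k i).
Proof.
move=> x; apply: (continuousD (f := fun x => cutoff k x * W i x)
   (g := fun x => cutoff' k i x * V i x)).
  apply: (continuousM (s := cutoff k) (t := W i)); last exact: cW.
  exact: continuous_cutoff.
apply: (continuousM (s := cutoff' k i) (t := V i)); last exact: cV.
exact: continuous_cutoff'.
Qed.

Let stein_u k i :
  gamma.-integrable setT (fun x => (u' k i x - x ord0 i * u k i x)%:E) /\
  (\int[gamma]_x (u' k i x - x ord0 i * u k i x)%:E = 0)%E.
Proof.
rewrite -u'E; apply: (gaussian_stein (a := k.+1%:R)).
- exact: cu.
- by move=> x; have [] := du k i x.
- by rewrite u'E; exact: cu'.
- move=> x kx; rewrite u'E /u /u'; have [-> ->] := cutoff_support i kx.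
  by rewrite !mul0r addr0.
Qed.

(** Integration by parts for a field that is only integrable, together with its
   divergence [\sum_i W i] and its radial part: the partial derivatives [W i]
   need not be integrable one by one.  Stein's identity holds for the field
   multiplied by [cutoff k]; as the derivatives of the cutoffs are bounded
   and tend to [0], dominated convergence passes to the limit. *)
Lemma gaussian_divergence :
  (\int[gamma]_x (\sum_i W i x)%:E = \int[gamma]_x (\sum_i x ord0 i * V i x)%:E)%E.
Proof.
pose h k x := \sum_i (u' k i x - x ord0 i * u k i x).
have hE k x : h k x = cutoff k x * (\sum_i W i x - \sum_i x ord0 i * V i x) +
    \sum_i cutoff' k i x * V i x.
  rewrite -sumrB mulr_sumr -big_split/=; apply: eq_bigr => i _.
  by rewrite /u /u'; ring.
have h0 k : (\int[gamma]_x (h k x)%:E = 0)%E.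
  under eq_integral do rewrite -sumEFin.
  rewrite integral_sum//; last by move=> i; exact: (stein_u k i).1.
  by rewrite big1// => i _; exact: (stein_u k i).2.
have mW i : measurable_fun [set: 'rV[R]_n] (W i) by exact: continuous_measurable_rV.
have mV i : measurable_fun [set: 'rV[R]_n] (V i) by exact: continuous_measurable_rV.
have mL : measurable_fun [set: 'rV[R]_n] (fun x => \sum_i W i x - \sum_i x ord0 i * V i x).
  apply: measurable_funB; first exact: measurable_sum.
  by apply: measurable_sum => i; apply: measurable_funM => //; exact: measurable_rV_coord.
pose g x := `|\sum_i W i x| + `|\sum_i x ord0 i * V i x| + \sum_i 4 * `|V i x|.
have ig : gamma.-integrable setT (EFin \o g).
  rewrite (_ : EFin \o g = fun x => (`|(\sum_i W i x)%:E| + `|(\sum_i x ord0 i * V i x)%:E|) +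
     \sum_i 4%:E * `|(V i x)%:E|)%E; last first.
    apply/funext => x; rewrite /g /= !EFinD -sumEFin; congr (_ + _)%E.
  apply: integrableD => //; first by apply: integrableD => //; exact: integrable_abse.
  by apply: integrable_sum => // i _; apply: integrableZl => //; exact/integrable_abse/iV.
have mh k : measurable_fun [set: 'rV[R]_n] (fun x => (h k x)%:E).
  apply/measurable_EFinP; apply: measurable_sum => i; apply: measurable_funB.
    by apply: continuous_measurable_rV; exact: cu'.
  by apply: measurable_funM; [exact: measurable_rV_coord|apply: continuous_measurable_rV; exact: cu].
have mL' : measurable_fun [set: 'rV[R]_n] (fun x => (\sum_i W i x - \sum_i x ord0 i * V i x)%:E).
  exact/measurable_EFinP.
have hc : {ae gamma, forall x, setT x -> (h k x)%:E @[k --> \oo] -->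
    (\sum_i W i x - \sum_i x ord0 i * V i x)%:E}.
  apply: aeW => x _; apply: cvg_EFin; first exact: nearW.
  rewrite (_ : fine \o _ = fun k => cutoff k x * (\sum_i W i x - \sum_i x ord0 i * V i x) +
    \sum_i cutoff' k i x * V i x); last by apply/funext => k; exact: hE.
  have z : \sum_(i < n) (0 : R) = 0 by rewrite big1.
  set L := _ - _; rewrite -[L in _ --> L]addr0 -[X in _ --> _ + X]z; apply: cvgD.
    by rewrite -[X in _ --> X]mul1r; apply: cvgMr_tmp; exact: cutoff_cvg.
  apply: cvg_big => [|i _]; first exact: add_continuous. rewrite -[X in _ --> X](mul0r (V i x)).
  by apply: cvgMr_tmp; exact: cutoff'_cvg.
have hg : {ae gamma, forall x k, setT x -> `|(h k x)%:E| <= (EFin \o g) x}%E.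
  apply: aeW => x k _; rewrite abse_EFin lee_fin hE /g.
  apply: le_trans (ler_normD _ _) _; apply: lerD.
    have /andP[c0 c1] := cutoff01 k x.
    rewrite normrM ger0_norm//; apply: le_trans (ler_normB _ _).
    by rewrite -[leRHS]mul1r ler_wpM2r.
  apply: le_trans (ler_norm_sum _ _ _) _; apply: ler_sum => i _.
  by rewrite normrM ler_wpM2r// cutoff'_le.
have [_ _] := dominated_convergence measurableT mh mL' hc ig hg.
rewrite (_ : [sequence _]_k = cst 0%E); last by apply/funext => k; exact: h0.
move=> /(cvg_unique (@ereal_hausdorff R) (cvg_cst _)) /esym.
under eq_integral do rewrite EFinB.
rewrite integralB// => /eqP.
by rewrite sube_eq ?integrable_fin_num// ?add0e => /eqP.
Qed.

End divergence.

(** * Square integrable functions *)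
Section square_integrable.
Context d (T : measurableType d) (R : realType) (P : probability T R).

Definition square_integrable (u : T -> R) : Prop :=
  measurable_fun [set: T] u /\ P.-integrable setT (EFin \o (fun x => u x ^+ 2)).

Lemma integrableM (u v : T -> R) : square_integrable u -> square_integrable v ->
  P.-integrable setT (EFin \o (fun x => u x * v x)).
Proof.
move=> [mu iu] [mv iv]; apply: (le_integrable measurableT _ _ (integrableD measurableT iu iv)).
  by apply/measurable_EFinP; exact: measurable_funM.
move=> x _ /=; rewrite lee_fin [leRHS]ger0_norm ?addr_ge0 ?sqr_ge0// ler_norml.
by apply/andP; split; nra.
Qed.

Lemma square_integrable_cst (k : R) : square_integrable (cst k).
Proof. by split; [exact: measurable_cst|exact: (finite_measure_integrable_cst P (k ^+ 2))]. Qed.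

Lemma square_integrable_integrable (u : T -> R) : square_integrable u ->
  P.-integrable setT (EFin \o u).
Proof.
move=> Lu; rewrite (_ : u = fun x => u x * cst 1 x).
  exact: integrableM (square_integrable_cst 1).
by apply/funext => x; rewrite mulr1.
Qed.

Lemma square_integrableB (u v : T -> R) (c : R) :
  square_integrable u -> square_integrable v -> square_integrable (fun x => u x - c * v x).
Proof.
move=> Lu Lv; have [mu iu] := Lu; have [mv iv] := Lv; have iuv := integrableM Lu Lv.
split; first by apply: measurable_funB => //; exact: measurable_funM.
rewrite (_ : _ \o _ = fun x => ((u x ^+ 2)%:E + ((- 2 * c)%:E * (u x * v x)%:E +
    (c ^+ 2)%:E * (v x ^+ 2)%:E))%E); last first.
  by apply/funext => x /=; rewrite -!EFinM -!EFinD; congr EFin; ring.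
by do 2 apply: integrableD => //; exact: integrableZl.
Qed.

Lemma integral_sqr_dist (u : T -> R) : square_integrable u ->
  (\int[P]_x \int[P]_y ((u x - u y) ^+ 2)%:E =
   (2 * (\int[P]_x (u x ^+ 2) - (\int[P]_x u x) ^+ 2))%:E)%E.
Proof.
move=> Lu; have [mu iu2] := Lu; have iu := square_integrable_integrable Lu.
set a := (\int[P]_x u x)%R; set b := (\int[P]_x (u x ^+ 2))%R.
have aE : (\int[P]_x (u x)%:E = a%:E)%E by rewrite fineK// integrable_fin_num.
have bE : (\int[P]_x (u x ^+ 2)%:E = b%:E)%E by rewrite fineK// integrable_fin_num.
have ic (k : R) : P.-integrable setT (EFin \o cst k) by exact: finite_measure_integrable_cst.
have E (k l m : R) : (\int[P]_y (k * u y ^+ 2 + l * u y + m)%:E = (k * b + l * a + m)%:E)%E.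
  under eq_integral do rewrite !EFinD !EFinM.
  rewrite integralD//; [|by apply: integrableD => //; exact: integrableZl|exact: ic].
  rewrite integralD//; [|exact: integrableZl..].
  by rewrite !integralZl// aE bE integral_prob_cst.
transitivity (\int[P]_x (1 * u x ^+ 2 + (- 2 * a) * u x + b)%:E)%E.
  apply: eq_integral => x _.
  transitivity (\int[P]_y (1 * u y ^+ 2 + (- 2 * u x) * u y + u x ^+ 2)%:E)%E.
    by apply: eq_integral => y _; congr EFin; ring.
  by rewrite E; congr EFin; ring.
by rewrite E; congr EFin; ring.
Qed.

End square_integrable.

(** * Sobolev functions for the Gaussian measure *)
Section sobolev.
Context (R : realType) (n : nat).
Local Notation gamma := (gaussian R n).
Local Notation L2 := (square_integrable gamma).
Implicit Types (f g : 'rV[R]_n -> R).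

(** [sqnorm x ^+ 2 <= 64 * expR (sqnorm x / 4)], by squaring
   [1 + s / 8 <= expR (s / 8)]. *)
Lemma square_integrable_sqnorm : L2 (@sqnorm R n).
Proof.
have ms := @measurable_sqnorm R n.
have me : measurable_fun [set: 'rV[R]_n] (fun x => expR (sqnorm x / 4)).
  by apply: measurableT_comp => //; apply: measurable_funM.
have ie : gamma.-integrable setT (EFin \o (fun x => expR (sqnorm x / 4))).
  apply/integrableP; split; first exact/measurable_EFinP.
  under eq_integral do rewrite gee0_abs ?lee_fin ?expR_ge0//.
  exact: gaussian_exp_lty.
split => //; apply: (le_integrable measurableT _ _ (integrableZl measurableT 64 ie)).
  by apply/measurable_EFinP; exact: measurable_funX.
move=> x _ /=; rewrite lee_fin ger0_norm ?sqr_ge0// ger0_norm ?mulr_ge0 ?expR_ge0//.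
have s0 := sqnorm_ge0 x.
rewrite (_ : sqnorm x / 4 = sqnorm x / 8 + sqnorm x / 8); last by field.
by rewrite expRD; have := expR_ge1Dx (sqnorm x / 8); nra.
Qed.

Lemma square_integrable_coord (i : 'I_n) : L2 (fun x => x ord0 i).
Proof.
have iS := square_integrable_integrable square_integrable_sqnorm.
have mi : measurable_fun [set: 'rV[R]_n] (fun x => x ord0 i) by exact: measurable_rV_coord.
split => //; apply: (le_integrable measurableT _ _ iS).
  by apply/measurable_EFinP; exact: measurable_funX.
move=> x _ /=; rewrite lee_fin !ger0_norm ?sqr_ge0 ?sqnorm_ge0//.
by rewrite /sqnorm (bigD1 i)//= lerDl; apply: sumr_ge0 => j _; exact: sqr_ge0.
Qed.

Definition sobolev f : Prop :=
  [/\ class_C 1 f, L2 f & forall i, L2 (partial i f)].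

Lemma class_C1_is_derive f (i : 'I_n) (x : 'rV[R]_n) : class_C 1 f ->
  is_derive x (delta_mx ord0 i) f (partial i f x).
Proof. by move=> [_ /(_ i)[df _]]; exact/derivableP. Qed.

Lemma class_C1_of_is_derive f (f' : 'I_n -> 'rV[R]_n -> R) : continuous f ->
  (forall i, continuous (f' i)) ->
  (forall i (x : 'rV[R]_n), is_derive x (delta_mx ord0 i) f (f' i x)) ->
  class_C 1 f /\ forall i, partial i f = f' i.
Proof.
move=> cf cf' df.
have E i : partial i f = f' i.
  by apply/funext => x; rewrite /partial; have := df i x => ?; rewrite derive_val.
split => //; split => // i; split; first by move=> x; have [] := df i x.
by split => //; rewrite E; exact: cf'.
Qed.

Lemma class_C1_sqnorm : class_C 1 (@sqnorm R n) /\
  forall i, partial i (@sqnorm R n) = fun x => 2 * x ord0 i.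
Proof.
apply: class_C1_of_is_derive; first exact: continuous_sqnorm.
  move=> i x; apply: (@continuous_comp _ _ _ (fun x : 'rV[R]_n => x ord0 i) (fun s : R => 2 * s)).
    exact: continuous_rV_coord.
  by apply: cvgMl_tmp; exact: cvg_id.
move=> i x; apply: is_derive_line.
under eq_fun do rewrite sqnorm_shift.
by apply: is_derive_eq; rewrite /GRing.scale/=; ring.
Qed.

Lemma class_C1B f g (c : R) : class_C 1 f -> class_C 1 g ->
  class_C 1 (fun x => f x - c * g x) /\
  forall i, partial i (fun x => f x - c * g x) = fun x => partial i f x - c * partial i g x.
Proof.
move=> Cf Cg.
have cB (u v : 'rV[R]_n -> R) : continuous u -> continuous v ->
    continuous (fun x => u x - c * v x).
  move=> cu cv x; apply: (continuousB (f := u) (g := fun x => c * v x)); first exact: cu.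
  by apply: (continuousM (s := cst c) (t := v)); [exact: cst_continuous|exact: cv].
apply: class_C1_of_is_derive.
- by apply: cB; [case: Cf|case: Cg].
- move=> i; apply: cB; first by have [_ /(_ i)[_ []]] := Cf.
  by have [_ /(_ i)[_ []]] := Cg.
- move=> i x; have := class_C1_is_derive i x Cf => ?; have := class_C1_is_derive i x Cg => ?.
  by apply: is_derive_eq; rewrite /GRing.scale/=.
Qed.

Lemma sobolev_sqnorm : sobolev (@sqnorm R n).
Proof.
have [C1 E] := class_C1_sqnorm; split => //; first exact: square_integrable_sqnorm.
move=> i; rewrite E.
have := square_integrableB (-2) (square_integrable_cst gamma 0) (square_integrable_coord i).
by under eq_fun do rewrite sub0r mulNr opprK.
Qed.

Lemma sobolevB f g (c : R) : sobolev f -> sobolev g -> sobolev (fun x => f x - c * g x).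
Proof.
move=> [Cf Lf Lf'] [Cg Lg Lg']; have [C1 E] := class_C1B c Cf Cg.
split => //; first exact: square_integrableB.
by move=> i; rewrite E; exact: square_integrableB.
Qed.

Lemma integrable_radial f : sobolev f ->
  gamma.-integrable setT (fun x => (\sum_i x ord0 i * partial i f x)%:E).
Proof.
move=> [_ _ Lf']; under eq_fun do rewrite -sumEFin.
apply: integrable_sum => // i _.
exact: (integrableM (square_integrable_coord i) (Lf' i)).
Qed.

Lemma integrable_sqnorm_gradient f : sobolev f ->
  gamma.-integrable setT (EFin \o (fun x => sqnorm (gradient f x))).
Proof.
move=> [_ _ Lf']; rewrite /sqnorm.
rewrite (_ : _ \o _ = fun x => (\sum_i (partial i f x ^+ 2)%:E)%E).
  by apply: integrable_sum => // i _; have [_ +] := Lf' i.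
by apply/funext => x; rewrite /= -sumEFin; apply: eq_bigr => i _; rewrite mxE.
Qed.

Lemma poincare_sobolev f : sobolev f ->
  \int[gamma]_x (f x ^+ 2) - (\int[gamma]_x f x) ^+ 2 <=
  \int[gamma]_x sqnorm (gradient f x).
Proof.
move=> Sf; have [Cf Lf _] := Sf; have ig := integrable_sqnorm_gradient Sf.
have := poincare_gaussian Cf; rewrite integral_sqr_dist//.
rewrite -[X in (_ <= _ * X)%E](fineK (integrable_fin_num _ ig))//.
by rewrite -EFinM lee_fin ler_pM2l.
Qed.

(** The divergence theorem for the gradient of [f]. *)
Lemma gaussian_radial_laplacian f : sobolev f -> class_C 2 f ->
  gamma.-integrable setT (EFin \o laplacian f) ->
  \int[gamma]_x laplacian f x = \int[gamma]_x (\sum_i x ord0 i * partial i f x).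
Proof.
move=> Sf [_ C2] iL; have [_ _ Lf'] := Sf; congr fine.
apply: (gaussian_divergence (V := fun i => partial i f) (W := fun i => partial i (partial i f))).
- by move=> i; have [_ []] := C2 i.
- by move=> i; have [_ [_ /(_ i)[_ []]]] := C2 i.
- by move=> i x; apply: class_C1_is_derive; have [_] := C2 i.
- by move=> i; exact: square_integrable_integrable.
- exact: integrable_radial.
- exact: iL.
Qed.

(** The divergence theorem for the field [f x * x]. *)
Lemma gaussian_radial_sqnorm f : sobolev f ->
  \int[gamma]_x (f x * sqnorm x) =
  \int[gamma]_x (\sum_i x ord0 i * partial i f x) + n%:R * \int[gamma]_x f x.
Proof.
move=> Sf; have [Cf Lf Lf'] := Sf; have [cf df] := Cf.
have iff := square_integrable_integrable Lf.
have E1 : (fun x : 'rV[R]_n => (\sum_i (x ord0 i * partial i f x + f x))%:E) =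
    (fun x : 'rV[R]_n => ((\sum_i x ord0 i * partial i f x) + n%:R * f x)%:E).
  by apply/funext => x; rewrite big_split/= sumr_const card_ord mulr_natl.
have E2 : (fun x : 'rV[R]_n => (\sum_i x ord0 i * (x ord0 i * f x))%:E) = EFin \o (fun x => f x * sqnorm x).
  apply/funext => x /=; congr EFin; rewrite mulr_sumr; apply: eq_bigr => i _; ring.
have inf : gamma.-integrable setT (EFin \o (fun x => n%:R * f x)).
  exact: (integrableZl measurableT n%:R iff).
rewrite -RintegralZl// -RintegralD//; last exact: integrable_radial.
congr fine; transitivity (\int[gamma]_x ((fun x : 'rV[R]_n => (\sum_i x ord0 i * (x ord0 i * f x))%R%:E) x))%E.
  by rewrite E2.
transitivity (\int[gamma]_x ((fun x : 'rV[R]_n => (\sum_i (x ord0 i * partial i f x + f x))%R%:E) x))%E; last by rewrite E1.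
apply/esym.
apply: (gaussian_divergence (V := fun i (x : 'rV[R]_n) => x ord0 i * f x)
  (W := fun i (x : 'rV[R]_n) => x ord0 i * partial i f x + f x)).
- move=> i x; apply: (continuousM (s := fun x : 'rV[R]_n => x ord0 i) (t := f)); last exact: cf.
  exact: continuous_rV_coord.
- move=> i x; apply: (continuousD (f := fun x : 'rV[R]_n => x ord0 i * partial i f x) (g := f)); last exact: cf.
  apply: (continuousM (s := fun x : 'rV[R]_n => x ord0 i) (t := partial i f)).
    exact: continuous_rV_coord.
  by have [_ [+ _]] := df i; move=> /(_ x).
- move=> i x; have := class_C1_is_derive i x Cf => ?.
  have dx : is_derive x (delta_mx ord0 i) (fun x : 'rV[R]_n => x ord0 i) (1 : R).
    apply: is_derive_line; rewrite (_ : (fun h => _) = fun h => h + x ord0 i).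
      by apply: is_derive_eq; rewrite addr0.
    by apply/funext => h; rewrite !mxE !eqxx mulr1.
  by apply: is_derive_eq; rewrite /GRing.scale/= mulr1.
- by move=> i; exact: (integrableM (square_integrable_coord i) Lf).
- by rewrite E2; exact: (integrableM Lf square_integrable_sqnorm).
- rewrite E1; under eq_fun do rewrite EFinD.
  by apply: integrableD => //; exact: integrable_radial.
Qed.

End sobolev.

(** * The refined Poincare inequality *)
Section refined_poincare.
Context (R : realType) (n : nat).
Hypothesis n_gt0 : (0 < n)%N.
Local Notation gamma := (gaussian R n).
Local Notation L2 := (square_integrable gamma).
Implicit Types f : 'rV[R]_n -> R.

(** Some [x] has a finite inner integral, and [f] differs from [f x - f] by a
   constant and a sign. *)
Lemma square_integrable_of_dist f : measurable_fun setT f ->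
  (\int[gamma]_x \int[gamma]_y ((f x - f y) ^+ 2)%:E < +oo)%E -> L2 f.
Proof.
move=> mf fin.
have [x xfin] : exists x, (\int[gamma]_y ((f x - f y) ^+ 2)%:E < +oo)%E.
  apply: contrapT => /forallNP H; move: fin; apply/negP; rewrite -leNgt leye_eq; apply/eqP.
  transitivity (\int[gamma]_x (cst +oo x))%E.
    by apply: eq_integral => x _; apply/eqP; rewrite -leye_eq leNgt; apply/negP/H.
  have -> : (\int[gamma]_x (cst +oo x) = +oo * gamma setT)%E by exact: integral_cst.
  by rewrite probability_setT mule1.
have md : measurable_fun [set: 'rV[R]_n] (fun y => (f x - f y) ^+ 2).
  by apply: measurable_funX; exact: measurable_funB.
have Ld : L2 (fun y => f x - f y).
  split; first exact: measurable_funB.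
  apply/integrableP; split; first exact/measurable_EFinP.
  by under eq_integral do rewrite gee0_abs ?lee_fin ?sqr_ge0//.
have := square_integrableB 1 (square_integrable_cst gamma (f x)) Ld.
by under eq_fun do rewrite mul1r opprB addrCA subrr addr0.
Qed.

Lemma sobolev_of_finite_energy f : class_C 1 f ->
  (\int[gamma]_x (sqnorm (gradient f x))%:E < +oo)%E -> sobolev f.
Proof.
move=> Cf Gfin; have [cf df] := Cf.
have mg : measurable_fun [set: 'rV[R]_n] (fun x => sqnorm (gradient f x)).
  apply: measurable_sqnorm_comp; apply: measurable_fun_rV => i.
  rewrite (_ : _ \o _ = partial i f); last by apply/funext => x; rewrite /= /rV_coord mxE.
  by apply: continuous_measurable_rV; have [_ []] := df i.
split => //.
  apply: square_integrable_of_dist; first exact: continuous_measurable_rV.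
  apply: le_lt_trans (poincare_gaussian Cf) _.
  by rewrite lte_mul_pinfty// lee_fin.
move=> i; have mi : measurable_fun [set: 'rV[R]_n] (partial i f).
  by apply: continuous_measurable_rV; have [_ []] := df i.
split => //; apply: (@le_integrable _ _ _ _ _ measurableT _ (EFin \o (fun x => sqnorm (gradient f x)))).
- by apply/measurable_EFinP; exact: measurable_funX.
- move=> x _ /=; rewrite lee_fin !ger0_norm ?sqr_ge0 ?sqnorm_ge0//.
  rewrite /sqnorm (bigD1 i)//= mxE lerDl; apply: sumr_ge0 => j _; exact: sqr_ge0.
- apply/integrableP; split; first exact/measurable_EFinP.
  by under eq_integral do rewrite gee0_abs ?lee_fin ?sqnorm_ge0//.
Qed.

Lemma Rintegral_sqnorm : \int[gamma]_x sqnorm x = n%:R.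
Proof. by rewrite /Rintegral gaussian_integral_sqnorm. Qed.

(** [gaussian_radial_sqnorm] for [f = sqnorm], whose radial derivative is
   [2 * sqnorm]. *)
Lemma Rintegral_sqnorm_sqr : \int[gamma]_x (sqnorm x ^+ 2) = n%:R ^+ 2 + 2 * n%:R.
Proof.
have [_ E] := class_C1_sqnorm R n.
have := gaussian_radial_sqnorm (sobolev_sqnorm R n); rewrite Rintegral_sqnorm => H.
transitivity (\int[gamma]_x (sqnorm x * sqnorm x)).
  by apply: eq_Rintegral => x _; rewrite expr2.
rewrite H addrC expr2; congr (_ + _).
rewrite -[X in 2 * X]Rintegral_sqnorm -RintegralZl//; last first.
  exact/square_integrable_integrable/square_integrable_sqnorm.
apply: eq_Rintegral => x _; rewrite /sqnorm mulr_sumr; apply: eq_bigr => i _.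
by rewrite E; ring.
Qed.

(** The Poincare inequality for [f - c * sqnorm].  Both sides are quadratic in
   [c], and all the coefficients are expressed by the divergence theorem through
   [A], the integral of the Laplacian; the difference is optimal at
   [c = A / (2 * n)]. *)
Lemma refined_poincare_sobolev f : sobolev f -> class_C 2 f ->
  gamma.-integrable setT (EFin \o laplacian f) ->
  \int[gamma]_x (f x ^+ 2) - (\int[gamma]_x f x) ^+ 2 <=
  \int[gamma]_x sqnorm (gradient f x) -
  (2 * n%:R)^-1 * (\int[gamma]_x laplacian f x) ^+ 2.
Proof.
move=> Sf C2f iL; have [Cf Lf Lf'] := Sf.
have Ls := square_integrable_sqnorm R n.
have AE := gaussian_radial_laplacian Sf C2f iL.
have bE := gaussian_radial_sqnorm Sf; rewrite -AE in bE.
set A := \int[gamma]_x laplacian f x in AE bE *.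
have n0 : n%:R != 0 :> R by rewrite pnatr_eq0 -lt0n.
pose c := A / (2 * n%:R).
have Sg := sobolevB c Sf (sobolev_sqnorm R n).
have iff := square_integrable_integrable Lf.
have is_ := square_integrable_integrable Ls.
have [_ if2] := Lf; have [_ is2] := Ls.
have ifs := integrableM Lf Ls.
have iG := integrable_sqnorm_gradient Sf.
have iX := integrable_radial Sf.
have [_ gradE] := class_C1B c Cf (class_C1_sqnorm R n).1.
have E1 : \int[gamma]_x (f x - c * sqnorm x) = \int[gamma]_x f x - c * n%:R.
  rewrite RintegralB//; last exact: (integrableZl measurableT c is_).
  by rewrite RintegralZl// Rintegral_sqnorm.
have E2 : \int[gamma]_x ((f x - c * sqnorm x) ^+ 2) =
    \int[gamma]_x (f x ^+ 2) - 2 * c * \int[gamma]_x (f x * sqnorm x) +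
    c ^+ 2 * (n%:R ^+ 2 + 2 * n%:R).
  rewrite -Rintegral_sqnorm_sqr -!RintegralZl// -RintegralB//; last first.
    exact: (integrableZl measurableT (2 * c) ifs).
  rewrite -RintegralD//; last 2 first.
  - exact: (integrableB measurableT if2 (integrableZl measurableT (2 * c) ifs)).
  - exact: (integrableZl measurableT (c ^+ 2) is2).
  by apply: eq_Rintegral => x _; ring.
have E3 : \int[gamma]_x sqnorm (gradient (fun x => f x - c * sqnorm x) x) =
    \int[gamma]_x sqnorm (gradient f x) - 4 * c * A + 4 * c ^+ 2 * n%:R.
  rewrite AE -[X in 4 * c ^+ 2 * X]Rintegral_sqnorm -!RintegralZl// -RintegralB//; last first.
    exact: (integrableZl measurableT (4 * c) iX).
  rewrite -RintegralD//; last 2 first.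
  - exact: (integrableB measurableT iG (integrableZl measurableT (4 * c) iX)).
  - exact: (integrableZl measurableT (4 * c ^+ 2) is_).
  apply: eq_Rintegral => x _; rewrite /sqnorm !mulr_sumr -sumrB -big_split/=.
  apply: eq_bigr => i _; rewrite !mxE gradE (class_C1_sqnorm R n).2; ring.
have optimize (m v e a1 a2 b G : R) : m = a1 - c * n%:R ->
    v = a2 - 2 * c * b + c ^+ 2 * (n%:R ^+ 2 + 2 * n%:R) ->
    e = G - 4 * c * A + 4 * c ^+ 2 * n%:R -> b = A + n%:R * a1 ->
    v - m ^+ 2 <= e -> a2 - a1 ^+ 2 <= G - (2 * n%:R)^-1 * A ^+ 2.
  move=> -> -> -> -> H; rewrite -subr_ge0; move: H; rewrite -subr_ge0.
  rewrite [X in 0 <= X -> _](_ : _ = G - (2 * n%:R)^-1 * A ^+ 2 - (a2 - a1 ^+ 2))//.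
  by rewrite /c; field.
exact: optimize E1 E2 E3 bE (poincare_sobolev Sg).
Qed.

(** A function of infinite energy satisfies the inequality trivially, since the
   integral of its Laplacian is finite; otherwise [f] is a Sobolev function by
   the Poincare inequality. *)
Theorem refined_poincare_gaussian : refined_Poincare R n.
Proof.
move=> f Sf iL.
have C1 := Sf 1%N; have C2 := Sf 2%N.
have LE : (\int[gamma]_x (laplacian f x)%:E = (\int[gamma]_x laplacian f x)%R%:E)%E.
  by rewrite fineK// integrable_fin_num.
have [Gfin|] := ltP (\int[gamma]_x (sqnorm (gradient f x))%:E)%E +oo%E; last first.
  by rewrite leye_eq => /eqP; rewrite LE => ->; rewrite -EFin_expe -EFinM addye// leey.
have S := sobolev_of_finite_energy C1 Gfin; have [_ Lf _] := S.
have := refined_poincare_sobolev S C2 iL.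
rewrite /Var LE.
have -> : (\int[gamma]_x (f x ^+ 2)%:E = (\int[gamma]_x (f x ^+ 2))%R%:E)%E.
  by rewrite fineK// integrable_fin_num//; case: Lf.
have -> : (\int[gamma]_x (f x)%:E = (\int[gamma]_x f x)%R%:E)%E.
  by rewrite fineK// integrable_fin_num//; exact: square_integrable_integrable.
have -> : (\int[gamma]_x (sqnorm (gradient f x))%:E = (\int[gamma]_x sqnorm (gradient f x))%R%:E)%E.
  by rewrite fineK// integrable_fin_num//; exact: integrable_sqnorm_gradient.
by rewrite -!EFin_expe -EFinM -!EFinB lee_fin.
Qed.

End refined_poincare.

Theorem corollary5p4 (R : realType) (n : nat) (n_gt0 : (0 < n)%N) :
  refined_Talagrand R n
  /\ (refined_Talagrand R n -> classical_Talagrand R n)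
  /\ (refined_Talagrand R n -> refined_Poincare R n).
Proof.
split; first exact: refined_talagrand_gaussian.
split; first exact: classical_of_refined.
by move=> _; exact: refined_poincare_gaussian.
Qed.
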